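(* Let $G \leq \mathrm{Homeo}(\mathfrak{C})$ be a finitely generated simple vigorous group. Let $k \geq 2$ and let $m_1, \dots, m_k \geq 2$ be integers, where $\{m_1, m_2\} \neq \{2\}$ if $k = 2$. Then $G$ has a minimal generating set $\{\alpha_1, \dots, \alpha_k\}$ of size $k$ where $|\alpha_i| = m_i$ for all $1 \leq i \leq k$. In particular, $m(G) = \infty$.
   Context: $\mathfrak{C}$ denotes Cantor space and $\mathrm{Homeo}(\mathfrak{C})$ its group of homeomorphisms, acting on the right. A group $G \leq \mathrm{Homeo}(\mathfrak{C})$ is vigorous if for every clopen subset $A$ of $\mathfrak{C}$ and all proper nonempty clopen subsets $B$ and $C$ of $A$ there exists $\gamma \in G$ such that $B\gamma \subseteq C$ and $\gamma$ fixes $\mathfrak{C} \setminus A$ pointwise. A generating set $X$ of a group $G$ is minimal if no proper subset of $X$ generates $G$. For a finitely generated group $G$ (whose minimal generating sets are all finite), $m(G)$ denotes the supremum of the sizes of the minimal generating sets of $G$. $|\alpha|$ denotes the order of an element $\alpha$. *)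

(* Defs.v *)
From HB Require Import structures.
From mathcomp Require Import all_boot all_order all_algebra.
From mathcomp Require Import boolp classical_sets functions cardinality.
From mathcomp Require Import reals ereal topology cantor.

Set Implicit Arguments.
Unset Strict Implicit.
Unset Printing Implicit Defensive.

Local Open Scope group_scope.
Local Open Scope classical_set_scope.

(* Infinite groups are instances of [groupType]; a subgroup
   of [gT : groupType] is a set [G : set gT] satisfying [subgroup]. *)

Section AbstractGroups.
Variable gT : groupType.
Implicit Types (G N X Y : set gT) (x : gT).

Definition subgroup G := group_closed (mem G).

Definition generated X : set gT := smallest subgroup X.

Definition finitely_generated G :=
  exists2 X : set gT, finite_set X & generated X = G.

Definition normal_in N G :=
  [/\ subgroup N, N `<=` G & forall x g, N x -> G g -> N (x ^ g)].

Definition simple_group G :=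
  G <> [set 1] /\ forall N, normal_in N G -> N = [set 1] \/ N = G.

Definition minimal_generating_set X G :=
  generated X = G /\ forall Y, Y `<` X -> generated Y <> G.

(* [m(G)].  Only finite minimal generating sets are taken into account: if [G]
   is finitely generated, all its minimal generating sets are finite. *)
Definition max_minimal_size (R : realType) G : \bar R :=
  ereal_sup [set (n%:R : R)%R%:E%E | n in [set n | exists2 X : set gT,
    (X #= `I_n)%card & minimal_generating_set X G]].

Definition has_order x (n : nat) :=
  [/\ (0 < n)%N, x ^+ n = 1 & forall j, (0 < j < n)%N -> x ^+ j <> 1].

End AbstractGroups.

Record homeo (T : topologicalType) := Homeo {
  homeo_fun :> T -> T;
  homeo_inv : T -> T;
  homeo_funK : cancel homeo_fun homeo_inv;
  homeo_invK : cancel homeo_inv homeo_fun;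
  homeo_fun_continuous : continuous homeo_fun;
  homeo_inv_continuous : continuous homeo_inv }.

Section HomeoGroup.
Variable T : topologicalType.
Implicit Types f g h : homeo T.

Lemma homeo_eqP f g : f =1 g -> f = g.
Proof.
case: f g => [f f' fK f'K cf cf'] [g g' gK g'K cg cg'] /= /funext efg.
case: _ / efg gK g'K cg => gK g'K cg.
have /funext efg' : f' =1 g' by move=> x; rewrite -[x in LHS]g'K fK.
case: _ / efg' gK g'K cg' => gK g'K cg'.
congr Homeo; exact: Prop_irrelevance.
Qed.

Definition homeo_one : homeo T :=
  @Homeo T idfun idfun (fun=> erefl) (fun=> erefl)
    (fun x => @cvg_id _ _) (fun x => @cvg_id _ _).

Lemma homeo_comp_continuous (f g : T -> T) :
  continuous f -> continuous g -> continuous (g \o f).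
Proof. by move=> cf cg x; apply: continuous_comp; [exact: cf|exact: cg]. Qed.

(* Homeomorphisms act on the right: [f * g] is [f] followed by [g]. *)
Definition homeo_mul f g : homeo T :=
  @Homeo T (g \o f) (homeo_inv f \o homeo_inv g)
    (can_comp (@homeo_funK _ g) (@homeo_funK _ f))
    (can_comp (@homeo_invK _ f) (@homeo_invK _ g))
    (homeo_comp_continuous (@homeo_fun_continuous _ f)
       (@homeo_fun_continuous _ g))
    (homeo_comp_continuous (@homeo_inv_continuous _ g)
       (@homeo_inv_continuous _ f)).

Definition homeo_invg f : homeo T :=
  @Homeo T (homeo_inv f) f (@homeo_invK _ f) (@homeo_funK _ f)
    (@homeo_inv_continuous _ f) (@homeo_fun_continuous _ f).

Lemma homeo_mulA : associative homeo_mul.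
Proof. by move=> f g h; apply: homeo_eqP. Qed.

Lemma homeo_mul1g : left_id homeo_one homeo_mul.
Proof. by move=> f; apply: homeo_eqP. Qed.

Lemma homeo_mulg1 : right_id homeo_one homeo_mul.
Proof. by move=> f; apply: homeo_eqP. Qed.

Lemma homeo_mulVg : left_inverse homeo_one homeo_invg homeo_mul.
Proof. by move=> f; apply: homeo_eqP => x /=; rewrite homeo_invK. Qed.

Lemma homeo_mulgV : right_inverse homeo_one homeo_invg homeo_mul.
Proof. by move=> f; apply: homeo_eqP => x /=; rewrite homeo_funK. Qed.

HB.instance Definition _ := gen_eqMixin (homeo T).
HB.instance Definition _ := gen_choiceMixin (homeo T).
HB.instance Definition _ := isGroup.Build (homeo T)
  homeo_mulA homeo_mul1g homeo_mulg1 homeo_mulVg homeo_mulgV.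

End HomeoGroup.

Definition vigorous (G : set (homeo cantor_space)) :=
  forall A B C : set cantor_space, clopen A -> clopen B -> clopen C ->
    B !=set0 -> B `<` A -> C !=set0 -> C `<` A ->
    exists2 g, G g & g @` B `<=` C /\ (forall x, ~ A x -> g x = x).

(* Main.v *)
(* Elements of a simple vigorous group [G] coincide near any point with elements of [G] of
   small support. Hence every even permutation of disjoint clopen copies of a set (a
   multisection) lies in [G], and [G] is generated by the 3-cycles of this kind; those carried
   by two overlapping clopen sets generate those carried by their union. So a subgroup [H] is
   [G] as soon as it contains the 3-cycles carried by each member of a suitable clopen cover.

   The two main generators act on [(k+1) J] disjoint copies of the whole Cantor space: [beta]
   permutes them by [rho], and [alpha] by [sigma], twisted by elements of [G] on some copies
   and by a link that makes a residual clopen set [Z] visit one copy. The cycles of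
   [sigma * rho] are one of prime length [k+2] and one long ring which meets all labels and
   the link; these cost only a period prime to [k+2], so a power of [alpha * beta] is the
   short cycle [Omega]. From [Omega] and [rho] one gets 3-cycles of copies, which isolate the
   labels; by simplicity [H] then contains [G] acting on a single copy, hence the 3-cycles
   carried by all copies and by [Z]. Each further generator links a private clopen piece to
   the copies. Every generator moves a point that all the others fix, which gives
   minimality. When all orders are 2, [rho] is of order 3 and [beta] is replaced by two
   involutions with product [beta]. *)

Require Import Defs.
From mathcomp Require Import all_boot all_order all_algebra perm.
From mathcomp Require Import boolp classical_sets functions cardinality.
From mathcomp Require Import reals ereal topology cantor.
From mathcomp Require Import zify.

Set Implicit Arguments.
Unset Strict Implicit.
Unset Printing Implicit Defensive.

Local Open Scope group_scope.
Local Open Scope classical_set_scope.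

(** * Subgroups and clopen sets *)

(** The orders of [alpha] and [beta] are prescribed exactly, so whatever [alpha] carries besides
    [sigma] has to commute with [mp sigma] and to have trivial [m]-th power, [m = m'.+2]. Hence the
    labels are elements of [G] with trivial [m]-th power (by simplicity these generate [G]), and
    they and the link sit on fixed points of [sigma], the leaves [vx i 1] with [0 < i]. A leaf uses
    a type strictly between the two types [0] and [n'.+2] shared by [rho] and [sig0]; this is why
    [rho] has order at least 3. The labels form a coboundary along [sigma * rho], so they multiply
    to 1 along a full turn of the ring and do not affect its period. The numbers of cycles are
    [k.+1 * m'.+1] for [rho], [k.+1 * n'.+2] for [sigma] and 2 for the product, on [k.+1 * J]
    points: Euler characteristic 2, a hypermap on the sphere. With [k.+2] prime, the ring size is
    congruent to [- J] modulo [k.+2], so a large [k] makes all ring periods prime to [k.+2]. Such a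
    [k] is odd, so the number of fibres is even and permutations of types are even on the copies,
    hence realised in [G]. *)

Section Subgroups.
Variable gT : groupType.
Implicit Types (G X : set gT) (x y : gT).

Lemma subgroupP G : subgroup G <->
  [/\ G 1, forall x y, G x -> G y -> G (x * y) & forall x, G x -> G x^-1].
Proof.
have mE x : (x \in mem G) = (x \in G) by [].
split=> [sG|[G1 GM GV]].
  have [G1 _] := sG.
  have GV := group_closedV sG; have GM := group_closedM sG.
  split; first by move: G1; rewrite mE inE.
    by move=> x y /mem_set xG /mem_set yG; have := GM x y xG yG; rewrite mE inE.
  by move=> x /mem_set xG; have := GV x xG; rewrite mE inE.
split=> [|x y]; rewrite !mE !inE //.
by move=> Gx Gy; apply: GM => //; apply: GV.
Qed.

Lemma subgroup1 G : subgroup G -> G 1. Proof. by case/subgroupP. Qed.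

Lemma subgroupM G x y : subgroup G -> G x -> G y -> G (x * y).
Proof. by case/subgroupP => _ + _; apply. Qed.

Lemma subgroupV G x : subgroup G -> G x -> G x^-1.
Proof. by case/subgroupP => _ _; apply. Qed.

Lemma subgroupX G x n : subgroup G -> G x -> G (x ^+ n).
Proof.
move=> sG Gx; elim: n => [|n IHn]; first exact: subgroup1.
by rewrite expgS; apply: subgroupM.
Qed.

Lemma subgroupJ G x y : subgroup G -> G x -> G y -> G (x ^ y).
Proof. by move=> sG Gx Gy; apply: subgroupM (subgroupV sG Gy) (subgroupM sG Gx Gy). Qed.

Lemma generated_subgroup X : subgroup (generated X).
Proof.
apply/subgroupP; split=> [H [sH _]|x y gx gy H sXH|x gx H sXH].
- exact: subgroup1.
- by case: (sXH) => sH _; apply: subgroupM (gx _ sXH) (gy _ sXH).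
- by case: (sXH) => sH _; apply: subgroupV (gx _ sXH).
Qed.

Lemma generated_sub X G : subgroup G -> X `<=` G -> generated X `<=` G.
Proof. by move=> sG XG x; apply. Qed.

Lemma sub_generated X : X `<=` generated X.
Proof. by move=> x Xx H [_]; apply. Qed.

Lemma generated_mono X Y : X `<=` Y -> generated X `<=` generated Y.
Proof.
by move=> XY; apply: generated_sub (generated_subgroup _) (subset_trans XY (@sub_generated _)).
Qed.

Lemma generated_normal G X : subgroup G -> X `<=` G ->
  (forall x g, X x -> G g -> X (x ^ g)) -> normal_in (generated X) G.
Proof.
move=> sG XG XJ; split; first exact: generated_subgroup.
  exact: generated_sub.
move=> x g gx Gg; have [g1 gM gV] := (subgroupP _).1 (generated_subgroup X).
suff : [set x | generated X (x ^ g)] x by [].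
apply: gx; split=> [|y Xy]; last by apply: sub_generated; apply: XJ.
apply/subgroupP; split=> /= [|a b ga gb|a ga]; first by rewrite conj1g.
  by rewrite conjMg; apply: gM.
by rewrite conjVg; apply: gV.
Qed.

Lemma generated_simple G X x : subgroup G -> simple_group G -> X `<=` G ->
  (forall x g, X x -> G g -> X (x ^ g)) -> X x -> x <> 1 -> generated X = G.
Proof.
move=> sG [_ simG] XG XJ Xx x1.
have [E|//] := simG _ (generated_normal sG XG XJ).
by have := sub_generated Xx; rewrite E.
Qed.

(** Each element is a word in finitely many members of [X]; this extracts a finite generating set
    from an infinite conjugation-invariant one. *)
Lemma generated_finite_support X (s : seq gT) : (forall x, x \in s -> generated X x) ->
  exists2 t : seq gT, (forall x, x \in t -> X x) &
    forall x, x \in s -> generated [set y | y \in t] x.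
Proof.
have one x : generated X x -> exists2 t : seq gT, (forall x, x \in t -> X x) &
    generated [set y | y \in t] x.
  move=> gx; suff : [set x | exists2 t : seq gT, (forall x, x \in t -> X x) &
    generated [set y | y \in t] x] x by [].
  apply: gx; split=> [|y Xy]; last first.
    exists [:: y] => [z|]; first by rewrite inE => /eqP ->.
    by apply: sub_generated; rewrite /= inE.
  apply/subgroupP; split=> [|y z [t tX gy] [u uX gz]|y [t tX gy]].
  - by exists [::] => //; exact: (subgroup1 (generated_subgroup _)).
  - exists (t ++ u) => [w|]; first by rewrite mem_cat => /orP[/tX|/uX].
    apply: (subgroupM (generated_subgroup _)).
      by apply: generated_mono gy => w /= wt; rewrite mem_cat wt.
    by apply: generated_mono gz => w /= wt; rewrite mem_cat wt orbT.
  - by exists t => //; exact: (subgroupV (generated_subgroup _)).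
elim: s => [|x s IHs] sX; first by exists [::].
have [|t tX gt] := IHs; first by move=> y ys; apply: sX; rewrite inE ys orbT.
have [u uX gu] := one x (sX x (mem_head _ _)).
exists (u ++ t) => [w|y]; first by rewrite mem_cat => /orP[/uX|/tX].
rewrite inE => /orP[/eqP ->|/gt gy].
  by apply: generated_mono gu => w /= wt; rewrite mem_cat wt.
by apply: generated_mono gy => w /= wt; rewrite mem_cat wt orbT.
Qed.

End Subgroups.

Notation T := cantor_space.

Arguments homeo_fun : simpl never.
Arguments monoid.inv : simpl never.
Arguments monoid.mul : simpl never.
Arguments monoid.one : simpl never.

Section Homeos.
Implicit Types (f g h : homeo T) (x y : T).

Lemma homeo1E x : (1 : homeo T) x = x. Proof. by []. Qed.
Lemma homeoME f g x : (f * g) x = g (f x). Proof. by []. Qed.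
Lemma homeoVK f : cancel f (f^-1)%g. Proof. exact: homeo_funK. Qed.
Lemma homeoKV f : cancel (f^-1)%g f. Proof. exact: homeo_invK. Qed.
Lemma homeo_inj f : injective f. Proof. exact: can_inj (homeoVK f). Qed.
Lemma homeoP f g : (forall x, f x = g x) -> f = g. Proof. exact: homeo_eqP. Qed.
Lemma homeoJE f g x : (f ^ g) x = g (f (g^-1 x)). Proof. by []. Qed.
Lemma homeoVE f x y : f x = y -> f^-1 y = x. Proof. by move=> <-; rewrite homeoVK. Qed.

Lemma clopen_preimage f (A : set T) : clopen A -> clopen [set x | A (f x)].
Proof. move=> cA; exact: (preimage_clopen cA (@homeo_fun_continuous _ f)). Qed.

Lemma image_homeo f (A : set T) : f @` A = [set x | A (f^-1 x)].
Proof.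
apply/seteqP; split=> [_ [x Ax <-]|x Ax] /=; first by rewrite homeoVK.
by exists (f^-1 x) => //; rewrite homeoKV.
Qed.

Lemma clopen_image f (A : set T) : clopen A -> clopen (f @` A).
Proof. by rewrite image_homeo; apply: clopen_preimage. Qed.

End Homeos.

(** * Splitting clopen sets, and compactness as an induction principle *)

Section ClopenSets.
Implicit Types (A B U V W : set T) (x y : T).

Lemma clopen_nbhs A x : clopen A -> A x -> nbhs x A.
Proof. by move=> [oA _] Ax; apply: open_nbhs_nbhs. Qed.

Lemma clopen_compl A : clopen A -> clopen (~` A).
Proof. by move=> cA; apply: (@clopenC _ A A). Qed.

Lemma clopenD A B : clopen A -> clopen B -> clopen (A `\` B).
Proof. by move=> cA cB; rewrite setDE; apply: clopenI => //; apply: clopen_compl. Qed.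

Lemma clopen_avoid1 A x : clopen A -> A !=set0 ->
  exists V, [/\ clopen V, V !=set0, V `<=` A & ~ V x].
Proof.
move=> cA A0; have [oA _] := cA.
have [y [z [Ay Az yz]]] := perfectTP_ex.1 cantor_perfect A oA A0.
have [w Aw xw] : exists2 w, A w & w != x.
  have [yx|yx] := eqVneq y x; last by exists y.
  by exists z => //; rewrite -yx eq_sym.
have [V [cV Vw Vx]] := cantor_zero_dimensional xw.
by exists (A `&` V); split; [apply: clopenI|exists w|move=> ? []|case].
Qed.

Lemma clopen_avoid A (s : seq T) : clopen A -> A !=set0 ->
  exists V, [/\ clopen V, V !=set0, V `<=` A & forall x, x \in s -> ~ V x].
Proof.
move=> cA A0; elim: s => [|x s [V [cV V0 VA Vs]]]; first by exists A; split.
have [W [cW W0 WV Wx]] := clopen_avoid1 x cV V0.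
exists W; split=> //; first exact: subset_trans WV VA.
by move=> y; rewrite inE => /orP[/eqP ->|/Vs nVy] // /WV.
Qed.

Lemma clopen_split A : clopen A -> A !=set0 ->
  exists B, [/\ clopen B, B !=set0, B `<=` A & (A `\` B) !=set0].
Proof.
move=> cA /[dup] A0 [x Ax]; have [B [cB B0 BA Bx]] := clopen_avoid1 x cA A0.
by exists B; split => //; exists x.
Qed.

(** The pieces are the successive differences of a decreasing sequence obtained by iterated
    splitting. *)
Lemma clopen_pieces A : clopen A -> A !=set0 -> exists C : nat -> set T,
  [/\ forall i, clopen (C i), forall i, C i !=set0, forall i, C i `<=` A &
      forall i j x, C i x -> C j x -> i = j].
Proof.
move=> cA A0.
(* The splitting must be a total function in order to be iterated; it takes the junk value [set0]
   outside nonempty clopen sets. *)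
have /choice [h hP] : forall B : set T, exists B' : set T,
    clopen B -> B !=set0 -> [/\ clopen B', B' !=set0, B' `<=` B & (B `\` B') !=set0].
  move=> B; have [[cB B0]|nB] := pselect (clopen B /\ B !=set0).
    by have [B' ?] := clopen_split cB B0; exists B'.
  by exists set0 => cB B0; exfalso; apply: nB.
pose R i := iter i h A.
have RP i : clopen (R i) /\ R i !=set0.
  elim: i => [//|i [cR R0]] /=; by have [] := hP _ cR R0.
have Rm i j : (i <= j)%N -> R j `<=` R i.
  elim: j => [|j IHj]; first by rewrite leqn0 => /eqP ->.
  rewrite leq_eqVlt => /orP[/eqP -> //|]; rewrite ltnS => /IHj; apply: subset_trans.
  by have [cR R0] := RP j; have [_ _ h3 _] := hP _ cR R0; exact: h3.
exists (fun i => R i `\` R i.+1); split=> [i|i|i x [Rx _]|i j x].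
- by apply: clopenD; apply: (RP _).1.
- by have [cR R0] := RP i; have [_ _ _ h4] := hP _ cR R0; exact: h4.
- exact: (Rm 0%N i) Rx.
- move=> [Rix Rix'] [Rjx Rjx']; apply/eqP; case: ltngtP => // ij.
    by case: Rix'; apply: Rm Rjx.
  by case: Rjx'; apply: Rm Rix.
Qed.

Lemma clopen_fin_pieces (J : finType) A : clopen A -> A !=set0 ->
  exists (C : J -> set T) (R : set T),
  [/\ forall i, [/\ clopen (C i), C i !=set0, C i `<=` A & C i `&` R = set0],
      forall i j x, C i x -> C j x -> i = j & [/\ clopen R, R !=set0 & R `<=` A]].
Proof.
move=> cA A0; have [C [cC C0 CA Cd]] := clopen_pieces cA A0.
exists (fun j => C (enum_rank j)), (C #|J|); split=> //.
  move=> i; split=> //; apply/seteqP; split=> // x [Cx Cx'].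
  by have := ltn_ord (enum_rank i); rewrite (Cd _ _ _ Cx Cx') ltnn.
by move=> i j x Ci Cj; apply/enum_rank_inj/val_inj; apply: Cd Ci Cj.
Qed.

(** Compactness: finitely many of the sets [V] cover [U], and removing them one after another cuts
    [U] into disjoint clopen pieces, each inside one [V]. *)
Lemma clopen_ind (Q : set T -> Prop) U : clopen U -> Q set0 ->
  (forall x, U x -> exists V, [/\ clopen V, V x &
     forall W, clopen W -> W `<=` V -> W `<=` U -> Q W]) ->
  (forall A B, clopen A -> clopen B -> A `<=` U -> B `<=` U -> A `&` B = set0 ->
     Q A -> Q B -> Q (A `|` B)) -> Q U.
Proof.
move=> cU Q0 Qloc QU.
have /choice [V VP] : forall x, exists V, clopen V /\ (U x -> V x /\
    forall W, clopen W -> W `<=` V -> W `<=` U -> Q W).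
  move=> x; have [/Qloc [V [cV Vx VQ]]|nUx] := pselect (U x); first by exists V.
  by exists set0; split=> //; exact: clopen0.
have : compact U.
  by apply: subclosed_compact cantor_space_compact _ => //; case: cU.
rewrite compact_cover => /(_ _ U V)[||D DU UD].
- by move=> x _; case: (VP x) => [[]].
- by move=> x Ux; exists x => //; case: (VP x) => _ /(_ Ux)[].
have Qs (s : seq T) : (forall i, i \in s -> U i) -> forall W, clopen W -> W `<=` U ->
    (forall x, W x -> exists2 i, i \in s & V i x) -> Q W.
  elim: s => [_ W cW WU Ws|i s IHs sU W cW WU Ws].
    by rewrite (_ : W = set0) //; apply/seteqP; split=> // x /Ws[].
  have cV := (VP i).1; have [Vi ViQ] := (VP i).2 (sU i (mem_head _ _)).
  have -> : W = (W `&` V i) `|` (W `\` V i) by rewrite setUIDK.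
  apply: QU; first exact: clopenI.
  - exact: clopenD.
  - by move=> x [/WU].
  - by move=> x [/WU].
  - by apply/seteqP; split=> // x [[_ ?] []].
  - by apply: ViQ; [exact: clopenI|move=> x []|move=> x [/WU]].
  apply: IHs; first by move=> j js; apply: sU; rewrite inE js orbT.
  - exact: clopenD.
  - by move=> x [/WU].
  by move=> x [/Ws[j]]; rewrite inE => /orP[/eqP -> //|js] Vj _; exists j.
by apply: (Qs (finmap.enum_fset D)) => // i /DU; rewrite inE.
Qed.

End ClopenSets.

(** * Multisections and wreath permutations *)

Definition locally_in (G : set (homeo T)) (E : set T) (f : T -> T) :=
  forall x, E x -> exists U g,
    [/\ clopen U, U x, G g & forall y, U y -> E y -> f y = g y].

(** The topological full group of [G]. *)
Definition full (G : set (homeo T)) : set (homeo T) :=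
  [set f : homeo T | locally_in G setT f].

Section LocallyIn.
Variable G : set (homeo T).
Hypothesis sG : subgroup G.
Implicit Types (E U : set T) (f : T -> T) (g h : homeo T) (x y : T).

Lemma locally_in_sub E U f : U `<=` E -> locally_in G E f -> locally_in G U f.
Proof.
move=> UE lf x /UE /lf [V [g [cV Vx Gg fg]]]; exists V, g; split=> // y Vy /UE.
exact: fg.
Qed.

Lemma locally_in_homeo E g : G g -> locally_in G E g.
Proof. by move=> Gg x Ex; exists setT, g; split=> //; exact: clopenT. Qed.

Lemma locally_in_id E : locally_in G E id.
Proof.
move=> x Ex; by exists setT, 1; split=> //; [exact: clopenT|exact: subgroup1].
Qed.

Lemma locally_in_comp E E' f f' : locally_in G E f -> locally_in G E' f' ->
  (forall x, E x -> E' (f x)) -> locally_in G E (f' \o f).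
Proof.
move=> lf lf' EE' x Ex; have [U [g [cU Ux Gg fg]]] := lf x Ex.
have [U' [g' [cU' Ux' Gg' fg']]] := lf' _ (EE' _ Ex).
exists (U `&` [set y | U' (g y)]), (g * g'); split.
- by apply: clopenI => //; apply: clopen_preimage.
- by split=> //=; rewrite -fg.
- exact: subgroupM.
move=> y [Uy Uy'] Ey /=; rewrite homeoME fg' ?fg //.
by rewrite -fg //; apply: EE'.
Qed.

Lemma locally_in_ext E f f' : (forall x, E x -> f x = f' x) ->
  locally_in G E f -> locally_in G E f'.
Proof.
move=> ff' lf x Ex; have [U [g [cU Ux Gg fg]]] := lf x Ex.
by exists U, g; split=> // y Uy Ey; rewrite -ff' // fg.
Qed.

Lemma full_subgroup : subgroup (full G).
Proof.
apply/subgroupP; split=> [|f g lf lg|f lf].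
- exact: locally_in_id.
- exact: locally_in_comp lf lg _.
move=> x _; have [U [g [cU Ux Gg fg]]] := lf (f^-1 x) I.
exists [set y | U (f^-1 y)], g^-1; split=> //; first exact: clopen_preimage.
  exact: subgroupV.
by move=> y /= Uy _; apply/esym/homeoVE; rewrite -fg // homeoKV.
Qed.

Lemma sub_full : G `<=` full G. Proof. by move=> g Gg; apply: locally_in_homeo. Qed.

Lemma locally_in_clopen_image E f : clopen E -> locally_in G E f -> clopen (f @` E).
Proof.
move=> cE lf; apply: (@clopen_ind (fun W => clopen (f @` W)) E cE).
- by rewrite image_set0; exact: clopen0.
- move=> x Ex; have [U [g [cU Ux Gg fg]]] := lf x Ex; exists U; split=> // W cW WU WE.
  have -> : f @` W = g @` W.
    apply/seteqP; split=> _ [y Wy <-]; exists y => //; first by rewrite fg //; auto.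
    by rewrite fg //; auto.
  exact: clopen_image.
- by move=> A B cA cB AE BE AB fA fB; rewrite image_setU; apply: clopenU.
Qed.

End LocallyIn.

Lemma locally_in_mono (G G' : set (homeo T)) E f : G `<=` G' ->
  locally_in G E f -> locally_in G' E f.
Proof. by move=> GG' lf x /lf [U [g [cU Ux /GG' Gg fg]]]; exists U, g. Qed.

Lemma subgroup_homeoT : subgroup [set: homeo T].
Proof. by apply/subgroupP. Qed.

Lemma locally_in_continuous (G : set (homeo T)) (f : T -> T) :
  locally_in G setT f -> continuous f.
Proof.
move=> lf x; have [U [g [cU Ux Gg fg]]] := lf x I.
move=> A; rewrite fg // => /(@homeo_fun_continuous _ g x) gA.
have : nbhs x ([set y | A (g y)] `&` U) by apply: filterI => //; apply: clopen_nbhs.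
by apply: filterS => y [gAy Uy]; rewrite /= fg.
Qed.

Lemma clopen_exists (J : finType) (A : J -> set T) :
  (forall j, clopen (A j)) -> clopen [set x | exists j, A j x].
Proof.
move=> cA; have cs (s : seq J) : clopen [set x | exists2 j, j \in s & A j x].
  elim: s => [|i s IHs].
    have -> : [set x | exists2 j, j \in [::] & A j x] = set0; last exact: clopen0.
    by apply/seteqP; split=> // x [].
  have -> : [set x | exists2 j, j \in i :: s & A j x] =
      A i `|` [set x | exists2 j, j \in s & A j x]; last exact: clopenU.
  apply/seteqP; split=> [x [j]|x [Aix|[j js Ajx]]].
  - by rewrite inE => /orP[/eqP ->|js] Ajx; [left|right; exists j].
  - by exists i => //; rewrite mem_head.
  - by exists j => //; rewrite inE js orbT.
have -> : [set x | exists j, A j x] = [set x | exists2 j, j \in enum J & A j x] => //.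
by apply/seteqP; split=> x [j Ajx]; exists j => //; rewrite mem_enum.
Qed.

Lemma clopen_forall (J : finType) (A : J -> set T) :
  (forall j, clopen (A j)) -> clopen [set x | forall j, A j x].
Proof.
move=> cA; have -> : [set x | forall j, A j x] = ~` [set x | exists j, (~` A j) x].
  apply/seteqP; split=> x /=; first by move=> Ax [j]; apply.
  by move=> nA j; apply: contrapT => nAj; apply: nA; exists j.
apply: clopen_compl; apply: (@clopen_exists J (fun j => ~` A j)) => j.
exact: clopen_compl.
Qed.

(* Junk value [1] unless [f] and [f'] are mutually inverse homeomorphisms. *)
Definition mk_homeo (f f' : T -> T) : homeo T :=
  if pselect [/\ cancel f f', cancel f' f, continuous f & continuous f'] is left H
  then let: And4 fK f'K cf cf' := H in Homeo fK f'K cf cf' else 1.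

Lemma mk_homeoE f f' : cancel f f' -> cancel f' f -> continuous f -> continuous f' ->
  mk_homeo f f' =1 f.
Proof. by move=> fK f'K cf cf'; rewrite /mk_homeo; case: pselect => [[]|[]]. Qed.

(* Multisections in the groupoid of germs of [G], indexed by [J]. *)
Definition multisection (G : set (homeo T)) (J : finType) (E : set T) (psi : J -> T -> T) :=
  [/\ clopen E, forall j, locally_in G E (psi j) &
      forall i j x y, E x -> E y -> psi i x = psi j y -> i = j /\ x = y].

Section Wreath.
Variables (J : finType) (E : set T) (psi : J -> T -> T).

Definition copies : set T := [set x | exists j, (psi j @` E) x].

(** The pair [(j, y)] is chosen from its image [psi j y]; on a multisection it is unique, so the
    choice does not matter. *)
Definition wreath_fun (s : J -> J) (F : J -> T -> T) (x : T) : T :=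
  if pselect (exists p : J * T, E p.2 /\ psi p.1 p.2 = x) is left H
  then let p := projT1 (cid H) in psi (s p.1) (F p.1 p.2) else x.

Definition wreath (s : {perm J}) (F : J -> homeo T) : homeo T :=
  mk_homeo (wreath_fun s F) (wreath_fun (s^-1)%g (fun j => (F (s^-1 j))^-1)).

Definition preserves (F : J -> homeo T) := forall j y, E (F j y) <-> E y.

Variable (G : set (homeo T)).
Hypothesis sG : subgroup G.
Hypothesis msE : multisection G E psi.
Implicit Types (s t : {perm J}) (F : J -> homeo T).

Lemma wreath_funE s (F : J -> T -> T) j y : E y ->
  wreath_fun s F (psi j y) = psi (s j) (F j y).
Proof.
move=> Ey; rewrite /wreath_fun; case: pselect => [H|[]]; last by exists (j, y).
case: (cid H) => -[i x] /= [Ex eqx]; have [_ _ inj] := msE.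
by have [-> ->] := inj _ _ _ _ Ex Ey eqx.
Qed.

Lemma wreath_funN s (F : J -> T -> T) x : ~ copies x -> wreath_fun s F x = x.
Proof.
move=> nx; rewrite /wreath_fun; case: pselect => // -[[j y] /= [Ey eqx]].
by case: nx; exists j, y.
Qed.

Lemma clopen_copies : clopen copies.
Proof.
have [cE lpsi _] := msE.
by apply: clopen_exists => j; apply: locally_in_clopen_image (lpsi j).
Qed.

Lemma locally_in_wreath_fun s F : preserves F -> (forall j, locally_in G E (F j)) ->
  locally_in G setT (wreath_fun s F).
Proof.
move=> pF lF x _; have [cE lpsi inj] := msE; have [[j [y Ey <-]]|nx] := pselect (copies x).
  have [U [g [cU Uy Gg fg]]] := lpsi j y Ey.
  have : locally_in G E (psi (s j) \o F j).
    by apply: locally_in_comp (lF j) (lpsi _) _ => // z /(pF j z).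
  move=> /(_ y Ey) [V [h [cV Vy Gh fh]]].
  exists [set z | (U `&` V `&` E) (g^-1 z)], (g^-1 * h); split.
  - by apply: clopen_preimage; apply: clopenI => //; apply: clopenI.
  - by rewrite /= fg // homeoVK.
  - by apply: subgroupM => //; apply: subgroupV.
  move=> z /= [[Uz Vz] Ez] _; rewrite -[in LHS](homeoKV g z) -fg // wreath_funE //.
  exact: fh.
exists (~` copies), 1; split=> //.
- exact: clopen_compl clopen_copies.
- exact: subgroup1.
- by move=> y ny _; rewrite wreath_funN.
Qed.

Lemma preservesV s F : preserves F -> preserves (fun j => (F (s^-1 j))^-1).
Proof. by move=> pF j y; rewrite -(pF (s^-1 j)) homeoKV. Qed.

Lemma wreath_funK s F : preserves F ->
  cancel (wreath_fun s F) (wreath_fun (s^-1)%g (fun j => (F (s^-1 j))^-1)).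
Proof.
move=> pF x; have [[j [y Ey <-]]|nx] := pselect (copies x); last by rewrite !wreath_funN.
by rewrite wreath_funE // wreath_funE ?permK ?homeoVK //; apply/pF.
Qed.

End Wreath.

Lemma multisection_mono (G G' : set (homeo T)) (J : finType) E (psi : J -> T -> T) :
  G `<=` G' -> multisection G E psi -> multisection G' E psi.
Proof. by move=> GG' [cE lpsi inj]; split=> // j; apply: locally_in_mono (lpsi j). Qed.

Section WreathHomeo.
Variables (J : finType) (E : set T) (psi : J -> T -> T) (G : set (homeo T)).
Hypothesis sG : subgroup G.
Hypothesis msE : multisection G E psi.
Implicit Types (s t : {perm J}) (F : J -> homeo T).

Lemma wreath_funEE s F : preserves E F -> wreath E psi s F =1 wreath_fun E psi s F.
Proof.
move=> pF.
(* Continuity is obtained with the group of all homeomorphisms in place of [G], since the values of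
   [F] are arbitrary homeomorphisms. *)
have msT : multisection setT E psi by apply: multisection_mono msE.
have cont t F' : preserves E F' -> continuous (wreath_fun E psi t F').
  move=> pF'; apply: (@locally_in_continuous setT).
  apply: (locally_in_wreath_fun subgroup_homeoT msT) => // j.
  exact: locally_in_homeo.
apply: mk_homeoE; last 2 first.
- exact: cont.
- by apply: cont; apply: preservesV.
- exact: (wreath_funK msE).
have := wreath_funK msE (s^-1)%g (preservesV s pF); rewrite invgK.
suff -> : (fun j => homeo_fun ((F ((s^-1)%g (s j)))^-1)^-1%g) =
          (fun j => homeo_fun (F j)) by [].
by apply/funext => j; rewrite invgK permK.
Qed.

Lemma wreathE s F j y : preserves E F -> E y ->
  wreath E psi s F (psi j y) = psi (s j) (F j y).
Proof. by move=> pF Ey; rewrite wreath_funEE // (wreath_funE msE). Qed.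

Lemma wreathN s F x : preserves E F -> ~ copies E psi x -> wreath E psi s F x = x.
Proof. by move=> pF nx; rewrite wreath_funEE // wreath_funN. Qed.

Lemma wreath_ext s F (h : homeo T) : preserves E F ->
  (forall j y, E y -> h (psi j y) = psi (s j) (F j y)) ->
  (forall x, ~ copies E psi x -> h x = x) -> h = wreath E psi s F.
Proof.
move=> pF h1 h2; apply: homeoP => x.
have [[j [y Ey <-]]|nx] := pselect (copies E psi x); first by rewrite wreathE // h1.
by rewrite wreathN // h2.
Qed.

Lemma wreathM s t F F' : preserves E F -> preserves E F' ->
  wreath E psi s F * wreath E psi t F' = wreath E psi (s * t) (fun j => F j * F' (s j)).
Proof.
move=> pF pF'; apply: wreath_ext => [j y|j y Ey|x nx].
- by rewrite homeoME; split=> [/pF' /pF|/pF /pF'].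
- by rewrite homeoME wreathE // wreathE ?permM //; apply/pF.
- by rewrite homeoME !wreathN.
Qed.

Lemma wreath1 : wreath E psi 1 (fun=> 1) = 1.
Proof. by apply/esym/wreath_ext => // j y Ey; rewrite perm1. Qed.

Lemma wreath_full s F : preserves E F -> (forall j, locally_in G E (F j)) ->
  full G (wreath E psi s F).
Proof.
move=> pF lF; apply: (@locally_in_ext _ _ (wreath_fun E psi s F)).
  by move=> x _; rewrite wreath_funEE.
exact: locally_in_wreath_fun.
Qed.

End WreathHomeo.

Definition mperm (J : finType) E (psi : J -> T -> T) (s : {perm J}) :=
  wreath E psi s (fun=> 1).

Section MPerm.
Variables (J : finType) (E : set T) (psi : J -> T -> T) (G : set (homeo T)).
Hypothesis sG : subgroup G.
Hypothesis msE : multisection G E psi.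
Implicit Types (s t : {perm J}) (h : homeo T).
Notation mp := (mperm E psi).

Lemma mpermE s j y : E y -> mp s (psi j y) = psi (s j) y.
Proof. by move=> Ey; rewrite /mperm (wreathE msE). Qed.

Lemma mpermN s x : ~ copies E psi x -> mp s x = x.
Proof. by move=> nx; rewrite /mperm (wreathN msE). Qed.

Lemma mpermM s t : mp (s * t) = mp s * mp t.
Proof. by rewrite /mperm (wreathM msE) // mulg1. Qed.

Lemma mperm1 : mp 1 = 1. Proof. exact: wreath1 msE. Qed.

Lemma mpermV s : mp s^-1 = (mp s)^-1.
Proof. by apply: (mulgI (mp s)); rewrite -mpermM !mulgV mperm1. Qed.

Lemma mpermX s n : mp (s ^+ n) = mp s ^+ n.
Proof. by elim: n => [|n IHn]; rewrite ?mperm1 // !expgS mpermM IHn. Qed.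

Lemma mperm_full s : full G (mp s).
Proof. by apply: wreath_full => // j; apply: locally_in_id. Qed.

Lemma mperm_ext s h : (forall j y, E y -> h (psi j y) = psi (s j) y) ->
  (forall x, ~ copies E psi x -> h x = x) -> h = mp s.
Proof. by move=> h1 h2; apply: (wreath_ext msE). Qed.

End MPerm.

Section MPermChange.
Variables (J : finType) (G : set (homeo T)).
Hypothesis sG : subgroup G.
Implicit Types (E : set T) (psi : J -> T -> T).

Lemma multisection_sub E E' psi : clopen E' -> E' `<=` E ->
  multisection G E psi -> multisection G E' psi.
Proof.
move=> cE' E'E [cE lpsi inj]; split=> // [j|i j x y /E'E Ex /E'E Ey].
  exact: locally_in_sub (lpsi j).
exact: inj.
Qed.

Lemma multisection_comp E psi h : full G h ->
  multisection G E psi -> multisection G E (fun j => h \o psi j).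
Proof.
move=> Gh [cE lpsi inj]; split=> // [j|i j x y Ex Ey /homeo_inj]; last exact: inj.
exact: locally_in_comp (lpsi j) Gh _.
Qed.

Lemma mperm_conj E psi s h : full G h -> multisection G E psi ->
  mperm E psi s ^ h = mperm E (fun j => h \o psi j) s.
Proof.
move=> Gh msE; have msh := multisection_comp Gh msE.
apply: (mperm_ext msh) => [j y Ey /=|x nx].
  by rewrite homeoJE homeoVK (mpermE msE).
rewrite homeoJE (mpermN msE) ?homeoKV // => -[j [y Ey yx]].
by apply: nx; exists j, y; rewrite //= yx homeoKV.
Qed.

Lemma mperm_setU E1 E2 psi s : multisection G (E1 `|` E2) psi ->
  clopen E1 -> clopen E2 -> E1 `&` E2 = set0 ->
  mperm (E1 `|` E2) psi s = mperm E1 psi s * mperm E2 psi s.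
Proof.
move=> ms c1 c2 E12.
have ms1 := multisection_sub c1 (@subsetUl _ E1 E2) ms.
have ms2 := multisection_sub c2 (@subsetUr _ E1 E2) ms.
have [_ _ inj] := ms.
have disj x : E1 x -> E2 x -> False by move=> E1x E2x; have : set0 x by rewrite -E12.
apply/esym/(mperm_ext ms) => [j y [Ey|Ey]|x nx].
- rewrite homeoME (mpermE ms1) // (mpermN ms2) // => -[i [z Ez]].
  by case/inj; [right|left|move=> _ zy; apply: (disj y) => //; rewrite -zy].
- rewrite homeoME (mpermN ms1) ?(mpermE ms2) // => -[i [z Ez]].
  by case/inj; [left|right|move=> _ zy; apply: (disj z) => //; rewrite zy].
- rewrite homeoME (mpermN ms1) ?(mpermN ms2) // => -[j [y Ey yx]]; apply: nx.
    by exists j, y => //; right.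
  by exists j, y => //; left.
Qed.

Lemma mperm0 psi s : mperm set0 psi s = 1.
Proof.
have ms : multisection G set0 psi.
  by split=> // [|j x []]; exact: clopen0.
by apply/esym/(mperm_ext ms).
Qed.

End MPermChange.

(** * Localization in vigorous groups *)

Lemma homeo_support (g : homeo T) (A : set T) : (forall x, ~ A x -> g x = x) ->
  forall x, A (g x) <-> A x.
Proof.
move=> gA x; split=> [Agx|Ax]; apply: contrapT => nA.
  by apply: (nA); rewrite -(gA x nA).
by apply: (nA); rewrite (homeo_inj (gA _ nA)).
Qed.

Section Vigorous.
Variable G : set (homeo T).
Hypotheses (sG : subgroup G) (vigG : vigorous G).
Implicit Types (A B C U V W : set T) (x y : T) (f g h : homeo T).

(** A handier form of vigour, with [B] possibly empty and [C] possibly all of [A]: the target is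
    first shrunk to a proper clopen part of [C]. *)
Lemma vigor A B C : clopen A -> clopen B -> clopen C -> B `<=` A -> (A `\` B) !=set0 ->
  C !=set0 -> C `<=` A -> exists g, [/\ G g, forall x, B x -> C (g x),
     forall x, ~ A x -> g x = x & forall x, ~ A x -> g^-1 x = x].
Proof.
move=> cA cB cC BA [a [Aa Ba]] C0 CA.
suff [g [Gg gB gA]] : exists g, [/\ G g, forall x, B x -> C (g x) & forall x, ~ A x -> g x = x].
  by exists g; split=> // x /gA gx; apply: homeoVE.
have [B0|B0] := pselect (B !=set0); last first.
  by exists 1; split=> // [|x Bx]; [exact: subgroup1|case: B0; exists x].
have [C' [cC' C'0 C'C [c [Cc C'c]]]] := clopen_split cC C0.
have [] := @vigG A B C' => //.
- by split=> // AB; apply/Ba/AB.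
- by split=> [x /C'C/CA //|/(_ c (CA c Cc))].
move=> g Gg [gB gA]; exists g; split=> // x Bx; apply: C'C; apply: gB.
by exists x.
Qed.

Lemma spread (J : Type) V (C : J -> set T) : clopen V -> (~` V) !=set0 ->
  (forall j, clopen (C j)) -> (forall j, C j !=set0) ->
  exists g : J -> homeo T, forall j, G (g j) /\ forall x, V x -> C j (g j x).
Proof.
move=> cV [a Va] cC C0.
suff /choice[g gP] : forall j, exists g : homeo T, G g /\ forall x, V x -> C j (g x) by exists g.
move=> j; have [|g [Gg gV _ _]] := vigor clopenT cV (cC j) (@subsetT _ V) _ (C0 j) (@subsetT _ (C j)).
  by exists a.
by exists g.
Qed.

End Vigorous.

Section Localization.
Variable G : set (homeo T).
Hypotheses (sG : subgroup G) (vigG : vigorous G).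
Implicit Types (A B C U V W : set T) (x y : T) (f g h : homeo T).

(** That [W] contains both [x] and [f x] is forced, since a homeomorphism supported in [W] preserves
    [W]. *)
Definition localizable f := forall x W, clopen W -> W x -> W (f x) ->
  exists U g, [/\ clopen U, U x, G g, forall y, U y -> g y = f y & forall y, ~ W y -> g y = y].

(** The conjugate [g ^ t] works when [t] fixes [U] and its image under [g], and pushes everything
    else outside [F'] into [B], inside [W]: a point outside [W] then comes under [t] from [F'],
    where [g] is the identity. *)
Lemma localizable_fixing g F : G g -> clopen F -> F !=set0 ->
  (forall x, F x -> g x = x) -> localizable g.
Proof.
move=> Gg cF F0 gF x W cW Wx Wgx.
have [F' [cF' F'0 F'F F'x]] := clopen_avoid [:: x; g x] cF F0.
have [B [cB B0 BW Bx]] : exists V, [/\ clopen V, V !=set0, V `<=` W &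
    forall y, y \in [:: x; g x] -> ~ V y] by apply: clopen_avoid => //; exists x.
pose D := W `\` B `\` F'.
have cD : clopen D by apply: clopenD => //; apply: clopenD.
pose U := D `&` [set y | D (g y)].
have cU : clopen U by apply: clopenI => //; apply: clopen_preimage.
pose A := ~` (U `|` [set y | U (g^-1 y)]).
have cA : clopen A by apply/clopen_compl/clopenU => //; apply: clopen_preimage.
have AD y : ~ D y -> A y.
  move=> nD [[Dy _]|[_]] //=; rewrite homeoKV => ?; exact: nD.
have [|||t [Gt tB tA tVA]] := vigor sG vigG cA (clopenD cA cF') cB _ _ B0 _.
- by move=> y [].
- have [z F'z] := F'0; exists z; split=> [|[]//]; by apply: AD => -[].
- by move=> y By; apply: AD => -[[]].
exists U, (g ^ t); split=> //.
- have xin z : z \in [:: x; g x] -> W z -> D z.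
    by move=> zx Wz; split; [split=> //; apply: Bx|apply: F'x].
  by split; apply: xin => //; rewrite !inE eqxx ?orbT.
- exact: subgroupJ.
- move=> y Uy; rewrite homeoJE tVA; last by apply; left.
  by rewrite tA //; apply; right; rewrite /= homeoVK.
move=> y nWy; have Ay : A y by apply: AD => -[[]].
have At : A (t^-1 y) by apply/(homeo_support tA); rewrite homeoKV.
have [F't|nF't] := pselect (F' (t^-1 y)).
  by rewrite homeoJE gF ?homeoKV //; apply: F'F.
by case: nWy; apply: BW; rewrite -(homeoKV t y); apply: tB.
Qed.

Lemma localizable_conj g t : G t -> localizable g -> localizable (g ^ t).
Proof.
move=> Gt lg x W cW Wx Wgx.
have [|||U [h [cU Ux Gh hg hW]]] := lg (t^-1 x) [set y | W (t y)].
- exact: clopen_preimage.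
- by rewrite /= homeoKV.
- by [].
exists [set y | U (t^-1 y)], (h ^ t); split=> //.
- exact: clopen_preimage.
- exact: subgroupJ.
- by move=> y Uy; rewrite !homeoJE hg.
- by move=> y nWy; rewrite homeoJE hW /= ?homeoKV.
Qed.

(** If the intermediate point [a x] lies in [W], the two localizations compose. Otherwise both
    factors are conjugated by an element that fixes [x] and [(a * b) x] and brings [a x] into
    [W]. *)
Lemma localizableM a b : localizable a -> localizable b -> localizable (a * b).
Proof.
have mid a' b' x W : localizable a' -> localizable b' -> clopen W -> W x -> W (a' x) ->
    W ((a' * b') x) -> exists U g, [/\ clopen U, U x, G g,
       forall y, U y -> g y = (a' * b') y & forall y, ~ W y -> g y = y].
  move=> la lb cW Wx Wax Wabx.
  have [U [g [cU Ux Gg ga gW]]] := la x W cW Wx Wax.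
  have [V [h [cV Vx Gh hb hW]]] := lb (a' x) W cW Wax Wabx.
  exists (U `&` [set y | V (a' y)]), (g * h); split.
  - by apply: clopenI => //; apply: clopen_preimage.
  - by [].
  - exact: subgroupM.
  - by move=> y [Uy Vy]; rewrite !homeoME ga // hb.
  - by move=> y nWy; rewrite homeoME gW // hW.
move=> la lb x W cW Wx Wabx; have [Wax|nWax] := pselect (W (a x)); first exact: mid.
have W0 : W !=set0 by exists x.
have [C [cC C0 CW Cx]] := clopen_avoid [:: x; (a * b) x] cW W0.
have cA : clopen (~` (W `\` C)) by apply/clopen_compl/clopenD.
have [|||t [Gt tB tA tVA]] := vigor sG vigG cA (clopen_compl cW) cC _ _ C0 _.
- by move=> y nWy [].
- by have [z Cz] := C0; exists z; split=> [[]//|]; apply; apply: CW.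
- by move=> y Cy [].
have D z : z \in [:: x; (a * b) x] -> W z -> (W `\` C) z by move=> zx Wz; split=> //; apply: Cx.
have Dx : (W `\` C) x by apply: D; rewrite // mem_head.
have Dabx : (W `\` C) ((a * b) x) by apply: D; rewrite // !inE eqxx orbT.
have abtE y : (W `\` C) y -> (W `\` C) ((a * b) y) -> (a ^ t * b ^ t) y = (a * b) y.
  move=> Dy Daby; rewrite -conjMg homeoJE tVA; last exact.
  by rewrite tA //; apply.
have [||U [g [cU Ux Gg gab gW]]] :=
    mid (a ^ t) (b ^ t) x W (localizable_conj Gt la) (localizable_conj Gt lb) cW Wx.
- rewrite homeoJE tVA; last exact.
  by apply/CW/tB.
- by rewrite abtE.
exists (U `&` ((W `\` C) `&` [set y | (W `\` C) ((a * b) y)])), g; split=> //.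
- apply: clopenI => //; apply: clopenI; first exact: clopenD.
  by apply: clopen_preimage; apply: clopenD.
- by move=> y [Uy [Dy Daby]]; rewrite gab // abtE.
Qed.

Lemma localizableV g : localizable g -> localizable g^-1.
Proof.
move=> lg x W cW Wx Wgx.
have [|U [h [cU Ux Gh hg hW]]] := lg (g^-1 x) W cW Wgx; first by rewrite homeoKV.
exists [set y | U (g^-1 y)], h^-1; split=> //.
- exact: clopen_preimage.
- exact: subgroupV.
- by move=> y Uy; apply: homeoVE; rewrite hg // homeoKV.
- by move=> y nWy; apply: homeoVE; apply: hW.
Qed.

(** The elements fixing some nonempty clopen set pointwise are permuted by conjugation and not all
    trivial, so they generate the simple group [G]; localizability passes to products and inverses,
    and is a local property of [f]. *)
Lemma localizable_full (simpleG : simple_group G) f : full G f -> localizable f.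
Proof.
pose X : set (homeo T) := [set g | G g /\ exists F, [/\ clopen F, F !=set0 &
  forall x, F x -> g x = x]].
have lG g : G g -> localizable g.
  have [C [cC C0 _ Cd]] := clopen_pieces (@clopenT T) (ex_intro _ point I).
  have [||||g0 [Gg0 g01 g02 _]] := vigor sG vigG (clopenU (cC 0%N) (cC 1%N)) (cC 0%N) (cC 1%N).
  - by move=> x; left.
  - have [z Cz] := C0 1%N; exists z; split; first by right.
    by move=> /(Cd _ _ _ Cz).
  - by [].
  - by move=> x; right.
  have Xg0 : X g0.
    split=> //; exists (C 2%N); split=> // x Cx; apply: g02 => -[] /(Cd _ _ _ Cx) //.
  have <- : generated X = G.
    apply: (generated_simple sG simpleG _ _ Xg0).
    - by move=> ? [].
    - move=> f' h [Gf' [F [cF [z Fz] fF]]] Gh; split; first exact: subgroupJ.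
      exists [set x | F (h^-1 x)]; split; first exact: clopen_preimage.
        by exists (h z); rewrite /= homeoVK.
      by move=> x /= Fx; rewrite homeoJE fF // homeoKV.
    - have [z Cz] := C0 0%N; move=> g1; have := g01 z Cz; rewrite g1 => /(Cd _ _ _ Cz).
      by [].
  apply; split=> [|h [Gh [F [cF F0 hF]]]]; last exact: (@localizable_fixing _ F).
  apply/subgroupP; split; [|exact: localizableM|exact: localizableV].
  by move=> x W cW Wx _; exists setT, 1; split=> //; [exact: clopenT|exact: subgroup1].
move=> lf x W cW Wx Wfx; have [V [g [cV Vx Gg fg]]] := lf x I.
have [|U [h [cU Ux Gh hg hW]]] := lG g Gg x W cW Wx; first by rewrite -fg.
exists (U `&` V), h; split=> //; first exact: clopenI.
by move=> y [Uy Vy]; rewrite fg // hg.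
Qed.

End Localization.

(** * Three-cycles *)

Section ThreeCycles.
Variable G : set (homeo T).
Hypotheses (sG : subgroup G) (simpleG : simple_group G) (vigG : vigorous G).
Implicit Types (A B C E U V W : set T) (x y : T) (f g h s : homeo T).

(** [B] is a dump: outside [U] and its image under [s], the element [g] may be arbitrary, but only
    on [B]. *)
Definition swaps_on s U B := exists g, [/\ G g, forall x, U x \/ U (s x) -> g x = s x &
  forall x, ~ U x -> ~ U (s x) -> ~ B x -> g x = x].

(** A localization [g0] of [s] near [x] may send [y = s x] to a wrong point [y']. A second local
    element [p], trivial near [y], returns [y'] to [x], so [g0 * p] exchanges neighbourhoods of [x]
    and [y] as [s] does. A conjugation then moves the rest of its support into [B]. *)
Lemma swap_local s x : full G s -> (forall y, s (s y) = y) -> s x <> x ->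
  exists V, [/\ clopen V, V x & forall U B, clopen U -> U `<=` V ->
    clopen B -> B !=set0 -> (forall y, B y -> ~ U y /\ ~ U (s y)) -> swaps_on s U B].
Proof.
move=> Gs ss sx; pose y := s x.
have [W0 [cW0 [w W0w] _ W0x]] := clopen_avoid [:: x; s x] clopenT (ex_intro _ point I).
pose W := ~` W0; have cW : clopen W by apply: clopen_compl.
have Wx : W x by apply: W0x; rewrite mem_head.
have Wy : W y by apply: W0x; rewrite !inE eqxx orbT.
have [U1 [g0 [cU1 U1x Gg0 g0s g0W]]] := localizable_full sG vigG simpleG Gs cW Wx Wy.
pose y' := g0 y; have yy' : y != y'.
  apply/eqP => e; apply: sx; rewrite -/y; apply: (homeo_inj (f := g0)).
  by rewrite -/y' -e (g0s x).
have yx : y != x by apply/eqP.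
have Wy' : W y' by apply/(homeo_support g0W).
have [N1 [cN1 N1y N1y']] := cantor_zero_dimensional yy'.
have [N2 [cN2 N2y N2x]] := cantor_zero_dimensional yx.
pose N := N1 `&` N2; have cN : clopen N by apply: clopenI.
pose k := g0^-1 * s.
have Gk : full G k.
  by apply: (subgroupM (full_subgroup sG)) => //; apply: sub_full => //; apply: subgroupV.
have ky' : k y' = x by rewrite /k homeoME /y' homeoVK ss.
have [||U2 [p [cU2 U2y' Gp pk pW]]] :=
    localizable_full sG vigG simpleG Gk (x := y') (clopenD cW cN).
- by split=> // -[].
- by rewrite ky'; split=> // -[].
pose g1 := g0 * p.
have g1W z : ~ W z -> g1 z = z by move=> nWz; rewrite homeoME g0W // pW // => -[].
pose V := U1 `&` [set u | N (s u)] `&` [set u | U2 (g0 (s u))] `&`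
  (W `&` [set u | W (s u)]).
have cV : clopen V.
  have c A f : clopen A -> clopen [set u | A (f u)] := @clopen_preimage f A.
  apply: clopenI; last by apply: clopenI => //; apply: c.
  apply: clopenI; last exact: (c U2 (s * g0)).
  by apply: clopenI => //; apply: c.
have g1s z : V z \/ V (s z) -> g1 z = s z.
  rewrite /g1 homeoME => -[[[[U1z Nz] _] _]|[[[_ _] U2z] _]].
    by rewrite g0s // pW // => -[].
  by move: U2z; rewrite /= ss => U2z; rewrite pk // /k homeoME homeoVK.
have Gg1 : G g1 by apply: subgroupM.
have Vx : V x by split=> //; split=> //; split.
suff VP U B : clopen U -> U `<=` V -> clopen B -> B !=set0 ->
    (forall y, B y -> ~ U y /\ ~ U (s y)) -> swaps_on s U B by exists V.
move=> cU UV cB B0 BU.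
have UW z : U z \/ U (s z) -> W z.
  by move=> [/UV[_ [Wz _]] //|/UV[_ [_]]]; rewrite /= ss.
pose A := ~` (U `|` [set z | U (s z)]).
have cUs : clopen (U `|` [set z | U (s z)]) by apply: clopenU => //; apply: clopen_preimage.
have cA : clopen A by apply: clopen_compl.
(* [W0] was set aside for this step: vigour requires a point of [A] outside [W]. *)
have [|||t [Gt tB tA tVA]] := vigor sG vigG cA (clopenI cW cA) cB _ _ B0 _.
- by move=> z [].
- by exists w; split=> [/UW|[]] /(_ W0w).
- by move=> z Bz [] ?; have [] := BU z Bz.
exists (g1 ^ t); split; first exact: subgroupJ.
  move=> z Uz; rewrite homeoJE tVA; last by apply.
  rewrite g1s; last by case: Uz => ?; [left|right]; apply: UV.
  by rewrite tA //; case: Uz => Uz; apply; [right; rewrite /= ss|left].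
move=> z nUz nUsz nBz; have Az : A z by case.
have At : A (t^-1 z) by apply/(homeo_support tA); rewrite homeoKV.
rewrite homeoJE g1W ?homeoKV // => Wz; apply: nBz.
by rewrite -(homeoKV t z); apply: tB.
Qed.

(** Compactness reduces to the pieces of [swap_local]. At each union the dump is cut in two, so that
    the error of one factor stays away from the swap made by the other. *)
Lemma swap_approx s U B : full G s -> (forall y, s (s y) = y) -> clopen U ->
  (forall x, U x -> ~ U (s x)) -> clopen B -> B !=set0 ->
  (forall y, B y -> ~ U y /\ ~ U (s y)) -> swaps_on s U B.
Proof.
move=> Gs ss cU sU; move: B.
apply: (@clopen_ind (fun U' => forall B, clopen B -> B !=set0 ->
  (forall y, B y -> ~ U' y /\ ~ U' (s y)) -> swaps_on s U' B) U cU).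
- by move=> B _ _ _; exists 1; split=> // [|x []//]; exact: subgroup1.
- move=> x Ux; have [|V [cV Vx VP]] := swap_local Gs ss (x := x).
    by move=> e; apply: (sU x Ux); rewrite e.
  by exists V; split=> // W cW WV _ B; apply: VP.
move=> A A' cA cA' AU A'U AA' QA QA' B cB B0 BAA.
have [B1 [cB1 B10 B1B [b [Bb B1b]]]] := clopen_split cB B0.
have [//|//||g [Gg gA gB]] := QA B1.
  by move=> y /B1B /BAA [nA nsA]; split=> ?; [apply: nA|apply: nsA]; left.
have [|||g' [Gg' gA' gB']] := QA' (B `\` B1).
- exact: clopenD.
- by exists b.
- by move=> y [/BAA [nA nsA] _]; split=> ?; [apply: nA|apply: nsA]; right.
have disj z : A z -> A' z -> False by move=> Az A'z; have : set0 z by rewrite -AA'.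
exists (g * g'); split=> [|x|x nAx nsAx nBx]; first exact: subgroupM.
  move=> [[Ax|A'x]|[sAx|sA'x]]; rewrite homeoME.
  - rewrite gA; last by left.
    rewrite gB' ?ss => // [A'sx|A'x|[Bsx _]]; last 1 first.
    + by have [_] := BAA _ Bsx; apply; left; rewrite ss.
    + by apply: (sU x); [apply: AU|apply: A'U].
    + exact: disj Ax A'x.
  - rewrite gB => [|Ax|sAx|/B1B Bx]; first by rewrite gA' //; left.
    + exact: disj Ax A'x.
    + by apply: (sU x); [apply: A'U|apply: AU].
    + by have [] := BAA _ Bx; case; right.
  - rewrite gA; last by right.
    rewrite gB' ?ss => // [A'sx|A'x|[Bsx _]]; last 1 first.
    + by have [] := BAA _ Bsx; case; left.
    + exact: disj sAx A'sx.
    + by apply: (sU x); [apply: A'U|apply: AU].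
  - rewrite gB => [|Ax|sAx|/B1B Bx]; first by rewrite gA' //; right.
    + by apply: (sU x); [apply: AU|apply: A'U].
    + exact: disj sAx sA'x.
    + by have [_] := BAA _ Bx; case; right.
rewrite homeoME gB; [|by move=> ?; apply: nAx; left|by move=> ?; apply: nsAx; left|by move=> /B1B].
by apply: gB'; [move=> ?; apply: nAx; right|move=> ?; apply: nsAx; right|case].
Qed.

Section MPermInG.
Variables (J : finType) (E : set T) (psi : J -> T -> T).
Hypothesis msE : multisection G E psi.
Notation mp := (mperm E psi).

Lemma mperm_tperm_swap a b x : (psi a @` E) x -> (psi b @` E) (mp (tperm a b) x).
Proof. by move=> [y Ey <-]; rewrite (mpermE msE) // tpermL; exists y. Qed.

Lemma copies_disjoint i j x : (psi i @` E) x -> (psi j @` E) x -> i = j.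
Proof. by have [_ _ inj] := msE; move=> [y Ey <-] [z Ez] /esym /inj[]. Qed.

Lemma mperm_fix (s : {perm J}) x : (forall j, (psi j @` E) x -> s j = j) -> mp s x = x.
Proof.
move=> sx; have [[j [y Ey yx]]|nx] := pselect (copies E psi x); last exact: (mpermN msE).
by rewrite -yx (mpermE msE) // sx //; exists y.
Qed.

Lemma clopen_copy j : clopen (psi j @` E).
Proof. by have [cE lpsi _] := msE; apply: locally_in_clopen_image (lpsi j). Qed.

Lemma mperm_tpermK a b x : mp (tperm a b) (mp (tperm a b) x) = x.
Proof. by rewrite -homeoME -(mpermM msE) tperm2 (mperm1 msE). Qed.

(** The two transpositions are realised only up to errors in the free region [C]. With errors
    confined to the disjoint parts [B] and [C \ B], a commutator erases them, while the commutator
    of two overlapping transpositions is a 3-cycle. *)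
Lemma mperm_3cycle_room a b c x0 : a != b -> b != c -> a != c ->
  (forall j, j \in [:: a; b; c] -> ~ (psi j @` E) x0) -> G (mp (tperm a b * tperm b c)).
Proof.
move=> ab bc ac x0E.
pose C := [set x | forall i : 'I_3, ~ (psi (tnth [tuple a; b; c] i) @` E) x].
have cC : clopen C by apply: clopen_forall => i; apply/clopen_compl/clopen_copy.
have Cx0 : C x0 by move=> i; apply: x0E; apply: mem_tnth.
have CE x : C x -> [/\ ~ (psi a @` E) x, ~ (psi b @` E) x & ~ (psi c @` E) x].
  move=> Cx; split; first exact: (Cx ord0).
    exact: (Cx (lift ord0 ord0)).
  exact: (Cx ord_max).
have [B [cB B0 BC CB0]] := clopen_split cC (ex_intro _ x0 Cx0).
have tN i j x : ~ (psi i @` E) x -> ~ (psi j @` E) x -> mp (tperm i j) x = x.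
  move=> nix njx; apply: mperm_fix => k kx; apply: tpermD; apply/eqP => e; subst k => //.
have sw i j B' : i != j -> clopen B' -> B' !=set0 ->
    (forall y, B' y -> ~ (psi i @` E) y /\ ~ (psi j @` E) y) ->
    exists g, [/\ G g, forall x, (psi i @` E) x \/ (psi j @` E) x -> g x = mp (tperm i j) x,
      forall x, ~ (psi i @` E) x -> ~ (psi j @` E) x -> ~ B' x -> g x = x &
      forall x, B' x -> B' (g x)].
  move=> ij cB' B'0 B'P.
  have jE x : (psi i @` E) (mp (tperm i j) x) <-> (psi j @` E) x.
    split=> [/(mperm_tperm_swap j)|]; first by rewrite mperm_tpermK.
    by move=> /(mperm_tperm_swap i); rewrite tpermC.
  have [|||||||g [Gg g1 g2]] := @swap_approx (mp (tperm i j)) (psi i @` E) B'.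
  - exact: mperm_full.
  - exact: mperm_tpermK.
  - exact: clopen_copy.
  - by move=> x ix /jE jx; move/eqP: ij; apply; apply: copies_disjoint ix jx.
  - by [].
  - by [].
  - by move=> y /B'P[? ?]; split=> // /jE.
  have gij x : (psi i @` E) x \/ (psi j @` E) x -> g x = mp (tperm i j) x.
    by case=> [?|?]; apply: g1; [left|right; apply/jE].
  have gfix x : ~ (psi i @` E) x -> ~ (psi j @` E) x -> ~ B' x -> g x = x.
    by move=> nix njx; apply: g2 => // /jE.
  exists g; split=> // x B'x; apply: contrapT => nB'gx.
  have nB'x : (psi i @` E) (g x) \/ (psi j @` E) (g x) -> False.
    move=> H; have : g (mp (tperm i j) (g x)) = g x.
      rewrite gij ?mperm_tpermK //; case: H => H; last by left; apply/jE.
      by right; apply: mperm_tperm_swap.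
    move=> /homeo_inj e; have [nix njx] := B'P x B'x.
    case: H => [H|/jE]; last by rewrite e => /nix.
    by apply: njx; rewrite -e; apply: mperm_tperm_swap.
  have : g (g x) = g x by apply: gfix => // H; apply: nB'x; [left|right].
  by move=> /homeo_inj e; apply: nB'gx; rewrite e.
have [|g1 [Gg1 g1s g1N g1B]] := sw a b B ab cB B0.
  by move=> y /BC /CE[].
have [|g2 [Gg2 g2s g2N g2B]] := sw b c (C `\` B) bc (clopenD cC cB) CB0.
  by move=> y [/CE[]].
set m := mp _.
suff <- : g2^-1 * g1^-1 * g2 * g1 = m by do !apply: subgroupM => //; apply: subgroupV.
rewrite -!mulgA; apply: (mulgI g2); rewrite mulVKg; apply: (mulgI g1); rewrite mulVKg.
have CNab x : C x -> mp (tperm a b) x = x by move=> /CE[*]; apply: tN.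
have CNbc x : C x -> mp (tperm b c) x = x by move=> /CE[*]; apply: tN.
have mE x : m x = mp (tperm b c) (mp (tperm a b) x) by rewrite /m (mpermM msE) homeoME.
have CN (s : {perm J}) x : (forall x, C x -> mp s x = x) -> ~ C x -> ~ C (mp s x).
  by move=> sC nCx Csx; apply: (nCx); have /homeo_inj <- := sC _ Csx.
have nCP x : ~ C x -> [\/ (psi a @` E) x, (psi b @` E) x | (psi c @` E) x].
  move=> nCx; apply: contrapT => nor; apply: nCx => i ix; apply: nor.
  have := mem_tnth i [tuple a; b; c]; move: ix; move: (tnth _ i) => j jx.
  by rewrite !inE => /or3P[] /eqP e; subst j; [apply: Or31|apply: Or32|apply: Or33].
have g1C x : ~ C x -> g1 x = mp (tperm a b) x.
  move=> nCx; have [[ax|bx]|] := pselect ((psi a @` E) x \/ (psi b @` E) x).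
  - by apply: g1s; left.
  - by apply: g1s; right.
  move=> /not_orP[na nb]; rewrite tN // g1N // => /BC //.
have g2C x : ~ C x -> g2 x = mp (tperm b c) x.
  move=> nCx; have [[ax|bx]|] := pselect ((psi b @` E) x \/ (psi c @` E) x).
  - by apply: g2s; left.
  - by apply: g2s; right.
  by move=> /not_orP[na nb]; rewrite tN // g2N // => -[].
apply: homeoP => x; rewrite !homeoME; have [Cx|nCx] := pselect (C x); last first.
  rewrite g2C // g1C; last exact: CN.
  rewrite g1C // g2C; last exact: CN.
  rewrite /m -!homeoME -!(mpermM msE); congr (mp _ x).
  (* The braid relation, from which the commutator of the transpositions is read off. *)
  have J1 : tperm a b * tperm b c * tperm a b = tperm b c * tperm a b * tperm b c.
    rewrite -{1}[tperm a b]tpermV -{2}[tperm b c]tpermV -!mulgA.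
    have := tpermJ b c (tperm a b); have := tpermJ a b (tperm b c).
    rewrite !conjgE !tpermL !tpermR tpermD // 1?eq_sym // tpermD // 1?eq_sym //.
    by rewrite !tpermV => -> ->.
  by rewrite !mulgA J1 -!mulgA tperm2 mulg1.
have Cg1 : C (g1 x).
  have [Bx|nBx] := pselect (B x); first exact/BC/g1B.
  by have [na nb _] := CE _ Cx; rewrite g1N.
have [Bx|nBx] := pselect (B x).
  have [na nb nc] := CE _ Cx.
  rewrite [g2 x]g2N // => [|[]//].
  rewrite g2N; [|by have [] := CE _ Cg1|by have [] := CE _ Cg1|by case=> _; apply; apply: g1B].
  by rewrite mE CNab // CNbc.
have [na nb nc] := CE _ Cx.
have CBg2 : (C `\` B) (g2 x) by apply: g2B.
have [nag nbg _] := CE _ CBg2.1; rewrite [g1 x]g1N // g1N //; last by case: CBg2.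
by rewrite mE CNab ?CNbc //; case: CBg2.
Qed.

End MPermInG.

(** The three copies of [E] may fill the whole space. Cutting [E] in two makes room: the copies of
    either half miss the copies of the other half. *)
Lemma mperm_3cycle (J : finType) E (psi : J -> T -> T) a b c : multisection G E psi ->
  a != b -> b != c -> G (mperm E psi (tperm a b * tperm b c)).
Proof.
move=> ms ab bc; have [<-|ac] := eqVneq a c.
  by rewrite [tperm b a]tpermC tperm2 (mperm1 ms); apply: subgroup1.
have cE : clopen E by case: ms.
have [E0|nE0] := pselect (E !=set0); last first.
  have -> : E = set0 by apply/seteqP; split=> // x Ex; case: nE0; exists x.
  by rewrite (mperm0 G); apply: subgroup1.
have [E1 [cE1 [x1 E1x] E1E [x2 [E2x E12]]]] := clopen_split cE E0.
have [E2 [cE2 E2E E2d EE E2x2]] : exists E2, [/\ clopen E2, E2 `<=` E, E1 `&` E2 = set0,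
    E = E1 `|` E2 & E2 x2].
  exists (E `\` E1); split=> //; first exact: clopenD.
  - by apply/seteqP; split=> // x [? []].
  - apply/seteqP; split=> [x Ex|x [/E1E//|[]//]].
    by have [|] := pselect (E1 x); [left|right].
have [_ _ inj] := ms.
have ms1 := multisection_sub cE1 E1E ms; have ms2 := multisection_sub cE2 E2E ms.
have disj x : E1 x -> E2 x -> False by move=> E1x' E2x'; have : set0 x by rewrite -E2d.
have -> : mperm E psi (tperm a b * tperm b c) = mperm E1 psi (tperm a b * tperm b c) *
    mperm E2 psi (tperm a b * tperm b c).
  by rewrite [in LHS]EE; apply: (mperm_setU (G := G)) => //; rewrite -EE.
apply: subgroupM => //.
  apply: (mperm_3cycle_room ms1 (x0 := psi a x2)) => // j _ [y E1y] /inj[|//|_ yx]; first exact: E1E.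
  by apply: (disj y) => //; rewrite yx.
apply: (mperm_3cycle_room ms2 (x0 := psi a x1)) => // j _ [y E2y] /inj[||_ yx]; auto.
by apply: (disj y) => //; rewrite yx.
Qed.

Lemma mperm_even (J : finType) E (psi : J -> T -> T) (s : {perm J}) :
  multisection G E psi -> ~~ odd_perm s -> G (mperm E psi s).
Proof.
move=> ms; have [ts -> dts] := prod_tpermP s; rewrite odd_perm_prod //.
have [n] := ubnP (size ts); elim: n ts dts => // n IHn [|[a b] [|[c d] ts]] //=.
  by move=> _ _ _; rewrite big_nil (mperm1 ms); apply: subgroup1.
move=> /and3P[/= ab cd dts] sz; rewrite negbK => ots.
rewrite !big_cons mulgA (mpermM ms); apply: subgroupM => //=; last by apply: IHn => //; lia.
have [ebc|bc] := eqVneq b c; first by subst c; apply: (mperm_3cycle ms).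
have -> : tperm a b * tperm c d = (tperm a b * tperm b c) * (tperm b c * tperm c d).
  by rewrite -!mulgA [tperm b c * (tperm b c * _)]mulgA tperm2 mul1g.
by rewrite (mpermM ms); apply: subgroupM => //; apply: (mperm_3cycle ms).
Qed.

(* [option bool] serves as a type with exactly three elements. *)
Definition contains_alt (H : set (homeo T)) (Y : set T) :=
  forall E (psi : option bool -> T -> T) (s : {perm option bool}), multisection G E psi ->
    (forall j x, E x -> Y (psi j x)) -> ~~ odd_perm s -> H (mperm E psi s).

Definition rot3 : {perm option bool} :=
  tperm None (Some false) * tperm (Some false) (Some true).

Lemma rot3E : [/\ rot3 None = Some true, rot3 (Some false) = None & rot3 (Some true) = Some false].
Proof. by rewrite /rot3; split; rewrite permM !permE. Qed.

Lemma even_rot3 : ~~ odd_perm rot3.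
Proof. by rewrite /rot3 odd_mul_tperm odd_tperm. Qed.

Lemma multisection3 V (g : bool -> homeo T) : clopen V -> (forall b, G (g b)) ->
  (forall b x y, V x -> V y -> x <> g b y) ->
  (forall x y, V x -> V y -> g false x <> g true y) ->
  multisection G V (fun j => if j is Some b then homeo_fun (g b) else id).
Proof.
move=> cV Gg Vg gg; split=> //.
  by move=> [b|]; [exact: locally_in_homeo|exact: locally_in_id].
move=> [[]|] [[]|] x y Vx Vy //=; try by [move=> /homeo_inj|move=> e; exfalso; apply: gg Vy Vx (esym e)
 | move=> e; exfalso; apply: gg Vx Vy e | move=> e; exfalso; apply: Vg Vx Vy e |
  move=> e; exfalso; apply: Vg Vy Vx (esym e)].
Qed.

Lemma multisection3_disjoint V (C : bool -> set T) : clopen V -> (forall b, clopen (C b)) ->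
  (forall b, C b !=set0) -> (forall b x, V x -> ~ C b x) ->
  (forall x, C false x -> ~ C true x) -> exists psi : option bool -> T -> T,
  [/\ multisection G V psi, psi None = id & forall b x, V x -> C b (psi (Some b) x)].
Proof.
move=> cV cC C0 VC CC.
have [|g gP] := spread sG vigG cV _ cC C0.
  by have [z Cz] := C0 true; exists z => /VC; apply; exact: Cz.
exists (fun j => if j is Some b then homeo_fun (g b) else id); split=> // [|b x]; last exact: (gP b).2.
apply: multisection3 => // [b|b x y Vx Vy e|x y Vx Vy e]; first exact: (gP b).1.
  by apply: (VC b x Vx); rewrite e; apply: (gP b).2.
by apply: (CC (g false x)); [apply: (gP _).2|rewrite e; apply: (gP _).2].
Qed.

(** The even permutations of multisections form a conjugation-invariant subset of [G] with a
    nontrivial member, so they generate the simple group [G]. *)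
Lemma contains_alt_full H : subgroup H -> contains_alt H setT -> G `<=` H.
Proof.
move=> sH altH; pose X : set (homeo T) := [set f | exists E (psi : option bool -> T -> T) (s : {perm option bool}),
  [/\ multisection G E psi, ~~ odd_perm s & f = mperm E psi s]].
have [C [cC C0 _ Cd]] := clopen_pieces (@clopenT T) (ex_intro _ point I).
have [|||||psi [ms psi0 psiC]] := @multisection3_disjoint (C 0%N) (fun b => C b.+1) => //.
- by move=> b x Cx /(Cd _ _ _ Cx).
- by move=> x Cx /(Cd _ _ _ Cx).
have <- : generated X = G.
  apply: (@generated_simple _ _ _ (mperm (C 0%N) psi rot3) sG simpleG).
  - by move=> _ [E [psi' [s [ms' es ->]]]]; apply: mperm_even.
  - move=> _ g [E [psi' [s [ms' es ->]]]] Gg; have Fg := sub_full Gg.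
    exists E, (fun j => g \o psi' j), s; split=> //; first exact: multisection_comp.
    exact: (mperm_conj sG _ Fg ms').
  - by exists (C 0%N), psi, rot3; split=> //; exact: even_rot3.
  have [z Cz] := C0 0%N => e; have := mpermE ms rot3 None Cz.
  rewrite e psi0 /= homeo1E; have [-> _ _] := rot3E => ez.
  by have := psiC true z Cz; rewrite -ez => /(Cd _ _ _ Cz).
apply: generated_sub => // _ [E [psi' [s [ms' es ->]]]]; exact: altH.
Qed.

End ThreeCycles.

(** * Alternating groups on clopen sets *)

Section PairPerm.
Variables I J : finType.
Implicit Types (s t : {perm J}) (i : I).

Lemma pair_perm_inj s : injective (fun p : I * J => (p.1, s p.2)).
Proof. by move=> [i a] [j b] /= [-> /perm_inj ->]. Qed.

Definition pair_perm s : {perm I * J} := perm (@pair_perm_inj s).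

Lemma pair_permE s p : pair_perm s p = (p.1, s p.2). Proof. by rewrite permE. Qed.

Lemma pair_permX s n : pair_perm s ^+ n = pair_perm (s ^+ n).
Proof.
apply/permP => p; elim: n p => [|n IHn] [i a]; first by rewrite pair_permE !perm1.
by rewrite !expgS !permM IHn !pair_permE permM.
Qed.

Lemma pair_perm1 : pair_perm 1 = 1.
Proof. by apply/permP => -[i a]; rewrite pair_permE !perm1. Qed.

Definition fiber_fun i s (p : I * J) := if p.1 == i then (i, s p.2) else p.

Lemma fiber_fun_inj i s : injective (fiber_fun i s).
Proof.
rewrite /fiber_fun => -[k a] [l b] /=.
have [->|ki] := eqVneq k i; have [->|li] := eqVneq l i => //.
- by move=> [/perm_inj ->].
- by move=> [e]; rewrite -e eqxx in li.
- by move=> [e]; rewrite e eqxx in ki.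
Qed.

Definition fiber_perm i s : {perm I * J} := perm (@fiber_fun_inj i s).

Lemma odd_fiber_perm i s : odd_perm (fiber_perm i s) = odd_perm s.
Proof.
have fM t u : fiber_perm i (t * u) = fiber_perm i t * fiber_perm i u.
  apply/permP => p; rewrite permM !permE /fiber_fun permM.
  by case: (eqVneq p.1 i) => [_|/negPf ->] //=; rewrite eqxx.
have [ts -> dts] := prod_tpermP s.
have -> : fiber_perm i (\prod_(p <- ts) tperm p.1 p.2) =
    \prod_(p <- [seq ((i, p.1), (i, p.2)) | p <- ts]) tperm p.1 p.2.
  elim: ts {dts} => [|t ts IHts].
    rewrite !big_nil; apply/permP => p; rewrite permE perm1 /fiber_fun perm1.
    by case: p => k a /=; case: eqP => [->|].
  rewrite big_cons fM IHts /= big_cons; congr (_ * _); apply/permP => -[k a].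
  rewrite permE /fiber_fun /=; case: (eqVneq k i) => [->|ki].
    by rewrite -(@inj_tperm _ _ (pair i)) // => b c [].
  by rewrite tpermD // xpair_eqE eq_sym (negPf ki).
rewrite !odd_perm_prod ?size_map // all_map; apply: sub_all dts => t /= /eqP tt.
by apply/eqP => -[].
Qed.

(** Repeating a permutation over an even number of fibres makes it even; both the links and [rho],
    [sigma] obtain their membership in [G] this way. *)
Lemma odd_pair_perm s : odd_perm (pair_perm s) = odd #|I| && odd_perm s.
Proof.
have -> : pair_perm s = \prod_(i <- enum I) fiber_perm i s.
  apply/permP => -[k a]; rewrite pair_permE /=.
  suff H l : uniq l -> (\prod_(i <- l) fiber_perm i s) (k, a) =
      if k \in l then (k, s a) else (k, a) by rewrite H ?enum_uniq // mem_enum.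
  elim: l a => [|i l IHl] a /=; first by rewrite big_nil perm1.
  move=> /andP[il ul]; rewrite big_cons permM permE /fiber_fun inE /=.
  by have [ki|ki] := eqVneq k i; rewrite ?IHl // -ki IHl // ki (negPf il).
have -> : #|I| = size (enum I) by rewrite cardE.
elim: (enum I) => [|i l IHl]; first by rewrite big_nil odd_perm1.
rewrite big_cons odd_permM odd_fiber_perm IHl /=.
by case: (odd (size l)); case: (odd_perm s).
Qed.

End PairPerm.

Definition rot_perm m : {perm 'I_m} := perm (can_inj (@ordSK m)).

Lemma rot_permX m k (i : 'I_m) : (rot_perm m ^+ k) i = ((i + k) %% m)%N :> nat.
Proof.
elim: k i => [|k IHk] i; first by rewrite perm1 addn0 modn_small.
by rewrite expgS permM IHk permE /= modnDml addSnnS.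
Qed.

Lemma rot_perm_order m : rot_perm m ^+ m = 1.
Proof.
apply/permP => i; apply: val_inj; rewrite perm1 /= rot_permX.
by rewrite modnDr modn_small.
Qed.

Section Alternating.
Variable G : set (homeo T).
Hypotheses (sG : subgroup G) (simpleG : simple_group G) (vigG : vigorous G).
Implicit Types (A B C E U V W Y Z : set T) (x y : T) (f g h : homeo T).

(* The doubled cycle makes the permutation even, hence an element of [G]. *)
Lemma exists_link Z Q m : clopen Z -> Z !=set0 -> clopen Q -> Q !=set0 -> Z `&` Q = set0 ->
  (2 <= m)%N -> exists q, [/\ G q, q ^+ m = 1, forall x, ~ Z x -> ~ Q x -> q x = x,
    forall j z, (0 < j < m)%N -> Z z -> Q ((q ^+ j) z) & exists2 y, Q y & Q (q y)].
Proof.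
move=> cZ Z0 cQ Q0 ZQ; case: m => [|[|m]] // _.
have disj x : Z x -> Q x -> False by move=> Zx Qx; have : set0 x by rewrite -ZQ.
have [C [R [CP Cd _]]] := @clopen_fin_pieces (bool * 'I_m.+2)%type Q cQ Q0.
have [|j|j|g gP] := @spread G sG vigG (bool * 'I_m.+2)%type Z C cZ.
- by have [y Qy] := Q0; exists y => /disj; apply.
- by have [] := CP j.
- by have [] := CP j.
have CQ j x : C j x -> Q x by have [_ _ CQ _] := CP j; apply: CQ.
(* The copy [(true, ord0)] is [Z] itself and all the others lie in [Q], so a point of [Z] stays in
   [Q] until its cycle closes. *)
pose psi (j : bool * 'I_m.+2) : T -> T := if j == (true, ord0) then id else homeo_fun (g j).
have ms : multisection G Z psi.
  split=> // [j|i j x y Zx Zy].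
    rewrite /psi; case: eqP => _; first exact: locally_in_id.
    by apply: locally_in_homeo; case: (gP j).
  have := (gP i).2 x Zx; have := (gP j).2 y Zy.
  rewrite /psi; do 2![case: eqP => [->|_]] => //.
  - by move=> Cy _ xy; have := disj x Zx (CQ _ _ _); rewrite xy => /(_ _ Cy).
  - by move=> _ Cx xy; have := disj y Zy (CQ _ _ _); rewrite -xy => /(_ _ Cx).
  - by move=> Cy Cx xy; rewrite xy in Cx; have ij := Cd _ _ _ Cx Cy; subst j; move/homeo_inj: xy.
pose s : {perm bool * 'I_m.+2} := pair_perm bool (rot_perm m.+2).
have Zq z : Z z -> psi (true, ord0) z = z by rewrite /psi eqxx.
have psiQ j z : j != (true, ord0) -> Z z -> Q (psi j z).
  by move=> /negPf j0 Zz; rewrite /psi j0; apply/CQ/(gP j).2.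
have sX k b a : (s ^+ k) (b, a) = (b, (rot_perm m.+2 ^+ k) a).
  by rewrite /s pair_permX pair_permE.
exists (mperm Z psi s); split.
- by apply: mperm_even => //; rewrite odd_pair_perm card_bool.
- by rewrite -(mpermX ms) /s pair_permX rot_perm_order pair_perm1 (mperm1 ms).
- move=> x nZ nQ; apply: (mpermN ms) => -[j [z Zz]].
  have [->|j0] := eqVneq j (true, ord0); first by rewrite Zq // => e; rewrite -e in nZ.
  by move=> e; apply: nQ; rewrite -e; apply: psiQ.
- move=> j z /andP[j0 jm] Zz.
  have -> : (mperm Z psi s ^+ j) z = psi ((s ^+ j) (true, ord0)) z.
    by rewrite -(mpermX ms) -{1}(Zq z Zz) (mpermE ms).
  rewrite sX; apply: psiQ => //; rewrite xpair_eqE /= -val_eqE /= rot_permX add0n modn_small //.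
  by rewrite -lt0n.
(* The second cycle, indexed by [false], runs entirely inside [Q]; it supplies the overlap of [Q]
   with its image. *)
have [z Zz] := Z0; exists (psi (false, ord0) z); first exact: psiQ.
by rewrite (mpermE ms) // -[s]expg1 sX; apply: psiQ.
Qed.

(** [q] moves [C 0], whereas its conjugate by [t] is supported in [C 2]. *)
Lemma exists_noncommuting : exists a b, [/\ G a, G b & a * b <> b * a].
Proof.
have [C [cC C0 _ Cd]] := clopen_pieces (@clopenT T) (ex_intro _ point I).
have [|q [Gq _ q1 q2 _]] := @exists_link (C 0%N) (C 1%N) 2 (cC _) (C0 _) (cC _) (C0 _) _ isT.
  by apply/seteqP; split=> // x [Cx /(Cd _ _ _ Cx)].
have [|t [Gt tC _ _]] := vigor sG vigG clopenT (clopenU (cC 0%N) (cC 1%N)) (cC 2%N)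
  (@subsetT _ _) _ (C0 2%N) (@subsetT _ _).
  by have [z Cz] := C0 3%N; exists z; split=> // -[] /(Cd _ _ _ Cz).
exists q, t; split=> // qt.
have qtq : q ^ t = q by rewrite conjgE qt mulKg.
have [z Cz] := C0 0%N; have := q2 1%N z isT Cz.
rewrite expg1 -[q]qtq homeoJE q1.
- by rewrite homeoKV => /(Cd _ _ _ Cz).
- by move=> Ct; have := tC (t^-1 z) (or_introl Ct); rewrite homeoKV => /(Cd _ _ _ Cz).
- by move=> Ct; have := tC (t^-1 z) (or_intror Ct); rewrite homeoKV => /(Cd _ _ _ Cz).
Qed.

(** The elements with trivial [m]-th power form a conjugation-invariant set, nontrivial because of
    [exists_link]; simplicity makes it generate [G], and finite generation leaves finitely many of
    them. *)
Lemma torsion_generators m : (2 <= m)%N -> finitely_generated G ->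
  exists us : seq (homeo T), (forall u, u \in us -> G u /\ u ^+ m = 1) /\
    generated [set u | u \in us] = G.
Proof.
move=> m2 [X0 /finite_seqP[s ->] gX].
pose X : set (homeo T) := [set u | G u /\ u ^+ m = 1].
have gXG : generated X = G.
  have [C [cC C0 _ Cd]] := clopen_pieces (@clopenT T) (ex_intro _ point I).
  have [|q [Gq qm _ q2 _]] := @exists_link (C 0%N) (C 1%N) m (cC _) (C0 _) (cC _) (C0 _) _ m2.
    by apply/seteqP; split=> // x [Cx /(Cd _ _ _ Cx)].
  apply: (@generated_simple _ _ _ q) => //.
  - by move=> u [].
  - by move=> u g [Gu um] Gg; split; [exact: subgroupJ|rewrite -conjXg um conj1g].
  - move=> q1; have [z Cz] := C0 0%N; have := q2 1%N z m2 Cz.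
    by rewrite expg1 q1 homeo1E => /(Cd _ _ _ Cz).
have [|us usX us_s] := @generated_finite_support _ X s.
  move=> x xs; rewrite gXG -gX; exact: sub_generated.
exists us; split=> //; apply/seteqP; split.
  by apply: generated_sub => // u /usX[].
rewrite -gX; apply: generated_sub; first exact: generated_subgroup.
by move=> x xs; apply: us_s.
Qed.

Lemma contains_alt_sub H Y Y' : Y' `<=` Y -> contains_alt G H Y -> contains_alt G H Y'.
Proof. by move=> YY aH E psi s ms pY; apply: aH => // j x Ex; apply/YY/pY. Qed.

Section ContainsAlt.
Variable H : set (homeo T).
Hypotheses (sH : subgroup H) (HG : H `<=` G).

Lemma contains_alt_image h Y : H h -> contains_alt G H Y -> contains_alt G H (h @` Y).
Proof.
move=> Hh aH E psi s ms pY es.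
have Fh : full G h by apply: sub_full; apply: HG.
have FhV : full G h^-1 by apply: subgroupV Fh; apply: full_subgroup.
have msV := multisection_comp sG FhV ms.
have -> : mperm E psi s = mperm E (fun j => (h^-1)%g \o psi j) s ^ h.
  rewrite (mperm_conj sG _ Fh msV); congr (mperm E _ s).
  by apply/funext => j; apply/funext => x /=; rewrite homeoKV.
apply: subgroupJ => //; apply: aH => // j x Ex /=.
by have [y Yy <-] := pY j x Ex; rewrite homeoVK.
Qed.

(** The points are brought in one at a time, by a 3-cycle of [Y2 \ Y1] with two pieces of the
    intersection that avoid the points already placed. *)
Lemma contains_alt_move Y1 Y2 (ps : seq T) : clopen Y1 -> clopen Y2 -> (Y1 `&` Y2) !=set0 ->
  contains_alt G H Y2 -> (forall p, p \in ps -> Y1 p \/ Y2 p) ->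
  exists h, [/\ H h, forall x, ~ Y1 x -> ~ Y2 x -> h x = x & forall p, p \in ps -> Y1 (h p)].
Proof.
move=> c1 c2 Y12 aH; elim: ps => [_|p ps IHps psY].
  by exists 1; split=> //; exact: subgroup1.
have [|h [Hh hY hps]] := IHps; first by move=> x xs; apply: psY; rewrite inE xs orbT.
have [Y1hp|nY1hp] := pselect (Y1 (h p)).
  by exists h; split=> // x; rewrite inE => /orP[/eqP ->|/hps].
have Y2hp : Y2 (h p).
  suff [] : Y1 (h p) \/ Y2 (h p) by [].
  have hY' x : ~ (Y1 `|` Y2) x -> h x = x by move=> /not_orP[]; apply: hY.
  by apply/(homeo_support hY'); apply: psY; rewrite mem_head.
have [C [cC C0 CY Cps]] := clopen_avoid [seq h x | x <- ps] (clopenI c1 c2) Y12.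
have [D [cD D0 DC Dd]] := clopen_pieces cC C0.
have [|b|b|b x [_ nY1x]|x|psi [ms psi0 psiD]] :=
    @multisection3_disjoint G sG vigG (Y2 `\` Y1) (fun b => D b).
- exact: clopenD.
- exact: cD.
- exact: D0.
- by move=> /DC/CY[].
- by move=> Dx /(Dd _ _ _ Dx).
have psiY2 j x : (Y2 `\` Y1) x -> Y2 (psi j x).
  by case: j => [b|] Vx; [have [] := CY _ (DC _ _ (psiD b x Vx))|rewrite psi0; case: Vx].
exists (h * mperm (Y2 `\` Y1) psi rot3); split.
- by apply: subgroupM => //; apply: aH => //; exact: even_rot3.
- move=> x n1 n2; rewrite homeoME hY // (mpermN ms) // => -[j [y Vy e]].
  by apply: n2; rewrite -e; apply: psiY2.
move=> x; rewrite inE => /orP[/eqP ->|xps]; rewrite homeoME.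
  have -> : mperm (Y2 `\` Y1) psi rot3 (h p) = psi (Some true) (h p).
    by have := mpermE ms rot3 None (conj Y2hp nY1hp); have [-> _ _] := rot3E; rewrite psi0.
  by have [] := CY _ (DC _ _ (psiD true (h p) (conj Y2hp nY1hp))).
have Y1x := hps x xps; rewrite (mpermN ms) // => -[[b|] [y Vy e]].
  by apply: (Cps (h x)); [rewrite map_f|rewrite -e; apply: DC (psiD b y Vy)].
by move: e; rewrite psi0 => e; case: Vy => _; rewrite e.
Qed.

(** Near [x], only the three points [psi j x] matter. Once some [h] in [H] has moved them into [Y1],
    small copies around them follow, and conjugation by [h] reduces to [Y1]; [clopen_ind]
    reassembles the domain. *)
Lemma contains_altU Y1 Y2 : clopen Y1 -> clopen Y2 -> (Y1 `&` Y2) !=set0 ->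
  contains_alt G H Y1 -> contains_alt G H Y2 -> contains_alt G H (Y1 `|` Y2).
Proof.
move=> c1 c2 Y12 a1 a2 E psi s ms pY es; have [cE lpsi _] := ms.
apply: (@clopen_ind (fun W => H (mperm W psi s)) E cE).
- by rewrite (mperm0 G); apply: subgroup1.
- move=> x Ex.
  have [|h [Hh _ hps]] := contains_alt_move (ps := [seq psi j x | j <- enum {: option bool}]) c1 c2 Y12 a2.
    by move=> p /mapP[j _ ->]; apply: pY.
  have /choice [V VP] : forall j, exists V, [/\ clopen V, V x &
      forall y, V y -> E y -> Y1 (h (psi j y))].
    move=> j; have [U [g [cU Ux Gg gU]]] := lpsi j x Ex.
    exists (U `&` [set y | Y1 ((g * h) y)]); split.
    + by apply: clopenI => //; apply: clopen_preimage.
    + by split=> //=; rewrite homeoME -gU //; apply: hps; apply/map_f/mem_enum.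
    + by move=> y [Uy Y1y] Ey; rewrite gU.
  exists [set y | forall j, V j y]; split=> [|j|W cW WV WE].
  + by apply: clopen_forall => j; have [] := VP j.
  + by have [] := VP j.
  have msW := multisection_sub cW WE ms.
  have Fh : full G h by apply: sub_full; apply: HG.
  have : H (mperm W psi s ^ h).
    rewrite (mperm_conj sG _ Fh msW); apply: a1 => //; first exact: multisection_comp.
    by move=> j y Wy /=; have [_ _ Vj] := VP j; apply: Vj; [apply: WV|apply: WE].
  move=> Hm; rewrite -(conjgK h (mperm W psi s)); apply: subgroupJ => //.
  exact: subgroupV.
- move=> A B cA cB AE BE AB HA HB; rewrite (mperm_setU (G := G)) //; first exact: subgroupM.
  by apply: multisection_sub ms; [exact: clopenU|move=> x [/AE|/BE]].
Qed.

Lemma contains_alt_bigU (I : eqType) (s : seq I) (Y : I -> set T) Z : clopen Z -> Z !=set0 ->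
  (forall i, clopen (Y i)) -> (forall i, i \in s -> Z `<=` Y i) -> contains_alt G H Z ->
  (forall i, i \in s -> contains_alt G H (Y i)) ->
  contains_alt G H (Z `|` [set x | exists2 i, i \in s & Y i x]).
Proof.
move=> cZ Z0 cY ZY aZ aY.
suff [_] : clopen (Z `|` [set x | exists2 i, i \in s & Y i x]) /\
    contains_alt G H (Z `|` [set x | exists2 i, i \in s & Y i x]) by [].
elim: s ZY aY => [|i s IHs] ZY aY.
  by rewrite (_ : _ `|` _ = Z) //; apply/seteqP; split=> x; [case=> // -[]|left].
have [||cs as_] := IHs.
- by move=> j js; apply: ZY; rewrite inE js orbT.
- by move=> j js; apply: aY; rewrite inE js orbT.
have -> : Z `|` [set x | exists2 j, j \in i :: s & Y j x] =
    (Z `|` [set x | exists2 j, j \in s & Y j x]) `|` Y i.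
  apply/seteqP; split=> x.
    move=> [Zx|[j]]; first by left; left.
    by rewrite inE => /orP[/eqP ->|js] Yx; [right|left; right; exists j].
  move=> [[Zx|[j js Yx]]|Yx]; first by left.
    by right; exists j => //; rewrite inE js orbT.
  by right; exists i => //; rewrite mem_head.
split; first exact: clopenU.
apply: contains_altU => //; last by apply: aY; rewrite mem_head.
by have [z Zz] := Z0; exists z; split; [left|apply: ZY Zz; rewrite mem_head].
Qed.

(** A multisection inside the copy [o] is pulled back along [psi o]. The pulled-back maps [th] are
    still locally in [G], so their even permutations belong to [G], and acting on the copy [o] they
    give back the original ones. *)
Lemma contains_alt_copy (J : finType) (psi : J -> T -> T) o : multisection G setT psi ->
  (forall g, G g -> H (wreath setT psi 1 (fun v => if v == o then g else 1))) ->
  contains_alt G H (psi o @` setT).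
Proof.
move=> ms Ho E phi s msE pY es; have [cE lphi inj] := msE; have [_ lpsi injpsi] := ms.
have /choice [phi' phi'P] : forall p : option bool * T, exists y, E p.2 -> psi o y = phi p.1 p.2.
  move=> [j x] /=; have [Ex|nEx] := pselect (E x); last by exists x.
  by have [y _ e] := pY j x Ex; exists y.
pose th j x := phi' (j, x).
have thE j x : E x -> psi o (th j x) = phi j x by move=> Ex; apply: (phi'P (j, x)).
have msth : multisection G E th.
  split=> // [j x Ex|i j x y Ex Ey e]; last by apply: inj => //; rewrite -!thE // e.
  have [U [g [cU Ux Gg gU]]] := lphi j x Ex.
  have [V [a [cV Vx Ga aV]]] := lpsi o (th j x) I.
  exists (U `&` [set z | V ((g * a^-1) z)]), (g * a^-1); split.
  - by apply: clopenI => //; apply: clopen_preimage.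
  - by split=> //=; rewrite homeoME -gU // -thE // aV // homeoVK.
  - by apply: subgroupM => //; apply: subgroupV.
  move=> z [Uz Vz] Ez.
  have [|//] := injpsi o o (th j z) ((g * a^-1) z) I I.
  by rewrite thE // aV // homeoME homeoKV gU.
suff -> : mperm E phi s = wreath setT psi 1 (fun v => if v == o then mperm E th s else 1).
  by apply: Ho; apply: mperm_even.
apply/esym/(mperm_ext msE) => [j y Ey|x nx].
  by rewrite -[in LHS]thE // (wreathE ms) // perm1 eqxx (mpermE msth) // thE.
have [[v [w _ e]]|nc] := pselect (copies setT psi x); last by rewrite (wreathN ms).
rewrite -e (wreathE ms) // perm1; case: eqP => [vo|//]; rewrite (mpermN msth) // => -[j [y Ey yw]].
by apply: nx; exists j, y => //; rewrite -thE // yw -e vo.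
Qed.

End ContainsAlt.
End Alternating.

(** * The hypermap *)

Section CyclePerm.
Variables (A : finType) (p : nat) (f : 'I_p -> A).
Hypothesis f_inj : injective f.

Definition cycle_fun (x : A) := if [pick i | f i == x] is Some i then f (ordS i) else x.

Lemma cycle_funE i : cycle_fun (f i) = f (ordS i).
Proof.
rewrite /cycle_fun; case: pickP => [j /eqP /f_inj -> //|/(_ i)].
by rewrite eqxx.
Qed.

Lemma cycle_funN x : (forall i, f i != x) -> cycle_fun x = x.
Proof. by move=> nx; rewrite /cycle_fun; case: pickP => // i; rewrite (negPf (nx i)). Qed.

Lemma cycle_fun_inj : injective cycle_fun.
Proof.
have D x : (exists i, x = f i) \/ forall i, f i != x.
  have [i /eqP <-|nf] := pickP (fun i => f i == x); first by left; exists i.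
  by right => i; rewrite nf.
move=> x y; have [[i ->]|nx] := D x; have [[j ->]|ny] := D y; rewrite ?cycle_funE ?(cycle_funN _) //.
- by move=> /f_inj /(can_inj (@ordSK p)) ->.
- by move=> e; have := ny (ordS i); rewrite e eqxx.
- by move=> e; have := nx (ordS j); rewrite e eqxx.
Qed.

Definition cycle_perm : {perm A} := perm cycle_fun_inj.

Lemma cycle_permE i : cycle_perm (f i) = f (ordS i).
Proof. by rewrite permE cycle_funE. Qed.

Lemma cycle_permN x : (forall i, f i != x) -> cycle_perm x = x.
Proof. by move=> nx; rewrite permE cycle_funN. Qed.

Lemma cycle_permX k i : (cycle_perm ^+ k) (f i) = f ((rot_perm p ^+ k) i).
Proof.
elim: k i => [|k IHk] i; first by rewrite !perm1.
by rewrite !expgS !permM cycle_permE IHk permE.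
Qed.

Lemma cycle_perm_order : cycle_perm ^+ p = 1.
Proof.
apply/permP => x; rewrite perm1.
have [i /eqP <-|nf] := pickP (fun i => f i == x).
  by rewrite cycle_permX rot_perm_order perm1.
have fx : cycle_perm x = x by apply: cycle_permN => i; rewrite nf.
by elim: p => [|k IHk]; rewrite ?perm1 // expgS permM fx.
Qed.

End CyclePerm.

(** * Three-cycles as commutators of permutations *)

Section ThreeCyclePerm.
Variable A : finType.
Implicit Types (a b : {perm A}) (x y z : A).

Definition cyc3 x y z := tperm x y * tperm x z.

Lemma cyc3E x y z : x != y -> y != z -> x != z ->
  [/\ cyc3 x y z x = y, cyc3 x y z y = z, cyc3 x y z z = x &
      forall v, v != x -> v != y -> v != z -> cyc3 x y z v = v].
Proof.
move=> xy yz xz; rewrite /cyc3; split=> [||| v vx vy vz]; rewrite permM.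
- by rewrite tpermL tpermD // eq_sym.
- by rewrite tpermR tpermL.
- by rewrite [X in tperm _ z X]tpermD // ?tpermR // eq_sym.
- by rewrite [X in tperm _ z X]tpermD ?tpermD // eq_sym.
Qed.

Lemma cyc3J x y z a : cyc3 x y z ^ a = cyc3 (a x) (a y) (a z).
Proof. by rewrite /cyc3 conjMg !tpermJ. Qed.

(** The classical commutator of two permutations whose supports meet in one point, checked in the
    form [a * b = b * a * cyc3]. *)
Lemma commg_cyc3 a b x : (forall v, a v != v -> b v != v -> v = x) ->
  a x != x -> b x != x -> [~ a, b] = cyc3 (a x) x (b x).
Proof.
move=> abx ax bx.
have amove v : a v != v -> a (a v) != a v by rewrite (inj_eq perm_inj).
have bmove v : b v != v -> b (b v) != b v by rewrite (inj_eq perm_inj).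
have b_fix v : a v != v -> v != x -> b v = v.
  by move=> av vx; apply/eqP/negPn/negP => bv; case/eqP: vx; apply: abx.
have a_fix v : b v != v -> v != x -> a v = v.
  by move=> bv vx; apply/eqP/negPn/negP => av; case/eqP: vx; apply: abx.
have bax : b (a x) = a x by apply: b_fix; [exact: amove|].
have abx' : a (b x) = b x by apply: a_fix; [exact: bmove|].
have axbx : a x != b x by apply/eqP => e; have := bmove x bx; rewrite -e bax eqxx.
have xbx : x != b x by rewrite eq_sym.
have [E1 E2 E3 E4] := cyc3E ax xbx axbx.
apply: (mulgI (b * a)); rewrite -commgC; apply/permP => v.
rewrite permM [RHS]permM [X in cyc3 _ _ _ X]permM.
have [->|vx] := eqVneq v x; first by rewrite bax abx' E3.
have [av|/negPn/eqP av] := boolP (a v != v).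
  rewrite (b_fix v av vx); have [avx|avx] := eqVneq (a v) x; first by rewrite avx E2.
  rewrite (b_fix _ (amove _ av) avx) E4 //; first by rewrite (inj_eq perm_inj).
  by apply/eqP => e; have := amove _ av; rewrite e abx' eqxx.
rewrite av; have [bv|/negPn/eqP bv] := boolP (b v != v).
  have [bvx|bvx] := eqVneq (b v) x; first by rewrite bvx E1.
  rewrite (a_fix _ (bmove _ bv) bvx) E4 //; last by rewrite (inj_eq perm_inj).
  by apply/eqP => e; have := bmove _ bv; rewrite e bax eqxx.
rewrite bv av E4 //; first by apply/eqP => e; have := amove _ ax; rewrite -e av eqxx.
by apply/eqP => e; have := bmove _ bx; rewrite -e bv eqxx.
Qed.

End ThreeCyclePerm.

Section Hypermap.
Variables (m' n' k : nat).
Hypothesis k4 : (3 < k)%N.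
Notation J := (m' + n').+3.
Notation X := ('I_k.+1 * 'I_J)%type.

Definition vx (i j : nat) : X := (inord i, inord j).

Lemma vxP (p : X) : exists i j, [/\ (i <= k)%N, (j < J)%N & p = vx i j].
Proof.
case: p => i j; exists i, j; split; [by rewrite -ltnS|by []|].
by rewrite /vx !inord_val.
Qed.

Lemma vx_eq i j i1 j1 : (i <= k)%N -> (j < J)%N -> (i1 <= k)%N -> (j1 < J)%N ->
  (vx i j == vx i1 j1) = (i == i1) && (j == j1).
Proof. by move=> *; rewrite xpair_eqE -!val_eqE /= !inordK. Qed.

(* [rho] and [sigma] have orders [n = n'.+3] and [m = m'.+2]. Every fibre of [X] carries an
   [n]-cycle of [rho] (on the types [0 .. n'.+2]) and an [m]-cycle of [sig0] (on [0] and
   [n'.+2 ..]); conjugation by [Omega] shifts the common type [0] to the next fibre, which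
   links the fibres into a hypermap whose faces, the cycles of [sigma * rho], are two:
   the orbit [inA] of [Omega], of length [k.+2], and a ring of length [ring_size]. *)
Definition rho_type (a : 'I_n'.+3) : 'I_J := inord a.
Definition sig_type (a : 'I_m'.+2) : 'I_J := inord (if a == 0%N :> nat then 0%N else n'.+1 + a).
Definition outer (a : 'I_k.+2) : X :=
  if a == 0%N :> nat then vx 0 0 else if a == 1%N :> nat then vx 0 1 else vx a.-1 0.

Lemma rho_type_inj : injective rho_type.
Proof.
move=> a b /(congr1 val); rewrite /= !inordK; first by move/val_inj.
all: by have := ltn_ord a; have := ltn_ord b; lia.
Qed.

Lemma sig_type_inj : injective sig_type.
Proof.
move=> a b /(congr1 val); rewrite /= !inordK; last 2 first.
- by have := ltn_ord b; case: ifP; lia.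
- by have := ltn_ord a; case: ifP; lia.
by move=> e; apply: val_inj; move: e => /=; do 2!case: ifP; lia.
Qed.

Lemma outer_inj : injective outer.
Proof.
move=> a b; rewrite /outer => /eqP e; apply: val_inj => /=; move: e.
have ha := ltn_ord a; have hb := ltn_ord b.
by do ?case: ifP => //=; rewrite ?vx_eq; lia.
Qed.

Definition rho : {perm X} := pair_perm _ (cycle_perm rho_type_inj).
Definition sig0 : {perm X} := pair_perm _ (cycle_perm sig_type_inj).
Definition Omega : {perm X} := cycle_perm outer_inj.
Definition sigma : {perm X} := sig0 ^ Omega^-1.

Lemma rho_order : rho ^+ n'.+3 = 1.
Proof. by rewrite pair_permX cycle_perm_order pair_perm1. Qed.

Lemma sigma_order : sigma ^+ m'.+2 = 1.
Proof. by rewrite -conjXg pair_permX cycle_perm_order pair_perm1 conj1g. Qed.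

Lemma Omega_order : Omega ^+ k.+2 = 1.
Proof. exact: cycle_perm_order. Qed.

Lemma rho_even : odd k -> ~~ odd_perm rho.
Proof. by move=> ok; rewrite odd_pair_perm card_ord /= ok. Qed.

Lemma sigma_even : odd k -> ~~ odd_perm sigma.
Proof. by move=> ok; rewrite odd_permJ odd_pair_perm card_ord /= ok. Qed.

Lemma rho_vx i j : (j < J)%N ->
  rho (vx i j) = vx i (if (j < n'.+2)%N then j.+1 else if j == n'.+2 then 0%N else j).
Proof.
move=> jJ; rewrite pair_permE /=; congr pair; have [jn|jn] := ltnP j n'.+3; last first.
  rewrite cycle_permN => [|a]; last first.
    by rewrite -val_eqE /= !inordK //; have := ltn_ord a; lia.
  by rewrite ifF ?ifF //; lia.
rewrite (_ : inord j = rho_type (Ordinal jn)) // cycle_permE; apply: val_inj.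
rewrite [RHS]/= inordK; last by do ?case: ifP; lia.
rewrite /= inordK; last by apply: (leq_trans (ltn_pmod _ _)) => //; lia.
rewrite /=; case: ifP => jn1; first by rewrite modn_small.
have -> : j = n'.+2 by lia.
by rewrite modnn eqxx.
Qed.

Lemma sig0_vx i j : (j < J)%N -> sig0 (vx i j) = vx i (if j == 0%N then n'.+2 else
  if (j < n'.+2)%N then j else if (j < (m' + n').+2)%N then j.+1 else 0%N).
Proof.
move=> jJ; rewrite pair_permE /=; congr pair.
have E (a : 'I_m'.+2) : val (sig_type a) = (if a == 0%N :> nat then 0%N else n'.+1 + a)%N.
  by rewrite /= inordK //; have := ltn_ord a; case: ifP; lia.
have [j0|j0] := eqVneq j 0%N.
  rewrite (_ : inord j = sig_type ord0); last by apply: val_inj; rewrite E j0 /= inordK.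
  rewrite cycle_permE; apply: val_inj; rewrite E /= modn_small // inordK //; lia.
have [jn|jn] := ltnP j n'.+2.
  rewrite cycle_permN // => a; rewrite -val_eqE E /= inordK //.
  by have := ltn_ord a; case: ifP; lia.
have am : (j - n'.+1 < m'.+2)%N by lia.
rewrite (_ : inord j = sig_type (Ordinal am)); last first.
  by apply: val_inj; rewrite E /= inordK //; case: ifP; lia.
rewrite cycle_permE; apply: val_inj; rewrite E [RHS]/= inordK /=; last by case: ifP; lia.
have [jJ1|jJ1] := ltnP j (m' + n').+2; last first.
  by have -> : (j - n'.+1).+1 = m'.+2 by [lia]; rewrite modnn.
by rewrite modn_small /=; lia.
Qed.

Lemma Omega_vx i j : (i <= k)%N -> (j < J)%N -> Omega (vx i j) =
  if j == 0%N then if i == 0%N then vx 0 1 else if (i < k)%N then vx i.+1 0 else vx 0 0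
  else if (i == 0%N) && (j == 1%N) then vx 1 0 else vx i j.
Proof.
move=> ik jJ; have O a (ha : (a < k.+2)%N) : outer (Ordinal ha) =
    if a == 0%N then vx 0 0 else if a == 1%N then vx 0 1 else vx a.-1 0 by [].
have S a (ha : (a < k.+1)%N) (ha' : (a < k.+2)%N) (ha1 : (a.+1 < k.+2)%N) :
    Omega (outer (Ordinal ha')) = outer (Ordinal ha1).
  by rewrite cycle_permE; congr outer; apply: val_inj; rewrite /= modn_small.
case: eqP => [->|j0]; first case: eqP => [->|i0].
- have h0 : (0 < k.+1)%N by []; have h0' : (0 < k.+2)%N by []; have h1 : (1 < k.+2)%N by [].
  by have := S 0%N h0 h0' h1; rewrite !O.
- have h' : (i.+1 < k.+2)%N by lia.
  have [ik1|ik1] := ltnP i k.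
    have h : (i.+1 < k.+1)%N by lia.
    have h1 : (i.+2 < k.+2)%N by lia.
    by have := S _ h h' h1; rewrite !O /= ifF //; lia.
  have := cycle_permE outer_inj (Ordinal h'); rewrite O /= ifF; last lia.
  move=> ->; rewrite (_ : ordS _ = ord0) //; apply: val_inj => /=.
  by rewrite (_ : i.+2 = k.+2) ?modnn //; lia.
case: ifP => [/andP[/eqP -> /eqP ->]|ij].
  have h1 : (1 < k.+1)%N by lia.
  have h1' : (1 < k.+2)%N by []; have h2 : (2 < k.+2)%N by lia.
  by have := S _ h1 h1' h2; rewrite !O.
rewrite cycle_permN // => -[a ha]; rewrite O.
by do 2?case: ifP; rewrite vx_eq; lia.
Qed.

Lemma OmegaV_vx i j : (i <= k)%N -> (j < J)%N -> Omega^-1%g (vx i j) =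
  if j == 0%N then if i == 0%N then vx k 0 else if i == 1%N then vx 0 1 else vx i.-1 0
  else if (i == 0%N) && (j == 1%N) then vx 0 0 else vx i j.
Proof.
move=> ik jJ; apply: (@perm_inj _ Omega); rewrite permKV.
case: eqP => [->|j0]; first case: eqP => [->|i0]; first by rewrite Omega_vx //= ltnn ifF //; lia.
  case: eqP => [->|i1]; first by rewrite Omega_vx.
  rewrite Omega_vx /=; [|lia|by []]; rewrite ifF; last lia.
  by rewrite ifT; [congr (vx _ _); lia|lia].
case: ifP => [/andP[/eqP -> /eqP ->]|ij]; first by rewrite Omega_vx.
by rewrite Omega_vx // (introF eqP j0) ij.
Qed.

Lemma sigma_vx i j : (i <= k)%N -> (j < J)%N -> sigma (vx i j) =
  if j == 0%N then if i == 0%N then vx 0 0 else if (i < k)%N then vx i.+1 n'.+2 else vx 0 n'.+2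
  else if j == 1%N then if i == 0%N then vx 1 n'.+2 else vx i j
  else if (j < n'.+2)%N then vx i j else if (j < (m' + n').+2)%N then vx i j.+1
  else if i == 0%N then vx k 0 else if i == 1%N then vx 0 1 else vx i.-1 0.
Proof.
move=> ik jJ; have -> : sigma (vx i j) = Omega^-1%g (sig0 (Omega (vx i j))).
  by rewrite /sigma conjgE invgK !permM.
rewrite Omega_vx //; case: eqP => [_|j0].
  case: eqP => [i0|i0].
    by rewrite sig0_vx //= OmegaV_vx.
  by case: ifP => ik1; rewrite sig0_vx //= OmegaV_vx //=; lia.
case: (j =P 1%N) => [j1|j1].
  have [i0|i0] := eqVneq i 0%N.
    by rewrite /= sig0_vx //= OmegaV_vx //=; lia.
  by rewrite /= j1 sig0_vx //= OmegaV_vx //= (negPf i0).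
rewrite andbF sig0_vx // (introF eqP j0).
case: ifP => jn; first by rewrite OmegaV_vx // ifF ?ifF //; lia.
case: ifP => jJ1; first by rewrite OmegaV_vx ?ifF ?ifF //; lia.
by rewrite OmegaV_vx.
Qed.

Definition inA (p : X) := (p.2 == 0%N :> nat) || ((p.1 == 0%N :> nat) && (p.2 == 1%N :> nat)).

Lemma inA_vx i j : (i <= k)%N -> (j < J)%N ->
  inA (vx i j) = (j == 0%N) || ((i == 0%N) && (j == 1%N)).
Proof. by move=> ik jJ; rewrite /inA /= !inordK. Qed.

Definition tau := sigma * rho.

(** [sigma] sends the [Omega]-predecessor of [vx i 0] to [vx i n'.+2], the last type of [rho], which
    wraps to [vx i 0]. The exception is [vx 0 0], fixed by [sigma] and sent by [rho] to [vx 0 1]. *)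
Lemma tau_inA v : inA v -> tau v = Omega v.
Proof.
have [i [j [ik jJ ->]]] := vxP v; rewrite inA_vx // => /orP[/eqP ->|/andP[/eqP -> /eqP ->]].
  rewrite /tau permM sigma_vx // Omega_vx //=.
  case: ifP => i0; first by rewrite rho_vx.
  case: ifP => ik1; rewrite rho_vx /=; [|lia| |lia]; rewrite ltnn eqxx //.
rewrite /tau permM sigma_vx // Omega_vx //= rho_vx /=; last by lia.
by rewrite ltnn eqxx.
Qed.

Lemma tau_outA i j : (i <= k)%N -> (j < J)%N -> ~~ inA (vx i j) -> tau (vx i j) =
  if (j < (m' + n').+2)%N then vx i j.+1 else
  if i == 0%N then vx k 1 else if i == 1%N then vx 0 2 else vx i.-1 1.
Proof.
move=> ik jJ; rewrite inA_vx // negb_or => /andP[j0 ij].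
rewrite /tau permM sigma_vx // (negPf j0).
have [j1|j1] := eqVneq j 1%N.
  by move: ij; rewrite j1 andbT => /negPf ->; rewrite rho_vx.
case: ifP => jn; first by rewrite rho_vx // jn ifT //; lia.
case: ifP => jJ1; first by rewrite rho_vx // ifF ?ifF //; lia.
by do 2?case: ifP => _; rewrite rho_vx.
Qed.

(* The position on the ring, counted from [vx k 1]. *)
Definition rk (p : X) := ((k - p.1) * (m' + n').+2 + p.2.-1 - (p.1 == 0%N :> nat))%N.
(** All [k.+1 * J] points but the [k.+2] of [inA]. In fibre 0 the set [inA] also takes type 1,
    whence the shift by 1 there in [rk]. *)
Definition ring_size := (k.+1 * (m' + n').+2).-1.

Lemma rk_vx i j : (i <= k)%N -> (j < J)%N ->
  rk (vx i j) = ((k - i) * (m' + n').+2 + j.-1 - (i == 0%N))%N.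
Proof. by move=> ik jJ; rewrite /rk /= !inordK. Qed.

Lemma ring_size_gt0 : (0 < ring_size)%N.
Proof. by rewrite /ring_size; nia. Qed.

Lemma rk_tau v : ~~ inA v -> ~~ inA (tau v) /\ rk (tau v) = ((rk v).+1 %% ring_size)%N.
Proof.
have [i [j [ik jJ ->]]] := vxP v; move=> nA; rewrite tau_outA //.
move: nA; rewrite inA_vx // negb_or => /andP[j0 ij].
(* Abstracting the common factor lets [lia] treat the products as atoms. *)
have [d dE] : {d | d = (m' + n').+2} by exists (m' + n').+2.
have rkE i1 j1 : (i1 <= k)%N -> (j1 < J)%N ->
    rk (vx i1 j1) = ((k - i1) * d + j1.-1 - (i1 == 0%N))%N by rewrite dE; apply: rk_vx.
have d2 : (2 <= d)%N by rewrite dE.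
have jd' : (j <= d)%N by rewrite dE.
have rb : ring_size = (k * d + d.-1)%N by rewrite /ring_size -dE mulSn; lia.
have kid : ((k - i) * d <= k * d)%N by rewrite leq_mul2r leq_subr orbT.
have ki1 : (0 < i)%N -> ((k - i.-1) * d = (k - i) * d + d)%N.
  by move=> i0; rewrite (_ : k - i.-1 = (k - i).+1)%N ?mulSn; lia.
have kid' : (0 < i)%N -> ((k - i) * d + d <= k * d)%N.
  by move=> i0; rewrite -ki1 // leq_mul2r leq_subr orbT.
have -> : (j < (m' + n').+2)%N = (j < d)%N by rewrite dE.
case: ifP => jd.
  rewrite inA_vx ?rkE //; [|lia..]; split; first by lia.
  have kid2 : i <> 0%N -> ((k - i) * d + d <= k * d)%N by move=> ?; apply: kid'; lia.
  rewrite rb; move: ((k - i) * d)%N (k * d)%N kid kid2 {rb ki1 kid'} => x z xz xz2.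
  have [i0|i0] := eqVneq i 0%N; last by have := xz2 (elimN eqP i0); rewrite modn_small; lia.
  by move: ij; rewrite i0 /= => j1; rewrite modn_small; lia.
have jE : j = d by lia.
case: eqP => [i0|i0].
  rewrite inA_vx // !rkE // subnn i0 subn0 eqxx jE; split; first by lia.
  have -> : (k * d + d.-1 - true).+1 = ring_size by rewrite rb; lia.
  by rewrite modnn; case: eqP; lia.
case: eqP => [i1|i1].
  rewrite inA_vx // !rkE // i1 /= ?subn0; split=> //.
  move: ki1 kid'; rewrite i1 /= subn0 => /(_ isT) ki1 /(_ isT) kid'.
  by rewrite jE modn_small; lia.
rewrite inA_vx ?rkE //; [|lia..].
split; first by lia.
rewrite ki1; last by lia.
by rewrite jE modn_small; have := kid'; lia.
Qed.

Lemma rk_lt v : ~~ inA v -> (rk v < ring_size)%N.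
Proof.
have [i [j [ik jJ ->]]] := vxP v; rewrite inA_vx // rk_vx // negb_or => /andP[j0 ij].
have [d dE] : {d | d = (m' + n').+2} by exists (m' + n').+2.
rewrite /ring_size -dE mulSn.
have [i0|i0] := posnP i; first by move: ij; rewrite i0 /= subn0; lia.
have : ((k - i) * d + d <= k * d)%N.
  by rewrite -mulSnr leq_mul2r; lia.
by lia.
Qed.

Lemma rk_inj v w : ~~ inA v -> ~~ inA w -> rk v = rk w -> v = w.
Proof.
have [i [j [ik jJ ->]]] := vxP v; have [i1 [j1 [ik1 jJ1 ->]]] := vxP w.
rewrite !inA_vx // !rk_vx // !negb_or => /andP[j0 ij] /andP[j10 ij1].
have [d dE] : {d | d = (m' + n').+2} by exists (m' + n').+2.
have {}jJ : (j <= d)%N by rewrite dE.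
have {}jJ1 : (j1 <= d)%N by rewrite dE.
have lem a b c a' b' c' : (a < a')%N -> (b < d)%N -> (b' - c' >= 0)%N ->
   (a * d + b - c = a' * d + b' - c')%N -> (c <= b)%N -> (c' <= b')%N -> False.
  move=> aa bd _ e cb cb'; have : (a.+1 * d <= a' * d)%N by rewrite leq_mul2r aa orbT.
  by rewrite mulSn; lia.
move=> e; rewrite -dE in e; have ii : i = i1.
  have [ii|ii|//] := ltngtP i i1.
    by exfalso; apply: (lem _ _ _ _ _ _ _ _ _ (esym e)); lia.
  by exfalso; apply: (lem _ _ _ _ _ _ _ _ _ e); lia.
by subst i1; congr vx; lia.
Qed.

End Hypermap.

(** * Orbits, three-cycles and transitivity of the hypermap *)

Section HypermapOrbits.
Variables (m' n' k : nat).
Hypothesis k4 : (3 < k)%N.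
Notation J := (m' + n').+3.
Notation X := ('I_k.+1 * 'I_J)%type.
Notation vx := (@vx m' n' k).
Notation rho := (rho m' n' k4).
Notation sigma := (sigma m' n' k4).
Notation tau := (tau m' n' k4).
Notation Omega := (Omega m' n' k4).
Notation inA := (@inA m' n' k).
Notation rk := (@rk m' n' k).
Notation b := (ring_size m' n' k).
Notation outer := (@outer m' n' k).

Let c := vx k 1.

Lemma inA_outer a : inA (outer a).
Proof.
have ha := ltn_ord a; rewrite /outer; case: eqP => a0; first by rewrite inA_vx.
by case: eqP => a1; rewrite inA_vx //; lia.
Qed.

Lemma inA_outerP v : inA v -> exists a, v = outer a.
Proof.
have [i [j [ik jJ ->]]] := vxP v; rewrite inA_vx // => /orP[/eqP ->|/andP[/eqP -> /eqP ->]].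
  have [->|i0] := eqVneq i 0%N; first by exists ord0.
  have h : (i.+1 < k.+2)%N by lia.
  by exists (Ordinal h); rewrite /outer /= ifF //; lia.
by have h : (1 < k.+2)%N by []; exists (Ordinal h).
Qed.

Lemma Omega_outA v : ~~ inA v -> Omega v = v.
Proof. by move=> nA; apply: cycle_permN => a; apply: contraNneq nA => <-; exact: inA_outer. Qed.

Lemma Omega_inA v : inA v -> inA (Omega v).
Proof. by move=> /inA_outerP[a ->]; rewrite cycle_permE inA_outer. Qed.

Lemma c_outA : ~~ inA c.
Proof. by rewrite inA_vx // negb_or /= andbT; lia. Qed.

Lemma tauX_outA j v : ~~ inA v -> ~~ inA ((tau ^+ j) v) /\ rk ((tau ^+ j) v) = ((rk v + j) %% b)%N.
Proof.
move=> nA; elim: j => [|j [IHA IHr]]; first by rewrite perm1 addn0 modn_small // rk_lt.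
rewrite expgSr permM; have [tA ->] := rk_tau k4 IHA; split=> //.
by rewrite IHr -addn1 modnDml addn1 addnS.
Qed.

Lemma rk_c : rk c = 0%N.
Proof. by rewrite rk_vx // subnn mul0n /= sub0n. Qed.

Lemma tau_ring v : ~~ inA v -> exists2 r, (r < b)%N & v = (tau ^+ r) c.
Proof.
move=> nA; exists (rk v); first exact: rk_lt.
have [tA tr] := tauX_outA (rk v) c_outA.
by apply: (rk_inj k4) => //; rewrite tr rk_c add0n modn_small // rk_lt.
Qed.

Lemma tau_ring_neq j : (0 < j < b)%N -> (tau ^+ j) c <> c.
Proof.
move=> /andP[j0 jb] e; have [_] := tauX_outA j c_outA.
by rewrite e rk_c add0n modn_small // => j0'; rewrite -j0' in j0.
Qed.

Lemma tau_ring_order v : ~~ inA v -> (tau ^+ b) v = v.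
Proof.
move=> nA; have [tA tr] := tauX_outA b nA; apply: (rk_inj k4) => //.
by rewrite tr modnDr modn_small // rk_lt.
Qed.

Lemma sigma_leaf i : (0 < i <= k)%N -> sigma (vx i 1) = vx i 1.
Proof. by move=> /andP[i0 ik]; rewrite sigma_vx //= gtn_eqF. Qed.

Lemma rho_outer_eq a : rho (outer a) = if a == 0%N :> nat then vx 0 1
  else if a == 1%N :> nat then vx 0 2 else vx a.-1 1.
Proof.
rewrite /outer; case: ifP => _; first by rewrite rho_vx.
by case: ifP => _; rewrite rho_vx.
Qed.

Lemma leaf_outer i (h : (i.+1 < k.+2)%N) : (0 < i)%N -> vx i 1 = rho (outer (Ordinal h)).
Proof. by move=> i0; rewrite rho_outer_eq /= ifF //; lia. Qed.

(* [Omega] and its conjugate by [rho] have a single common moved point, so that their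
   commutator is a 3-cycle. *)
Lemma cyc3_leaves (P : set {perm X}) i : subgroup P -> P Omega -> P rho ->
  (0 < i < k)%N -> P (cyc3 (vx 1 0) (vx i 1) (vx i.+1 1)).
Proof.
move=> sP PO Pr; pose O' := Omega ^ rho.
have PO' : P O' by apply: subgroupJ.
have O'E a : O' (rho (outer a)) = rho (outer (ordS a)) by rewrite permJ cycle_permE.
have h1 : (1 < k.+2)%N by []; have h2 : (2 < k.+2)%N by lia.
have o0 : ordS (@ord0 k.+1) = Ordinal h1 by apply: val_inj.
have o1 : ordS (Ordinal h1) = Ordinal h2 by apply: val_inj; rewrite /= modn_small.
have OX : Omega (vx 0 1) = vx 1 0 by rewrite Omega_vx.
have O'X : O' (vx 0 1) = vx 0 2.
  by have := O'E ord0; rewrite o0 !rho_outer_eq.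
have y_fix : O' (vx 1 0) = vx 1 0.
  rewrite /O' conjgE !permM Omega_outA ?permKV //.
  have -> : rho^-1%g (vx 1 0) = vx 1 n'.+2.
    by apply: (@perm_inj _ rho); rewrite permKV rho_vx ?ltnn ?eqxx //; lia.
  by rewrite inA_vx //; lia.
have O'move v : O' v != v -> exists a, v = rho (outer a).
  move=> v'; have [/inA_outerP[a e]|nA] := boolP (inA (rho^-1%g v)).
    by exists a; rewrite -e permKV.
  by move: v'; rewrite /O' conjgE !permM Omega_outA // permKV eqxx.
(* [O'] fixes [vx 1 0] and shifts the points [rho (outer a)], so conjugation by it carries the
   initial commutator to every consecutive pair of them. *)
have E q (h : (q < k.+2)%N) (h' : (q.+1 < k.+2)%N) :
    P (cyc3 (vx 1 0) (rho (outer (Ordinal h))) (rho (outer (Ordinal h')))).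
  elim: q h h' => [|q IHq] h h'.
    have -> : cyc3 (vx 1 0) (rho (outer (Ordinal h))) (rho (outer (Ordinal h'))) =
        [~ Omega, O'].
      rewrite !rho_outer_eq /=; rewrite -OX -O'X; apply/esym/commg_cyc3.
      - move=> v Ov /O'move[a va]; subst v.
        have : inA (rho (outer a)) by apply: contraNT Ov => /Omega_outA ->.
        have ha := ltn_ord a; rewrite rho_outer_eq.
        by case: ifP => a0 //; case: ifP => a1; rewrite inA_vx //=; lia.
      - by rewrite OX vx_eq.
      - by rewrite O'X vx_eq.
    by rewrite commgEl; apply: subgroupM => //; [exact: subgroupV|exact: subgroupJ].
  have h0 : (q < k.+2)%N by lia.
  have -> : Ordinal h' = ordS (Ordinal h) by apply: val_inj; rewrite /= modn_small.
  have -> : Ordinal h = ordS (Ordinal h0) by apply: val_inj; rewrite /= modn_small.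
  rewrite -!O'E -{1}y_fix -cyc3J; apply: subgroupJ => //.
  by rewrite O'E (_ : ordS (Ordinal h0) = Ordinal h) //; apply: val_inj; rewrite /= modn_small.
move=> /andP[i0 ik].
have h : (i.+1 < k.+2)%N by lia.
have h' : (i.+2 < k.+2)%N by lia.
by rewrite (leaf_outer h i0) (leaf_outer h' isT).
Qed.

(** The 3-cycle through [vx 1 0] and the leaves [k.-1], [k] conjugates [vx 1 0] to the leaf [k.-1];
    the bound on [i] keeps the other two leaves out of its support. *)
Lemma cyc3_leaves_target (P : set {perm X}) i : subgroup P -> P Omega -> P rho ->
  (0 < i)%N -> (i.+2 < k)%N -> P (cyc3 (vx k.-1 1) (vx i 1) (vx i.+1 1)).
Proof.
move=> sP PO Pr i0 ik.
have k1 : k = k.-1.+1 by lia.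
have Pk : P (cyc3 (vx 1 0) (vx k.-1 1) (vx k 1)).
  by have := @cyc3_leaves P k.-1 sP PO Pr; rewrite -k1; apply; lia.
have Pi : P (cyc3 (vx 1 0) (vx i 1) (vx i.+1 1)) by apply: cyc3_leaves => //; lia.
have := subgroupJ sP Pi Pk; rewrite cyc3J.
have [|||-> _ _ E] := @cyc3E X (vx 1 0) (vx k.-1 1) (vx k 1); try by rewrite vx_eq //; lia.
by rewrite !E //; rewrite vx_eq //; lia.
Qed.

(** [rho] leads from [c] to [vx k 0], powers of [tau] then reach all of [outer], hence type 0 of
    every fibre; [rho] climbs to type [n'.+2], and [sigma] to the types beyond. *)
Lemma hypermap_transitive (V : X -> Prop) : V c -> (forall v, V v -> V (rho v)) ->
  (forall v, V v -> V (sigma v)) -> forall v, V v.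
Proof.
move=> Vc Vr Vs.
have up i j l : (j <= l)%N -> (l <= n'.+2)%N -> V (vx i j) -> V (vx i l).
  elim: l => [|l IHl]; first by rewrite leqn0 => /eqP ->.
  rewrite leq_eqVlt => /orP[/eqP -> //|jl] ln Vij.
  by have := Vr _ (IHl jl (ltnW ln) Vij); rewrite rho_vx ?ln //; lia.
have V0 i j : (j <= n'.+2)%N -> V (vx i j) -> V (vx i 0).
  move=> jn /(up _ _ n'.+2 jn (leqnn _))/Vr.
  by rewrite rho_vx ?ltnn ?eqxx //; lia.
have Vt v : V v -> V (tau v).
  by move=> Vv; rewrite permM; apply/Vr/Vs.
have Vk : V (outer ord_max).
  by rewrite /outer /= ifF; [exact: (V0 k 1%N)|lia].
have Vmax q : V (outer ((rot_perm k.+2 ^+ q) ord_max)).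
  elim: q => [|q IHq]; first by rewrite perm1.
  rewrite expgSr permM permE -(cycle_permE (@outer_inj m' n' k k4)).
  by rewrite -[cycle_perm _ _](tau_inA k4 (inA_outer _)); apply: Vt.
have VA a : V (outer a).
  have := Vmax a.+1; rewrite (_ : (rot_perm k.+2 ^+ a.+1) ord_max = a) //; apply: val_inj.
  by have /= -> := rot_permX a.+1 (@ord_max k.+1); rewrite addnS -addSn addnC modnDr modn_small.
have Vi0 i : (i <= k)%N -> V (vx i 0).
  move=> ik; have [->|i0] := eqVneq i 0%N; first exact: (VA ord0).
  have h : (i.+1 < k.+2)%N by lia.
  by have := VA (Ordinal h); rewrite /outer /= ifF //; lia.
move=> v; have [i [j [ik jJ ->]]] := vxP v.
have Vlow l : (l <= n'.+2)%N -> V (vx i l) by move=> ln; apply: up (Vi0 i ik).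
elim: j jJ => [|j IHj] jJ; first exact: Vlow.
have [jn|jn] := leqP j.+1 n'.+2; first exact: Vlow.
have j0 : (j == 0%N) = false by lia.
have j1 : (j == 1%N) = false by lia.
have j2 : (j < n'.+2)%N = false by lia.
have j3 : (j < (m' + n').+2)%N by [].
by have := Vs _ (IHj (ltnW jJ)); rewrite sigma_vx ?(ltnW jJ) // j0 j1 j2 j3.
Qed.

(** Modulo [k.+2] the ring size is the opposite of [J = (m' + n').+3], so the three factors are, up
    to sign, [m'.+2], [J] and [m'.+1 * J - 1], all positive and below [k.+2]. *)
Lemma ring_coprime : prime k.+2 -> (m'.+1 * (m' + n').+3 < k.+2)%N ->
  ~~ (k.+2 %| m'.+2 * b * (m'.+1 * b).+1)%N.
Proof.
move=> pr lt; rewrite !Euclid_dvdM // !negb_or.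
have bE : (b + (m' + n').+3 = k.+2 * (m' + n').+2)%N.
  rewrite /ring_size -[in RHS](addn1 k.+1) mulnDl mul1n.
  have : (0 < k.+1 * (m' + n').+2)%N by rewrite muln_gt0.
  by move: (k.+1 * _)%N => z; lia.
have lt1 : (m'.+2 < k.+2)%N by apply: leq_ltn_trans lt; rewrite mulSn; lia.
have lt2 : ((m' + n').+3 < k.+2)%N by apply: leq_ltn_trans lt; apply: leq_pmull.
rewrite -andbA; apply/and3P; split; first by rewrite gtnNdvd.
- apply/negP => db; have : (k.+2 %| (m' + n').+3)%N.
    by rewrite -(dvdn_addr _ db) bE dvdn_mulr.
  by rewrite gtnNdvd.
apply/negP => db.
have p0 : (1 < m'.+1 * (m' + n').+3)%N by rewrite mulSn; lia.
have : (k.+2 %| (m'.+1 * b).+1 + (m'.+1 * (m' + n').+3).-1)%N.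
  have -> : ((m'.+1 * b).+1 + (m'.+1 * (m' + n').+3).-1 = m'.+1 * (k.+2 * (m' + n').+2))%N.
    rewrite -bE mulnDr; move: p0; set z := (m'.+1 * b)%N; set w := (m'.+1 * (m' + n').+3)%N.
    by move: z w => z w; lia.
  by rewrite dvdn_mull // dvdn_mulr.
rewrite (dvdn_addr _ db) gtnNdvd //.
by apply: leq_ltn_trans lt; apply: leq_pred.
Qed.

End HypermapOrbits.

(** * The pair of large generators *)

Lemma commute_disjoint_support (f g : homeo T) (A : set T) :
  (forall x, ~ A x -> f x = x) -> (forall x, A x -> g x = x) -> commute f g.
Proof.
move=> fA gA; apply: homeoP => x; rewrite !homeoME.
have [Ax|nAx] := pselect (A x); first by rewrite (gA _ Ax) gA //; apply/(homeo_support fA).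
rewrite (fA _ nAx) fA // => Agx; apply: (nAx).
by rewrite -(homeo_inj (gA _ Agx)).
Qed.

Lemma centralizer_subgroup (gT : groupType) (A : set gT) :
  subgroup [set g | forall x, A x -> commute x g].
Proof.
apply/subgroupP; split=> [x _|g h Cg Ch x Ax|g Cg x Ax].
- exact: commute1.
- by apply: commuteM; [apply: Cg|apply: Ch].
- by apply: commuteV; apply: Cg.
Qed.

Lemma generated_abelian (gT : groupType) (A : set gT) : (forall x y, A x -> A y -> commute x y) ->
  forall x y, generated A x -> generated A y -> commute x y.
Proof.
move=> comA x y Ax Ay; have C z : A z -> commute z x.
  move=> Az; suff /(_ x Ax)/(_ z Az) : generated A `<=` [set g | forall w, A w -> commute w g] by [].
  apply: generated_sub; first exact: centralizer_subgroup.
  by move=> w Aw v Av; exact: comA.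
suff /(_ y Ay)/(_ x erefl) : generated A `<=` [set g | forall w, [set x] w -> commute w g] by [].
apply: generated_sub; first exact: centralizer_subgroup.
by move=> z /C /commute_sym xz w ->.
Qed.

Lemma expg_coprime (gT : groupType) (x : gT) p N : x ^+ p = 1 -> (1 < p)%N -> coprime p N ->
  exists e, x ^+ (N * e) = x.
Proof.
move=> xp p1 cop; have N0 : (0 < N)%N.
  by case: N cop => //; rewrite /coprime gcdn0 => /eqP p11; move: p1; rewrite p11.
case: (egcdnP p N0) => u v uv _; exists u.
rewrite mulnC uv gcdnC (eqP cop) expgnDr mulnC expgnA xp expg1n mul1g.
by rewrite expg1.
Qed.

(** A subset missing [gen i] lies in the stabiliser of the private point of [i], which does not
    contain [gen i]. *)
Lemma private_minimal (I : Type) (gen : I -> homeo T) :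
  (forall i, exists x, gen i x <> x /\ forall j, j <> i -> gen j x = x) ->
  injective gen /\ forall Y, Y `<` range gen -> generated Y <> generated (range gen).
Proof.
move=> priv; split=> [i j gij|Y [Yg nY] eY].
  apply: contrapT => ij; have [x [gx fx]] := priv j; apply: gx; rewrite -gij.
  exact: fx.
apply: nY => _ [i _ <-]; have [x [gx fx]] := priv i; apply: contrapT => nYi.
have sx : subgroup [set g : homeo T | g x = x].
  apply/subgroupP; split=> [//|g h /= gx1 hx|g /= gx1]; first by rewrite homeoME gx1.
  exact: homeoVE.
apply: gx; have : generated Y (gen i) by rewrite eY; apply: sub_generated; exists i.
suff /[apply] : generated Y `<=` [set g : homeo T | g x = x] by [].
apply: generated_sub => // g Yg'; have [j _ gj] := Yg _ Yg'; rewrite -gj.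
by apply: fx => ji; apply: nYi; rewrite -ji gj.
Qed.

Section Core.
Variable G : set (homeo T).
Hypotheses (sG : subgroup G) (simpleG : simple_group G) (vigG : vigorous G).
Variables (m' n' k : nat).
Hypotheses (k4 : (3 < k)%N) (ok : odd k) (pk : prime k.+2).
Hypothesis kbig : (m'.+1 * (m' + n').+3 < k.+2)%N.
Notation J := (m' + n').+3.
Notation X := ('I_k.+1 * 'I_J)%type.
Notation vx := (@vx m' n' k).
Notation rho := (rho m' n' k4).
Notation sigma := (sigma m' n' k4).
Notation tau := (tau m' n' k4).
Notation Omega := (Omega m' n' k4).
Notation inA := (@inA m' n' k).
Notation b := (ring_size m' n' k).
Notation c := (vx k 1).
Notation o := (vx k.-1 1).

Variable psi : X -> T -> T.
Hypothesis ms : multisection G setT psi.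
Variable us : seq (homeo T).
Hypotheses (usG : forall u, u \in us -> G u /\ u ^+ m'.+2 = 1)
  (gen_us : generated [set u | u \in us] = G) (us_small : (3 * size us + 3 <= k)%N).
Variables (Z : set T) (q : homeo T).
Notation P v := (psi v @` setT).
Hypotheses (cZ : clopen Z) (Z0 : Z !=set0) (Zc : forall x, Z x -> ~ copies setT psi x)
  (Gq : G q) (qm : q ^+ m'.+2 = 1)
  (q_supp : forall x, ~ Z x -> ~ P c x -> q x = x)
  (qZ : forall j z, (0 < j < m'.+2)%N -> Z z -> P c ((q ^+ j) z))
  (q_overlap : exists2 y, P c y & P c (q y)).

Implicit Types (s : {perm X}) (F : X -> homeo T) (v w : X) (x y : T).
Notation mp := (mperm setT psi).
Notation W := (wreath setT psi 1).

Lemma preservesT (F : X -> homeo T) : preserves setT F.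
Proof. by []. Qed.
Hint Resolve preservesT : core.

(* Only every third index carries a generator [u] of [G], so that [lam] takes the values
   [u^-1], [u], [1] on three consecutive leaves [vx i 1]. *)
Definition label (i : nat) := if i %% 3 == 2 then nth 1 us (i %/ 3) else 1.
Definition lam (v : X) := if v.2 == 1%N :> nat then (label v.1.+1)^-1 * label v.1 else 1.
Definition pot (v : X) := if v.2 == 0%N :> nat then 1 else
  if v.2 == 1%N :> nat then label v.1.+1 else label v.1.

Lemma label0 : label 0%N = 1. Proof. by []. Qed.
Lemma label1 : label 1%N = 1. Proof. by []. Qed.
Lemma label_big i : (3 * size us <= i)%N -> label i = 1.
Proof.
move=> li; rewrite /label; case: ifP => // _; rewrite nth_default //.
by rewrite leq_divRL // mulnC.
Qed.

Lemma lam_vx i j : (i <= k)%N -> (j < J)%N ->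
  lam (vx i j) = if j == 1%N then (label i.+1)^-1 * label i else 1.
Proof. by move=> ik jJ; rewrite /lam /= !inordK. Qed.

Lemma pot_vx i j : (i <= k)%N -> (j < J)%N ->
  pot (vx i j) = if j == 0%N then 1 else if j == 1%N then label i.+1 else label i.
Proof. by move=> ik jJ; rewrite /pot /= !inordK. Qed.

Lemma pot_inA v : inA v -> pot v = 1.
Proof.
have [i [j [ik jJ ->]]] := vxP v; rewrite inA_vx // pot_vx //.
by move=> /orP[/eqP ->|/andP[/eqP -> /eqP ->]].
Qed.

(** Along the ring, [pot] changes only on leaving type 1 of a fibre, from [label i.+1] to [label i];
    passing to the next fibre keeps it. The ring closes up because the labels are trivial at both
    ends. *)
Lemma lam_pot v : lam v = (pot v)^-1 * pot (tau v).
Proof.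
have [Av|nAv] := boolP (inA v).
  have -> : pot (tau v) = 1 by rewrite tau_inA //; apply/pot_inA/(Omega_inA k4).
  rewrite pot_inA // invg1 mulg1; move: Av; have [i [j [ik jJ ->]]] := vxP v.
  by rewrite inA_vx // lam_vx // => /orP[/eqP ->|/andP[/eqP -> /eqP ->]] //=; rewrite invg1 mulg1.
have [i [j [ik jJ e]]] := vxP v; move: nAv; rewrite {}e => nAv; rewrite tau_outA // lam_vx // pot_vx //.
move: nAv; rewrite inA_vx // negb_or => /andP[j0 ij]; rewrite (negPf j0).
have [jd|jd] := ltnP j (m' + n').+2.
  rewrite pot_vx //=; case: eqP => [->|j1] //=; last by rewrite ifF ?mulVg //; lia.
have -> : (j == 1%N) = false by lia.
case: (i =P 0%N) => [->|i0]; first by rewrite pot_vx //= label0 invg1 mul1g label_big //; lia.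
case: (i =P 1%N) => [->|i1]; first by rewrite pot_vx //= label1 label0 invg1 mulg1.
rewrite pot_vx //=; last by lia.
by rewrite prednK ?mulVg //; lia.
Qed.

Lemma lam_sigma v : lam (sigma v) = lam v.
Proof.
have [i [j [ik jJ ->]]] := vxP v; rewrite sigma_vx // [RHS]lam_vx //.
have lam01 : (label 1%N)^-1 * label 0%N = 1 by rewrite label0 label1 mulVg.
case: (j =P 0%N) => [->|j0].
  by do 2?case: ifP => ?; rewrite lam_vx //; lia.
case: (j =P 1%N) => [->|j1].
  case: (i =P 0%N) => [->|i0]; last by rewrite lam_vx.
  by rewrite lam01 lam_vx //; lia.
case: ifP => jn; first by rewrite lam_vx // ifF //; lia.
case: ifP => jd; first by rewrite lam_vx //= ifF //; lia.
by do 2?case: ifP => ?; rewrite lam_vx //= ?lam01 //; lia.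
Qed.

Lemma lam_c : lam c = 1.
Proof. by rewrite lam_vx //= !label_big ?mulVg //; lia. Qed.

Lemma lam_o : lam o = 1.
Proof. by rewrite lam_vx //=; [rewrite !label_big ?mulVg //; lia|lia]. Qed.

Definition Lam := W lam.
Definition alpha := mp sigma * q * Lam.
Definition beta := mp rho.

Lemma WM F F' : W F * W F' = W (fun v => F v * F' v).
Proof.
by rewrite (wreathM ms) // mulg1; congr wreath; apply/funext => v; rewrite perm1.
Qed.

Lemma W1 : W (fun=> 1) = 1. Proof. exact: (wreath1 ms). Qed.

Lemma WV F : (W F)^-1 = W (fun v => (F v)^-1).
Proof.
apply: (mulgI (W F)); rewrite mulgV WM -[LHS]W1; congr wreath.
by apply/funext => v; rewrite mulgV.
Qed.

Lemma WX F n : W F ^+ n = W (fun v => F v ^+ n).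
Proof.
elim: n => [|n IHn]; first by rewrite -[LHS]W1.
rewrite expgS IHn WM; congr wreath; apply/funext => v; by rewrite expgS.
Qed.

Lemma mpW s F : mp s * W F = wreath setT psi s (fun v => F (s v)).
Proof.
rewrite /mperm (wreathM ms) // mulg1; congr wreath; apply/funext => v; exact: mul1g.
Qed.

Lemma Wmp s F : W F * mp s = wreath setT psi s F.
Proof.
rewrite /mperm (wreathM ms) // mul1g; congr wreath; apply/funext => v; exact: mulg1.
Qed.

Lemma WJ s F : W F ^ mp s = W (fun v => F (s^-1 v)).
Proof.
apply: (mulgI (mp s)); rewrite -conjgC Wmp mpW; congr wreath; apply/funext => v.
by rewrite permK.
Qed.

Lemma P_disj v w x : P v x -> P w x -> v = w.
Proof. exact: (copies_disjoint ms). Qed.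

Lemma P_psi v y : P v (psi v y). Proof. by exists y. Qed.

Lemma Z_P v x : Z x -> ~ P v x.
Proof. by move=> Zx Px; apply: (Zc Zx); exists v. Qed.

Lemma W_fix (F : X -> homeo T) x : (forall v, P v x -> F v = 1) -> W F x = x.
Proof.
move=> Fx; have [[v Pv]|nx] := pselect (copies setT psi x); last exact: (wreathN ms).
by case: (Pv) => y _ e; rewrite -e (wreathE ms) // Fx // perm1.
Qed.

Lemma psi_P v w y : P v (psi w y) -> v = w.
Proof. by move=> Pv; apply: P_disj Pv (P_psi w y). Qed.

Lemma mp_fix (s : {perm X}) x : (forall v, P v x -> s v = v) -> mp s x = x.
Proof. exact: (mperm_fix ms). Qed.

Lemma q_fix v x : v != c -> P v x -> q x = x.
Proof.
move=> vc Pv; apply: q_supp => [/Z_P|Pc]; first by move/(_ v).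
by case/eqP: vc; apply: P_disj Pv Pc.
Qed.

Definition base v (g : homeo T) := W (fun w => if w == v then g else 1).

Lemma baseM v g h : base v g * base v h = base v (g * h).
Proof. by rewrite /base WM; congr wreath; apply/funext => w; case: eqP => // _; exact: mul1g. Qed.

Lemma baseV v g : (base v g)^-1 = base v g^-1.
Proof. by rewrite /base WV; congr wreath; apply/funext => w; case: eqP => // _; exact: invg1. Qed.

Lemma base1 v : base v 1 = 1.
Proof. by rewrite -[RHS]W1; congr wreath; apply/funext => w; case: eqP. Qed.

(** [psi v] is only locally in [G], so this is not immediate. The admissible [g] form a subgroup,
    which contains the even permutations of multisections because [psi v] transports
    multisections. *)
Lemma base_G v g : G g -> G (base v g).
Proof.
have sB : subgroup [set g | G (base v g)].
  apply/subgroupP; split=> [|h h' Gh Gh'|h Gh] /=.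
  - by rewrite base1; apply: subgroup1.
  - by rewrite -baseM; apply: subgroupM.
  - by rewrite -baseV; apply: subgroupV.
apply: (contains_alt_full sG simpleG vigG sB) => E phi s msE _ es /=.
have msv : multisection G E (fun j => psi v \o phi j).
  have [cE lphi injE] := msE; have [_ lpsi injp] := ms.
  split=> // [j|i j x y Ex Ey /injp[//|//|_]]; last exact: injE.
  by apply: locally_in_comp (lphi j) (lpsi v) _.
suff -> : base v (mperm E phi s) = mperm E (fun j => psi v \o phi j) s by apply: mperm_even.
apply: (mperm_ext msv) => [j y Ey|x nx] /=.
  by rewrite /base (wreathE ms) // eqxx perm1 (mpermE msE).
rewrite /base; have [[w [z _ e]]|nx'] := pselect (copies setT psi x); last exact: (wreathN ms).
rewrite -e (wreathE ms) // perm1; case: eqP => // wv; rewrite (mpermN msE) // => -[j [y Ey yz]].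
by apply: nx; exists j, y; rewrite //= yz -wv.
Qed.

Lemma W_G F : (forall v, G (F v)) -> G (W F).
Proof.
move=> GF; have H (l : seq X) : uniq l -> G (W (fun v => if v \in l then F v else 1)).
  elim: l => [_|w l IHl /= /andP[ws us']]; first by rewrite W1; apply: subgroup1.
  have -> : W (fun v => if v \in w :: l then F v else 1) =
      base w (F w) * W (fun v => if v \in l then F v else 1).
    rewrite /base WM; congr wreath; apply/funext => v; rewrite inE.
    by case: eqP => [->|_] /=; rewrite ?(negPf ws) ?mulg1 ?mul1g.
  by apply: subgroupM => //; [apply: base_G|apply: IHl].
have := H (enum {: X}) (enum_uniq _); congr G; congr wreath.
by apply/funext => v; rewrite mem_enum.
Qed.

Lemma label_G i : G (label i) /\ label i ^+ m'.+2 = 1.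
Proof.
rewrite /label; case: ifP => _; last by rewrite expg1n; split=> //; exact: subgroup1.
have [lt|ge] := ltnP (i %/ 3) (size us); first by apply: usG; rewrite mem_nth.
by rewrite nth_default // expg1n; split=> //; exact: subgroup1.
Qed.

Lemma lam_G v : G (lam v).
Proof.
rewrite /lam; case: ifP => _; last exact: subgroup1.
by apply: subgroupM => //; [apply: subgroupV => //|]; apply: (label_G _).1.
Qed.

(** Labels occur only at indices congruent to 2 modulo 3, so at most one factor is nontrivial; the
    order of a product of two of them would be uncontrolled. *)
Lemma lam_order v : lam v ^+ m'.+2 = 1.
Proof.
rewrite /lam; case: ifP => _; last exact: expg1n.
have [i1|i1] := boolP (v.1.+1 %% 3 == 2)%N; last first.
  by rewrite {1}/label (negPf i1) invg1 mul1g; apply: (label_G _).2.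
have -> : label v.1 = 1.
  by rewrite /label ifF //; apply/eqP => i0; move: i1; rewrite -addn1 -modnDml i0.
by rewrite mulg1 expVgn (label_G _).2 invg1.
Qed.

Lemma Lam_G : G Lam. Proof. by apply: W_G; exact: lam_G. Qed.

Lemma Lam_order : Lam ^+ m'.+2 = 1.
Proof. by rewrite /Lam WX -[RHS]W1; congr wreath; apply/funext => v; apply: lam_order. Qed.

Lemma alpha_G : G alpha.
Proof.
apply: subgroupM => //; last exact: Lam_G.
by apply: subgroupM => //; apply: (mperm_even sG simpleG vigG ms); apply: sigma_even.
Qed.

Lemma beta_G : G beta.
Proof. by apply: (mperm_even sG simpleG vigG ms); apply: rho_even. Qed.

Lemma sigma_c : sigma c = c.
Proof. by rewrite sigma_leaf // leqnn; lia. Qed.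

Lemma commute_mp_q s : s c = c -> commute (mp s) q.
Proof.
move=> sc; apply: commute_sym.
apply: (@commute_disjoint_support _ _ (P c `|` Z)) => [x /not_orP[nP nZ]|x [Pc|Zx]].
- exact: q_supp.
- by apply: mp_fix => v Pv; rewrite (P_disj Pv Pc).
- by apply: mp_fix => v /(Z_P Zx).
Qed.

Lemma commute_W_q F : F c = 1 -> commute (W F) q.
Proof.
move=> Fc; apply: commute_sym.
apply: (@commute_disjoint_support _ _ (P c `|` Z)) => [x /not_orP[nP nZ]|x [Pc|Zx]].
- exact: q_supp.
- by apply: W_fix => v Pv; rewrite (P_disj Pv Pc).
- by apply: W_fix => v /(Z_P Zx).
Qed.

Lemma commute_mp_W s F : (forall v, F (s v) = F v) -> commute (mp s) (W F).
Proof. by move=> sF; rewrite /commute mpW Wmp; congr wreath; apply/funext => v. Qed.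

Lemma commute_sigma_Lam : commute (mp sigma) Lam.
Proof. exact: commute_mp_W lam_sigma. Qed.

(** The three factors commute: [lam] is constant on [sigma]-cycles, and [q] lives on [Z] and on the
    copy [c], which is fixed by [sigma] and has trivial label. *)
Lemma alpha_order : alpha ^+ m'.+2 = 1.
Proof.
rewrite expgMn; last first.
  apply: commute_sym; apply: commuteM; first exact/commute_sym/commute_sigma_Lam.
  exact: commute_W_q lam_c.
rewrite expgMn; last exact: commute_mp_q sigma_c.
by rewrite -(mpermX ms) sigma_order (mperm1 ms) qm Lam_order !mulg1.
Qed.

Lemma beta_order : beta ^+ n'.+3 = 1.
Proof. by rewrite -(mpermX ms) rho_order (mperm1 ms). Qed.

Lemma alpha_psi v y : v != c -> alpha (psi v y) = psi (sigma v) (lam v y).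
Proof.
move=> vc; rewrite /alpha !homeoME (mpermE ms) // (q_fix _ (P_psi _ _)).
  by rewrite (wreathE ms) // perm1 lam_sigma.
by apply: contra vc => /eqP e; rewrite -(inj_eq (@perm_inj _ sigma)) e sigma_c.
Qed.

Lemma q_stable x : (P c `|` Z) x -> (P c `|` Z) (q x).
Proof.
by move=> Ax; apply/(homeo_support (A := P c `|` Z)) => // y /not_orP[nP nZ]; apply: q_supp.
Qed.

Lemma alpha_q x : (P c `|` Z) x -> alpha x = q x.
Proof.
move=> Ax; rewrite /alpha !homeoME mp_fix.
  have [Pq|Zq] := q_stable Ax; apply: W_fix => v Pv; last by case: (Z_P Zq Pv).
  by rewrite (P_disj Pv Pq) lam_c.
by move=> v Pv; case: Ax => [Pc|/Z_P/(_ Pv)//]; rewrite (P_disj Pv Pc) sigma_c.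
Qed.

Lemma alphaX_q j x : (P c `|` Z) x -> (alpha ^+ j) x = (q ^+ j) x.
Proof.
elim: j x => [|j IHj] x Ax; first by rewrite !expg0.
by rewrite !expgS homeoME [RHS]homeoME alpha_q // IHj //; apply: q_stable.
Qed.

Lemma alpha_fix x : ~ copies setT psi x -> ~ Z x -> alpha x = x.
Proof.
move=> nx nZ; rewrite /alpha !homeoME (mpermN ms) // q_supp // => [|Pc].
  exact: (wreathN ms).
by apply: nx; exists c.
Qed.

(* Naming [mp tau] keeps arithmetic rewriting out of its type. *)
Definition mtau := mp tau.

(* Since [lam] is the coboundary of [pot] along [tau], conjugation removes the labels. *)
Lemma alpha_beta : alpha * beta = (q * mtau) ^ W pot.
Proof.
have -> : alpha = q * (Lam * mp sigma).
  by rewrite /alpha (commute_mp_q sigma_c) -mulgA commute_sigma_Lam.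
rewrite conjMg (_ : q ^ W pot = q); last first.
  apply/conjg_fixP/commgP; apply: commute_sym; apply: commute_W_q.
  by rewrite pot_vx //= label_big //; lia.
rewrite -!mulgA; congr (_ * _); rewrite -(mpermM ms) Wmp conjgE WV /mtau mpW.
rewrite (wreathM ms) // mul1g; congr wreath; apply/funext => v.
by rewrite perm1 lam_pot.
Qed.

Notation f := (q * mtau).

Lemma f_inA v y j : inA v -> (f ^+ j) (psi v y) = psi ((Omega ^+ j) v) y.
Proof.
elim: j v => [|j IHj] v Av; first by rewrite !expg0 perm1.
rewrite !expgS homeoME permM homeoME (@q_fix v).
- by rewrite (mpermE ms) // tau_inA // IHj //; apply: (Omega_inA k4).
- by apply: contraTneq Av => ->; exact: c_outA.
- exact: P_psi.
Qed.

Lemma f_ring j (y w : T) : (0 < j <= b)%N -> q y = psi c w -> (f ^+ j) y = psi ((tau ^+ j) c) w.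
Proof.
move=> /andP[+ + qy]; elim: j => // j IHj _ jb.
rewrite expgSr homeoME [in RHS]expgSr permM homeoME.
have [->|j0] := posnP j; first by rewrite expg0 perm1 qy (mpermE ms).
rewrite IHj ?(ltnW jb) // (@q_fix ((tau ^+ j) c)); last exact: P_psi.
  by rewrite (mpermE ms).
by apply/eqP; apply: tau_ring_neq; rewrite j0.
Qed.

Lemma f_ring_order y : P c (q y) -> (f ^+ b) y = q y.
Proof.
move=> [w _ qy]; rewrite (@f_ring b y w) ?leqnn ?ring_size_gt0 //.
by rewrite tau_ring_order //; apply: c_outA.
Qed.

Lemma f_Z y : Z (q y) -> f y = q y.
Proof. by move=> /Zc nc; rewrite homeoME (mpermN ms). Qed.

Lemma qX_stable j x : (P c `|` Z) x -> (P c `|` Z) ((q ^+ j) x).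
Proof.
move=> Ax; elim: j => [|j IHj]; first by rewrite expg0.
by rewrite expgSr homeoME; apply: q_stable.
Qed.

Lemma f_qX j x : (P c `|` Z) x -> exists r, (f ^+ r) x = (q ^+ j) x.
Proof.
move=> Ax; elim: j => [|j [r IHr]]; first by exists 0%N; rewrite !expg0.
rewrite expgSr homeoME; have [] := qX_stable j.+1 Ax; rewrite expgSr homeoME => h.
  by exists (r + b)%N; rewrite expgnDr homeoME IHr f_ring_order.
by exists r.+1; rewrite expgSr homeoME IHr f_Z.
Qed.

Lemma expg_fix (h : homeo T) n N x : (h ^+ n) x = x -> (n %| N)%N -> (h ^+ N) x = x.
Proof.
move=> hx /dvdnP[l ->]; rewrite mulnC expgnA; elim: l => [|l IHl]; first by rewrite expg0.
by rewrite expgS homeoME hx.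
Qed.

(* On the ring an orbit of [f] closes up after [m'.+2 * b] steps, or after [m'.+1 * b + 1]
   steps if it passes through [Z], where the link skips one turn. *)
Notation E := (m'.+2 * b * (m'.+1 * b).+1)%N.

Lemma f_torsion_Z z : Z z -> (f ^+ E) z = z.
Proof.
move=> Zz; have H j : (j < m'.+2)%N -> (f ^+ (b * j)) z = (q ^+ j) z.
  elim: j => [|j IHj] jm; first by rewrite muln0 !expg0.
  rewrite mulnS addnC expgnDr homeoME IHj ?(ltnW jm) // [RHS](congr1 (fun g : homeo T => g z) (expgSr q j)) homeoME.
  by apply: f_ring_order; rewrite -homeoME -(expgSr q j); apply: qZ.
apply: (@expg_fix _ (m'.+1 * b).+1); last by rewrite dvdn_mull.
have qz : q ((q ^+ m'.+1) z) = z by rewrite -homeoME -(expgSr q m'.+1) qm.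
by rewrite expgSr homeoME mulnC H // f_Z qz.
Qed.

Lemma f_torsion x : (P c `|` Z) x -> (f ^+ E) x = x.
Proof.
move=> Ax; have [[j Zq]|nZ] := pselect (exists j, Z ((q ^+ j) x)).
  have [r fr] := f_qX j Ax; apply: (@homeo_inj (f ^+ r)).
  by rewrite -homeoME -expgnDr addnC expgnDr homeoME fr f_torsion_Z.
have Pq j : P c ((q ^+ j) x).
  by case: (qX_stable j Ax) => // Zq; case: nZ; exists j.
apply: (@expg_fix _ (m'.+2 * b)); last by rewrite dvdn_mulr.
have H j : (f ^+ (b * j)) x = (q ^+ j) x.
  elim: j => [|j IHj]; first by rewrite muln0 !expg0.
  rewrite mulnS addnC expgnDr homeoME IHj // [RHS](congr1 (fun g : homeo T => g x) (expgSr q j)) homeoME.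
  by apply: f_ring_order; rewrite -homeoME -(expgSr q j).
by rewrite mulnC H qm.
Qed.

(** [E] is a multiple of every period met on [Z] and on the ring. It suffices to check this at the
    points of [P c] and [Z], since every point of a ring copy is reached from one of them by a power
    of [f]. *)
Lemma f_E : f ^+ E = mp (Omega ^+ E).
Proof.
have OmegaX_out j v : ~~ inA v -> (Omega ^+ j) v = v.
  by move=> nA; elim: j => [|j IHj]; rewrite ?perm1 // expgSr permM IHj (Omega_outA k4).
apply: (mperm_ext ms) => [v y _|x nx].
  have [Av|nAv] := boolP (inA v); first exact: f_inA.
  rewrite OmegaX_out //; have [r rb ->] := tau_ring k4 nAv.
  have [->|r0] := posnP r; first by rewrite perm1; apply: f_torsion; left; apply: P_psi.
  have Ay : (P c `|` Z) (q^-1 (psi c y)).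
    apply/(homeo_support (g := q)) => [z /not_orP[nP nZ]|]; first exact: q_supp.
    by left; rewrite homeoKV; apply: P_psi.
  have fy : (f ^+ r) (q^-1 (psi c y)) = psi ((tau ^+ r) c) y.
    by apply: f_ring; rewrite ?homeoKV // r0 ltnW.
  by rewrite -fy -homeoME -expgnDr addnC expgnDr homeoME f_torsion.
have [Zx|nZ] := pselect (Z x); first exact: f_torsion_Z.
apply: (@expg_fix _ 1); last exact: dvd1n.
rewrite expg1 homeoME q_supp // => [|Pc]; first exact: (mpermN ms).
by apply: nx; exists c.
Qed.

(** * Subgroups containing [alpha] and [beta] *)

Section Generated.
Variable H : set (homeo T).
Hypotheses (sH : subgroup H) (HG : H `<=` G) (Ha : H alpha) (Hb : H beta).

(** By Bezout a power of [Omega ^+ E] is [Omega]. Conjugation by [W pot] leaves it unchanged,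
    because [pot] is trivial on [inA], outside which [Omega] is the identity. *)
Lemma Omega_in : H (mp Omega).
Proof.
have [//||e] := @expg_coprime _ _ k.+2 E (Omega_order m' n' k4).
  by rewrite prime_coprime //; apply: ring_coprime.
have := f_E; move: E => N fN OE.
have -> : mp Omega = (alpha * beta) ^+ (N * e).
  rewrite alpha_beta -conjXg expgnA fN -(mpermX ms) -expgnA OE; apply/esym/conjg_fixP/commgP.
  apply: commute_mp_W => v; have [Av|nAv] := boolP (inA v).
    by rewrite !pot_inA //; apply: (Omega_inA k4).
  by rewrite (Omega_outA k4).
by apply: subgroupX => //; apply: subgroupM.
Qed.

Lemma mp_subgroup : subgroup [set s | H (mp s)].
Proof.
apply/subgroupP; split=> [|s t Hs Ht|s Hs] /=.
- by rewrite (mperm1 ms); apply: subgroup1.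
- by rewrite (mpermM ms); apply: subgroupM.
- by rewrite (mpermV ms); apply: subgroupV.
Qed.

(** [kap] permutes three leaves other than [c], so it commutes with [mp sigma] and [q], and
    conjugating [alpha] by it only displaces labels. These are [1], [u], [1] on the three leaves, so
    the quotient by [alpha] is [u] on [o] and [u^-1] on one leaf. *)
Lemma pair_in (x : nat) : (x < size us)%N -> H (W (fun v => if v == o then nth 1 us x
  else if v == vx (3 * x + 2) 1 then (nth 1 us x)^-1 else 1)).
Proof.
move=> xs; set i := (3 * x + 2)%N.
have k0 : (0 < k.-1 <= k)%N by lia.
have i0 : (0 < i <= k)%N by rewrite /i; lia.
have i1 : (0 < i.+1 <= k)%N by rewrite /i; lia.
have oi : o != vx i 1 by rewrite vx_eq; rewrite ?/i //; lia.
have oi1 : o != vx i.+1 1 by rewrite vx_eq; rewrite ?/i //; lia.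
have ii1 : vx i 1 != vx i.+1 1 by rewrite vx_eq; rewrite ?/i //; lia.
have [K1 K2 K3 K4] := cyc3E oi ii1 oi1.
set kap := cyc3 o (vx i 1) (vx i.+1 1) in K1 K2 K3 K4.
have Hk : H (mp kap).
  apply: (@cyc3_leaves_target m' n' k k4 [set s | H (mp s)] i mp_subgroup Omega_in Hb).
    by rewrite /i; lia.
  by rewrite /i; lia.
have sk : kap ^ sigma = kap by rewrite /kap cyc3J !sigma_leaf.
have com : commute (mp sigma * q) (mp kap).
  apply: commute_sym; apply: commuteM.
    by rewrite /commute -!(mpermM ms) conjgC sk.
  apply: commute_mp_q; rewrite K4 // eq_sym vx_eq //; lia.
have -> : W (fun v => if v == o then nth 1 us x else if v == vx i 1 then (nth 1 us x)^-1 else 1)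
    = alpha^-1 * alpha ^ (mp kap)^-1.
  have -> : alpha ^ (mp kap)^-1 = mp sigma * q * Lam ^ (mp kap)^-1.
    by rewrite conjMg; congr (_ * _); apply/conjg_fixP/commgP/commuteV.
  rewrite /alpha [X in X * _]invgM -mulgA mulKg -(mpermV ms) WJ WV WM; congr wreath.
  apply/funext => v; rewrite invgK.
  have lab_i : label i = nth 1 us x.
    by rewrite /label /i mulnC modnMDl /= divnMDl // addn0.
  have lab_i1 : label i.+1 = 1 by rewrite /label /i -addnS mulnC modnMDl.
  have lab_i2 : label i.+2 = 1 by rewrite /label /i -!addnS mulnC modnMDl.
  have lam_i : lam (vx i 1) = nth 1 us x by rewrite lam_vx ?lab_i ?lab_i1 /= ?invg1 ?mul1g //; lia.
  have lam_i1 : lam (vx i.+1 1) = 1 by rewrite lam_vx ?lab_i1 ?lab_i2 /= ?mulVg //; lia.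
  case: (v =P o) => [->|vo]; first by rewrite K1 lam_i lam_o invg1 mul1g.
  case: (v =P vx i 1) => [->|vi]; first by rewrite K2 lam_i lam_i1 mulg1.
  case: (v =P vx i.+1 1) => [->|vi1]; first by rewrite K3 lam_i1 lam_o mulVg.
  by rewrite K4 ?mulVg //; apply/eqP.
by apply: subgroupM => //; [apply: subgroupV|apply: subgroupJ => //; apply: subgroupV].
Qed.

Lemma WJW F F' : W F ^ W F' = W (fun v => F v ^ F' v).
Proof. by rewrite conjgE WV !WM; congr wreath; apply/funext => v; rewrite conjgE. Qed.

(** On the copy [o], conjugation by the element of [pair_in] is conjugation by a label, and the
    labels generate [G]. The equivalence in [N] makes it closed under inverses. *)
Lemma base_normal : normal_in [set g | G g /\ H (base o g)] G.
Proof.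
split=> [|g []//|g h [Gg Hg] Gh].
  apply/subgroupP; split=> [|g h [Gg Hg] [Gh Hh]|g [Gg Hg]].
  - by split; [apply: subgroup1|rewrite base1; apply: subgroup1].
  - by split; [apply: subgroupM|rewrite -baseM; apply: subgroupM].
  - by split; [apply: subgroupV|rewrite -baseV; apply: subgroupV].
split; first exact: subgroupJ.
pose N := [set h | forall g, (H (base o (g ^ h)) <-> H (base o g))].
have sN : subgroup N.
  apply/subgroupP; split=> [g'|a b Na Nb g'|a Na g'].
  - by rewrite conjg1.
  - by rewrite conjgM Nb Na.
  - by rewrite -Na conjgKV.
suff Nh : N h by apply/Nh.
move: Gh; rewrite -gen_us; apply: (generated_sub sN) => u /= /(nthP 1)[x xs <-] g'.
have := pair_in xs; set Wx := W _ => HW.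
have -> : base o (g' ^ nth 1 us x) = base o g' ^ Wx.
  rewrite /base WJW; congr wreath; apply/funext => v.
  by case: eqP => // _; rewrite conj1g.
split=> [|Hg']; last exact: subgroupJ.
move=> Hg'; rewrite -[base o g'](conjgK Wx); apply: subgroupJ => //.
exact: subgroupV.
Qed.

(** For distinct labels, the two elements of [pair_in] share only the copy [o], so their commutator
    lives there. *)
Lemma base_commutator (x y : nat) : (x < size us)%N -> (y < size us)%N ->
  H (base o [~ nth 1 us x, nth 1 us y]).
Proof.
move=> xs ys; have [->|xy] := eqVneq x y.
  by rewrite (_ : [~ _, _] = 1) ?base1; [apply: subgroup1|apply/eqP/commgP].
have := pair_in xs; set Wx := W _ => Hx; have := pair_in ys; set Wy := W _ => Hy.
have -> : base o [~ nth 1 us x, nth 1 us y] = Wx^-1 * Wx ^ Wy.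
  rewrite /Wx /Wy WJW WV WM; congr wreath; apply/funext => v; case: eqP => // _.
  case: (v =P vx _ 1) => [->|_]; last by rewrite conj1g mulgV.
  rewrite vx_eq ?ifF ?conjg1 ?mulVg //; try lia.
by apply: subgroupM => //; [apply: subgroupV|apply: subgroupJ].
Qed.

(** By simplicity the normal subgroup of [base_normal] is [G] or trivial; in the second case the
    labels commute by [base_commutator], and [G] would be abelian. *)
Lemma base_in g : G g -> H (base o g).
Proof.
have [_ simp] := simpleG; have [M1|MG] := simp _ base_normal; last by rewrite -{1}MG => -[].
have [a [b [Ga Gb []]]] := exists_noncommuting sG simpleG vigG.
move: Ga Gb; rewrite -gen_us; apply: generated_abelian => _ _ /= /(nthP 1)[x xs <-] /(nthP 1)[y ys <-].
apply/commgP/eqP; have : [set g | G g /\ H (base o g)] [~ nth 1 us x, nth 1 us y].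
  split; last exact: base_commutator.
  have Gu (z : nat) : (z < size us)%N -> G (nth 1 us z) by move=> zs; apply: (usG _).1; rewrite mem_nth.
  by apply: subgroupM; [|apply: subgroupV|apply: subgroupJ] => //; apply: Gu.
by rewrite M1.
Qed.

Lemma alt_c : contains_alt G H (P c).
Proof.
have ko : H (mp (cyc3 (vx 1 0) o c)).
  have := @cyc3_leaves m' n' k k4 [set s | H (mp s)] k.-1 mp_subgroup Omega_in Hb.
  by rewrite (prednK (n := k)); [apply; lia|lia].
have K2 : cyc3 (vx 1 0) o c o = c.
  by case: (@cyc3E _ (vx 1 0) o c) => //; rewrite vx_eq //; lia.
apply: contains_alt_sub (contains_alt_image sG sH HG ko (contains_alt_copy sG simpleG vigG ms base_in)).
by move=> _ [y _ <-]; exists (psi o y); [exact: P_psi|rewrite (mpermE ms) // K2].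
Qed.

Lemma clopen_P v : clopen (P v).
Proof. exact: (clopen_copy ms). Qed.

Lemma clopen_PZ v : clopen (P v `|` Z).
Proof. by apply: clopenU => //; exact: clopen_P. Qed.

Lemma alpha_Z z : Z z -> P c (alpha z).
Proof. by move=> Zz; rewrite alpha_q; [have := @qZ 1%N z isT Zz; rewrite expg1|right]. Qed.

(** On [P c] and [Z], [alpha] acts as [q]: the image of [P c] covers [Z], whose previous position
    under [q] is in [P c], and it meets [P c] by [q_overlap]. *)
Lemma alt_cZ : contains_alt G H (P c `|` Z).
Proof.
have aP := contains_alt_image sG sH HG Ha alt_c.
apply: contains_alt_sub (contains_altU sG vigG sH HG (clopen_P c) (clopen_image alpha (clopen_P c)) _ alt_c aP).
  move=> x [Pc|Zx]; [by left|right]; exists ((q ^+ m'.+1) x); first by apply: qZ; rewrite ?ltnSn.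
  by rewrite alpha_q; [rewrite -homeoME -(expgSr q m'.+1) qm|left; apply: qZ; rewrite ?ltnSn].
have [y Py Pqy] := q_overlap; exists (q y); split=> //; exists y => //.
by rewrite alpha_q //; left.
Qed.

(** [Z] accompanies each copy to provide the overlaps: [beta] fixes it, and [alpha] sends it into
    [P c], so the image under [alpha] meets the set of [alt_cZ], which restores [Z]. *)
Lemma alt_PZ v : contains_alt G H (P v `|` Z).
Proof.
move: v; refine (@hypermap_transitive m' n' k k4 (fun v => contains_alt G H (P v `|` Z)) _ _ _) => [|v Av|v Av].
- exact: alt_cZ.
- apply: contains_alt_sub (contains_alt_image sG sH HG Hb Av) => x [[y _ <-]|Zx].
    by exists (psi v y); [left; exact: P_psi|rewrite (mpermE ms)].
  by exists x; [right|apply: mp_fix => w /(Z_P Zx)].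
have [->|vc] := eqVneq v c; first by rewrite sigma_c; exact: alt_cZ.
have aA := contains_alt_image sG sH HG Ha Av.
apply: contains_alt_sub (contains_altU sG vigG sH HG (clopen_image alpha (clopen_PZ v))
  (clopen_PZ c) _ aA alt_cZ).
  move=> x [[y _ <-]|Zx]; last by right; right.
  left; exists (psi v ((lam v)^-1 y)); first by left; exact: P_psi.
  by rewrite alpha_psi // homeoKV.
have [z Zz] := Z0; exists (alpha z); split; last by left; apply: alpha_Z.
by exists z; [right|].
Qed.

Lemma alt_core : contains_alt G H (Z `|` copies setT psi).
Proof.
have altZ : contains_alt G H Z by apply: contains_alt_sub alt_cZ; right.
apply: contains_alt_sub (contains_alt_bigU (s := enum {: X}) sG vigG sH HG cZ Z0 clopen_PZ _ altZ _).
- move=> x [Zx|[v Pv]]; [by left|right]; exists v; first by rewrite mem_enum.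
  by left.
- by move=> v _ x; right.
- by move=> v _; exact: alt_PZ.
Qed.
End Generated.

(** * Further generators and private points *)

Section Assembly.
Variables (I : finType) (ia : I) (oth : pred I) (m : I -> nat).
Variables (E : I -> set T) (a : I -> homeo T).
Notation Q := (P (vx 1 0)).
Hypotheses (m_ia : m ia = m'.+2) (oth_ia : ~~ oth ia).
Hypotheses (cE : forall i, clopen (E i)) (E_disj : forall i j x, E i x -> E j x -> i = j)
  (E0 : forall i, oth i -> E i !=set0)
  (E_out : forall i x, oth i -> E i x -> ~ copies setT psi x /\ ~ Z x)
  (cover : forall x, copies setT psi x \/ Z x \/ exists2 i, oth i & E i x).
Hypothesis aP : forall i, oth i -> [/\ (1 < m i)%N, G (a i), a i ^+ m i = 1,
  forall x, ~ E i x -> ~ Q x -> a i x = x &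
  forall j z, (0 < j < m i)%N -> E i z -> Q ((a i ^+ j) z)].

(** The indices whose generators produce [beta]: a single one, or two when all orders are 2. *)
Definition rest i := ~~ oth i && (i != ia).
Section Rest.
Variables (B : I -> homeo T) (p : I -> T).
Hypotheses (BP : forall i, rest i -> [/\ G (B i), has_order (B i) (m i) &
    forall x, ~ copies setT psi x -> B i x = x])
  (B_beta : forall H, subgroup H -> (forall i, rest i -> H (B i)) -> H beta)
  (pP : forall i, rest i -> [/\ copies setT psi (p i), ~ Q (p i), alpha (p i) = p i,
    B i (p i) <> p i & forall j, rest j -> j <> i -> B j (p i) = p i]).

Definition gen i := if oth i then a i else if i == ia then alpha else B i.

Lemma gen_oth i : oth i -> gen i = a i. Proof. by rewrite /gen => ->. Qed.
Lemma gen_ia : gen ia = alpha. Proof. by rewrite /gen (negPf oth_ia) eqxx. Qed.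
Lemma gen_rest i : rest i -> gen i = B i.
Proof. by rewrite /gen => /andP[/negPf -> /negPf ->]. Qed.

Lemma gen_ind (K : I -> Prop) : (forall i, oth i -> K i) -> K ia -> (forall i, rest i -> K i) ->
  forall i, K i.
Proof.
move=> Ko Ka Kr i; have [/Ko //|no] := boolP (oth i).
by have [-> //|ni] := eqVneq i ia; apply: Kr; rewrite /rest no.
Qed.

Lemma gen_G i : G (gen i).
Proof.
elim/gen_ind: i => [i oi||i ri]; first by rewrite gen_oth //; case: (aP oi).
  by rewrite gen_ia; exact: alpha_G.
by rewrite gen_rest //; case: (BP ri).
Qed.

Lemma Z_neq z x : Z z -> copies setT psi x -> x <> z.
Proof. by move=> Zz Px xz; apply: (Zc Zz); rewrite -xz. Qed.

Lemma E_neq i z x : oth i -> E i z -> copies setT psi x -> x <> z.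
Proof. by move=> oi Ez Px xz; apply: (E_out oi Ez).1; rewrite -xz. Qed.

Lemma P_copies v x : P v x -> copies setT psi x. Proof. by exists v. Qed.

Lemma gen_order i : has_order (gen i) (m i).
Proof.
elim/gen_ind: i => [i oi||i ri]; last by rewrite gen_rest //; case: (BP ri).
  have [m2 _ am _ aE] := aP oi; rewrite gen_oth //; split=> // [|j jm aj]; first exact: ltnW.
  have [z Ez] := E0 oi; apply: (E_neq oi Ez (P_copies (aE _ _ jm Ez))).
  by rewrite aj.
rewrite gen_ia m_ia; split=> // [|j jm aj]; first exact: alpha_order.
have [z Zz] := Z0; apply: (Z_neq Zz (P_copies (qZ jm Zz))).
by rewrite -alphaX_q ?aj //; right.
Qed.

(** The private point lies in [E i] for a linking generator, in [Z] for [alpha], and is the given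
    [p i] for the generators producing [beta]. *)
Lemma gen_private i : exists x, gen i x <> x /\ forall j, j <> i -> gen j x = x.
Proof.
elim/gen_ind: i => [i oi||i ri].
- have [m2 _ _ _ aE] := aP oi; have [z Ez] := E0 oi; exists z; have [nc nZ] := E_out oi Ez.
  split; first by rewrite gen_oth //; apply: (E_neq oi Ez); apply/P_copies/(aE 1%N _ _ Ez).
  elim/gen_ind => [j oj ji||j rj _].
  + have [_ _ _ a_supp _] := aP oj; rewrite gen_oth // a_supp // => [Ej|/P_copies //].
    by apply: ji; apply: E_disj Ej Ez.
  + by rewrite gen_ia => _; apply: alpha_fix.
  + by rewrite gen_rest //; have [_ _] := BP rj; apply.
- have [z Zz] := Z0; exists z; split; first by rewrite gen_ia; apply/(Z_neq Zz)/P_copies/alpha_Z.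
  elim/gen_ind => [j oj _|//|j rj _].
  + have [_ _ _ a_supp _] := aP oj; rewrite gen_oth // a_supp // => [Ej|/P_copies /(Zc Zz) //].
    by case: (E_out oj Ej).
  + by rewrite gen_rest //; have [_ _] := BP rj; apply; apply: Zc.
have [cp nQ ap Bp Bj] := pP ri; exists (p i); split; first by rewrite gen_rest.
elim/gen_ind => [j oj _||j rj ji].
- have [_ _ _ a_supp _] := aP oj; rewrite gen_oth // a_supp // => Ej.
  by case: (E_out oj Ej).
- by rewrite gen_ia.
- by rewrite gen_rest // Bj.
Qed.

(* [alt_core] gives the 3-cycles on the copies and [Z]; each link then adds its own piece. *)
Lemma gen_full : generated (range gen) = G.
Proof.
have sG0 : generated (range gen) `<=` G.
  by apply: generated_sub => // _ [i _ <-]; apply: gen_G.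
set H := generated (range gen); have sH : subgroup H := generated_subgroup _.
have Hg i : H (gen i) by apply: sub_generated; exists i.
have Ha : H alpha by rewrite -gen_ia.
have Hb : H beta by apply: B_beta => // i ri; rewrite -gen_rest.
apply/seteqP; split=> //; apply: (contains_alt_full sG simpleG vigG sH).
have core := alt_core sH sG0 Ha Hb; set Y := Z `|` copies setT psi in core.
have cY : clopen Y by apply: clopenU => //; apply: (clopen_copies ms).
have [z Zz] := Z0; have Yz : Y z by left.
have Y_E i : oth i -> contains_alt G H (Y `|` E i).
  move=> oi; have [m2 _ am a_supp aE] := aP oi.
  have Hai : H (a i) by rewrite -gen_oth.
  have aY := contains_alt_image sG sH sG0 Hai core.
  (* A point of [Z], fixed by [a i], is the overlap between [Y] and its image. *)
  have az : a i z = z.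
    by apply: a_supp => [/(E_out oi) []//|/P_copies/(Zc Zz)].
  apply: contains_alt_sub (contains_altU sG vigG sH sG0 cY (clopen_image (a i) cY) _ core aY).
    move=> x [Yx|Ex]; [by left|right]; exists ((a i ^+ (m i).-1) x).
      by right; apply: P_copies (aE _ _ _ Ex); lia.
    by rewrite -homeoME -(expgSr (a i)) prednK ?am //; lia.
  by exists z; split=> //; exists z.
apply: contains_alt_sub (contains_alt_bigU (s := enum oth) (Y := fun i => Y `|` E i) sG vigG sH sG0
  cY _ _ _ core _).
- move=> x _; have [cx|[Zx|[i oi Ei]]] := cover x; [by left; right|by left; left|right].
  by exists i; [rewrite mem_enum|right].
- by exists z.
- by move=> i; apply: clopenU.
- by move=> i _ x; left.
- by move=> i; rewrite mem_enum; exact: Y_E.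
Qed.

Lemma gen_minimal : [/\ injective gen, minimal_generating_set (range gen) G &
  forall i, has_order (gen i) (m i)].
Proof.
have [gi gm] := private_minimal gen_private; split=> //; last exact: gen_order.
by split; [exact: gen_full|rewrite -gen_full].
Qed.
End Rest.

Lemma psi_eq v w y : psi v y = psi w y -> v = w.
Proof. by have [_ _ injp] := ms => /injp[]. Qed.

Lemma mpE s v y : mp s (psi v y) = psi (s v) y. Proof. exact: (mpermE ms). Qed.

Lemma rhoX_00 j : (j <= n'.+2)%N -> (rho ^+ j) (vx 0 0) = vx 0 j.
Proof.
elim: j => [|j IHj] jn; first by rewrite expg0 perm1.
by rewrite expgSr permM IHj ?(ltnW jn) // rho_vx ?jn //; lia.
Qed.

Lemma beta_has_order : has_order beta n'.+3.
Proof.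
split=> // [|j /andP[j0 jn]]; first exact: beta_order.
rewrite -(mpermX ms) => bj; have := mpE (rho ^+ j) (vx 0 0) point.
rewrite bj rhoX_00 // => /psi_eq/eqP; rewrite vx_eq //; lia.
Qed.

Lemma alpha_leaf i y : (0 < i < k)%N -> lam (vx i 1) = 1 -> alpha (psi (vx i 1) y) = psi (vx i 1) y.
Proof.
move=> ik li; rewrite alpha_psi ?li ?sigma_leaf //; first by lia.
by rewrite vx_eq //; lia.
Qed.

Definition rest_gen := exists gen : I -> homeo T,
  [/\ injective gen, minimal_generating_set (range gen) G & forall i, has_order (gen i) (m i)].

(** The private point of [beta] is in the copy [o]: a leaf with trivial label is fixed by [alpha],
    while [rho] moves type 1. *)
Lemma rest_one ib : (forall i, rest i = (i == ib)) -> m ib = n'.+3 -> rest_gen.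
Proof.
move=> restE mb; exists (gen (fun=> beta)); apply: (gen_minimal (p := fun=> psi o point)) => [i|H _ HB|i].
- rewrite restE => /eqP ->; rewrite mb; split; [exact: beta_G|exact: beta_has_order|].
  by move=> x; apply: (mpermN ms).
- by apply: (HB ib); rewrite restE.
rewrite restE => /eqP ->; split.
- by exists o; exact: P_psi.
- by move/psi_P/eqP; rewrite vx_eq //; lia.
- by apply: alpha_leaf lam_o; lia.
- rewrite /beta (mpermE ms) // rho_vx // => e.
  by move/psi_eq/eqP: e; rewrite vx_eq //; lia.
by move=> j; rewrite restE => /eqP ->.
Qed.

Definition type_swap (j : nat) : {perm X} := pair_perm _ (tperm (inord j) (inord 2)).

Lemma type_swap_vx j i l : (j < 2)%N -> (l < J)%N ->
  type_swap j (vx i l) = vx i (if l == j then 2%N else if l == 2%N then j else l).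
Proof.
move=> j2 lJ; have jJ : (j < J)%N by lia.
rewrite /type_swap pair_permE /=; congr pair.
have e (u v : nat) : (u < J)%N -> (v < J)%N -> (inord u == inord v :> 'I_J) = (u == v).
  by move=> uJ vJ; rewrite -(inj_eq val_inj) /= !inordK.
case: tpermP => [/eqP|/eqP|/eqP + /eqP].
- by rewrite e // => ->.
- by rewrite e // => /eqP ->; case: eqP => // ->.
by rewrite !e // => /negPf -> /negPf ->.
Qed.

Lemma type_swap_order j : type_swap j ^+ 2 = 1.
Proof. by rewrite /type_swap pair_permX expgS expg1 tperm2 pair_perm1. Qed.

Lemma type_swap_even j : ~~ odd_perm (type_swap j).
Proof. by rewrite /type_swap odd_pair_perm card_ord /= ok. Qed.

Lemma rho_swaps : n' = 0%N -> rho = type_swap 0 * type_swap 1.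
Proof.
move=> n0; apply/permP => v; have [i [j [ik jJ ->]]] := vxP v.
rewrite permM rho_vx // [type_swap 0 _]type_swap_vx // type_swap_vx //; last by case: j jJ => [|[|[]]].
by congr vx; rewrite n0; case: j jJ => [|[|[|j]]].
Qed.

(** The 3-cycle of types is the product of the swaps of 0 and of 1 with 2. Each swap fixes the type
    of the other's private point; these points lie in the copies [vx 0 0] and [o], both fixed by
    [sigma] with trivial label. *)
Lemma rest_two i1 i2 : n' = 0%N -> i1 != i2 -> (forall i, rest i = (i == i1) || (i == i2)) ->
  m i1 = 2%N -> m i2 = 2%N -> rest_gen.
Proof.
move=> n0 i12 restE m1 m2; have k0 : (0 < k)%N by lia.
pose jj i := if i == i1 then 0%N else 1%N.
pose v0 i := if i == i1 then vx 0 0 else o.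
have jj2 i : (jj i < 2)%N by rewrite /jj; case: ifP.
have jjJ i : (jj i < J)%N by apply: leq_trans (jj2 i) _.
have jj1 : jj i1 = 0%N by rewrite /jj eqxx.
have jj_2 : jj i2 = 1%N by rewrite /jj eq_sym (negPf i12).
have mi i : rest i -> m i = 2%N by rewrite restE => /orP[] /eqP ->.
have v0E i : v0 i = vx (if i == i1 then 0%N else k.-1) (jj i) by rewrite /v0 /jj; case: ifP.
have moved i y : type_swap (jj i) (v0 i) <> v0 i.
  rewrite v0E type_swap_vx // eqxx; move/eqP; rewrite vx_eq //; last by case: ifP; lia.
    by have := jj2 i; lia.
  by case: ifP; lia.
exists (gen (fun i => mp (type_swap (jj i)))).
apply: (gen_minimal (p := fun i => psi (v0 i) point)) => [i ri|H sH HB|i ri].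
- split; [by apply: (mperm_even sG simpleG vigG ms); apply: type_swap_even|rewrite mi //|].
    split=> // [|[|[|//]] // _]; first by rewrite -(mpermX ms) type_swap_order (mperm1 ms).
    rewrite expg1 => e; apply: (moved i point).
    have := mpE (type_swap (jj i)) (v0 i) point.
    by rewrite e => /psi_eq.
  by move=> x; apply: (mpermN ms).
- rewrite /beta (rho_swaps n0) (mpermM ms); apply: subgroupM => //.
    by rewrite -jj1; apply: HB; rewrite restE eqxx.
  by rewrite -jj_2; apply: HB; rewrite restE eqxx orbT.
split.
- by exists (v0 i); exact: P_psi.
- move/psi_P/eqP; rewrite v0E vx_eq //; last by case: ifP; lia.
  by rewrite /jj; case: ifP => //; lia.
- have [->|->] : v0 i = vx 0 0 \/ v0 i = o by rewrite /v0; case: ifP; [left|right].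
    rewrite alpha_psi; last by rewrite vx_eq //; lia.
    by rewrite sigma_vx // lam_vx.
  by apply: alpha_leaf lam_o; lia.
- rewrite (mpermE ms) // => e; apply: (moved i point).
  exact: psi_eq e.
move=> j rj ji; rewrite (mpermE ms) // v0E type_swap_vx //; congr psi; congr vx.
move: ri rj ji; rewrite !restE /jj => /orP[]/eqP -> /orP[]/eqP -> ji.
all: by rewrite ?eqxx ?(eq_sym i2) ?(negPf i12).
Qed.
End Assembly.

End Core.

(** * Assembling the generators *)

Lemma nonempty_cantor : [set: T] !=set0. Proof. by exists point. Qed.

Section GeneratingTuples.
Variable G : set (homeo T).
Hypotheses (sG : subgroup G) (simpleG : simple_group G) (vigG : vigorous G).

(** A homeomorphism cannot send the whole space into a proper part, so each copy is assembled from
    two elements of [G], on [B] and on its complement, with targets in disjoint pieces. The leftover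
    piece lies outside all copies. *)
Lemma multisection_exists (J : finType) :
  exists2 psi : J -> T -> T, multisection G setT psi & ~` copies setT psi !=set0.
Proof.
have [B [cB [b Bb] _ [b' [_ nBb']]]] := clopen_split (@clopenT T) nonempty_cantor.
have [C [R [CP C_disj [_ [r Rr] _]]]] := @clopen_fin_pieces (J * bool)%type _ (@clopenT T) nonempty_cantor.
have piece V (c : bool) : clopen V -> (~` V) !=set0 ->
    exists g : J -> homeo T, forall j, G (g j) /\ forall x, V x -> C (j, c) (g j x).
  by move=> cV V0; apply: (@spread G sG vigG J V (fun j => C (j, c))) => // j; case: (CP (j, c)).
have [g gP] := piece B true cB (ex_intro _ b' nBb').
have [h hP] := piece (~` B) false (clopen_compl cB) (ex_intro _ b (fun nB => nB Bb)).
pose psi j x := if pselect (B x) then g j x else h j x.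
have psiB j x : B x -> psi j x = g j x by rewrite /psi; case: pselect.
have psiN j x : ~ B x -> psi j x = h j x by rewrite /psi; case: pselect.
have psiC j x : exists c, C (j, c) (psi j x) /\ (c <-> B x).
  have [Bx|nBx] := pselect (B x); [exists true; rewrite psiB //|exists false; rewrite psiN //].
    by split; [apply: (gP j).2|].
  by split; [apply: (hP j).2|].
exists psi; [split|].
- exact: clopenT.
- move=> j x _; have [Bx|nBx] := pselect (B x).
    by exists B, (g j); split=> //; [exact: (gP j).1|move=> y By _; exact: psiB].
  exists (~` B), (h j); split=> //; [exact: clopen_compl|exact: (hP j).1|].
  by move=> y By _; exact: psiN.
- move=> i j x y _ _ e; have [c [Cx cx]] := psiC i x; have [c' [Cy cy]] := psiC j y.
  rewrite e in Cx; have [ij cc] := C_disj _ _ _ Cx Cy; split=> //.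
  rewrite -ij in e; subst c'; have [Bx|nBx] := pselect (B x).
    by move: e; rewrite !psiB //; [exact: homeo_inj|apply/cy/cx].
  by move: e; rewrite !psiN //; [exact: homeo_inj|move=> By; apply/nBx/cx/cy].
exists r => -[j [x _ e]]; have [c [Cx _]] := psiC j x; have [_ _ _ CR] := CP (j, c).
suff : (C (j, c) `&` R) r by rewrite CR.
by split=> //; rewrite -e.
Qed.

Lemma rest_exists (I : finType) (ia : I) (oth : pred I) (m : I -> nat) (m' n' : nat) :
  finitely_generated G -> (forall i, (2 <= m i)%N) -> m ia = m'.+2 -> ~~ oth ia ->
  (exists2 ib, m ib = n'.+3 & forall i, rest ia oth i = (i == ib)) \/
  n' = 0%N /\ (exists i1 i2, [/\ i1 != i2, forall i, rest ia oth i = (i == i1) || (i == i2),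
    m i1 = 2%N & m i2 = 2%N]) ->
  rest_gen G m.
Proof.
move=> fgG m2 m_ia oth_ia cases.
have [us [usG gen_us]] := torsion_generators sG simpleG vigG (isT : (2 <= m'.+2)%N) fgG.
(* The product is the bound of [ring_coprime]; the remaining terms leave enough leaves for the
   labels, with [c] and [o] unlabelled, and give [3 < k]. *)
have [L Lbig pL] := prime_above (m'.+1 * (m' + n').+3 + 3 * size us + 6)%N.
have [k Lk] : exists k, L = k.+2 by exists (L - 2)%N; lia.
rewrite {L}Lk in Lbig pL.
have ok : odd k by case: (even_prime pL) => [|/=]; [lia|rewrite negbK].
have kbig : (m'.+1 * (m' + n').+3 < k.+2)%N by move: Lbig; lia.
have k4 : (3 < k)%N by lia.
have us_small : (3 * size us + 3 <= k)%N by lia.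
have [psi ms R0] := @multisection_exists ('I_k.+1 * 'I_(m' + n').+3)%type.
have cR : clopen (~` copies setT psi) := clopen_compl (clopen_copies ms).
have [C [R' [CP C_disj [cR' [r R'r] R'R]]]] := @clopen_fin_pieces I _ cR R0.
(* Only the pieces indexed by [oth] are taken out; the others stay in [Z], so that copies, [Z] and
   the chosen pieces cover the space. *)
pose U := [set x | exists i, (if oth i then C i else set0) x].
have cU : clopen U.
  by apply: clopen_exists => i; case: ifP => _; [case: (CP i)|exact: clopen0].
have UP x : U x -> exists2 i, oth i & C i x.
  by move=> -[i]; case: ifP => // oi Ci; exists i.
pose Z := ~` copies setT psi `\` U; have cZ : clopen Z := clopenD cR cU.
have Z0 : Z !=set0.
  exists r; split=> [|/UP[i _ Ci]]; first exact: R'R.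
  by have [_ _ _ CR] := CP i; suff : (C i `&` R') r; [rewrite CR|].
have Zc x : Z x -> ~ copies setT psi x by case.
pose Pv v := psi v @` setT; have cP v : clopen (Pv v) := clopen_copy ms v.
have P0 v : Pv v !=set0 by exists (psi v point), point.
have ZP v : Z `&` Pv v = set0.
  by apply/seteqP; split=> // x [/Zc nc Px]; apply: nc; exists v.
have [q [Gq qm q_supp qZ q_ov]] := exists_link sG simpleG vigG cZ Z0 (cP (vx m' n' k k 1))
  (P0 _) (ZP _) (isT : (1 < m'.+2)%N).
have C_out i x : C i x -> ~ copies setT psi x by case: (CP i) => _ _ CR _ /CR.
have link i : exists a, [/\ (1 < m i)%N, G a, a ^+ m i = 1,
    forall x, ~ C i x -> ~ Pv (vx m' n' k 1 0) x -> a x = x &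
    forall j z, (0 < j < m i)%N -> C i z -> Pv (vx m' n' k 1 0) ((a ^+ j) z)].
  have [cC C0 CR _] := CP i.
  have CPv : C i `&` Pv (vx m' n' k 1 0) = set0.
    by apply/seteqP; split=> // x [/C_out nc Px]; apply: nc; exists (vx m' n' k 1 0).
  have [a [Ga am a_supp aC _]] := exists_link sG simpleG vigG cC C0 (cP _) (P0 _) CPv (m2 i).
  by exists a.
have [a aP] := choice link.
have cC i : clopen (C i) by case: (CP i).
have C0 i : oth i -> C i !=set0 by case: (CP i).
have C_out' i x : oth i -> C i x -> ~ copies setT psi x /\ ~ Z x.
  move=> oi Ci; split; first exact: C_out Ci.
  by move=> [_ nU]; apply: nU; exists i; rewrite oi.
have cover x : copies setT psi x \/ Z x \/ exists2 i, oth i & C i x.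
  have [|nc] := pselect (copies setT psi x); first by left.
  by right; have [/UP|nU] := pselect (U x); [right|left].
have aP' i : oth i -> _ := fun _ => aP i.
case: cases => [[ib m_ib restE]|[n0 [i1 [i2 [i12 restE m1 m2']]]]].
  exact: (rest_one sG simpleG vigG k4 ok pL kbig ms usG gen_us us_small cZ Z0 Zc Gq qm q_supp qZ
    q_ov m_ia oth_ia cC C_disj C0 C_out' cover aP' restE m_ib).
exact: (rest_two sG simpleG vigG k4 ok pL kbig ms usG gen_us us_small cZ Z0 Zc Gq qm q_supp qZ
  q_ov m_ia oth_ia cC C_disj C0 C_out' cover aP' n0 i12 restE m1 m2').
Qed.
End GeneratingTuples.

Lemma max_minimal_size_infty (gT : groupType) (R : realType) (A : set gT) :
  (forall k, (3 <= k)%N -> exists2 alpha : 'I_k -> gT, injective alpha &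
     minimal_generating_set (range alpha) A) -> max_minimal_size R A = +oo%E.
Proof.
move=> gen; have ub k : (3 <= k)%N -> ((k%:R : R)%R%:E <= max_minimal_size R A)%E.
  move=> /gen[alpha inj_a min_a]; apply: ereal_sup_ubound; exists k => //=.
  exists (range alpha) => //; apply: card_eq_trans (inj_card_eq (in2W inj_a)) _.
  by rewrite card_eq_sym card_II.
case e : (max_minimal_size R A) => [x|//|].
  have := ub (maxn (Num.truncn x) 3).+1 (leqW (leq_maxr _ _)).
  by rewrite e lee_fin Order.TotalTheory.leNgt -Num.Theory.truncn_le_nat leq_maxl.
by have := ub 3%N isT; rewrite e.
Qed.

Theorem theorem7 (R : realType) (G : set (homeo cantor_space))
    (subG : subgroup G) (fgG : finitely_generated G)
    (simpleG : simple_group G) (vigG : vigorous G) :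
  (forall (k : nat) (m : 'I_k -> nat),
     (2 <= k)%N -> (forall i, (2 <= m i)%N) ->
     (k = 2%N -> range m <> [set 2%N]) ->
     exists alpha : 'I_k -> homeo cantor_space,
       [/\ injective alpha,
           minimal_generating_set (range alpha) G &
           forall i, has_order (alpha i) (m i)])
  /\ max_minimal_size R G = +oo%E.
Proof.
have first_part (k : nat) (m : 'I_k -> nat) : (2 <= k)%N -> (forall i, (2 <= m i)%N) ->
    (k = 2%N -> range m <> [set 2%N]) -> rest_gen G m.
  move=> k2 m2 m22; have [[ib mb]|no3] := pselect (exists ib, (3 <= m ib)%N).
    have [ia iab] : exists ia : 'I_k, ia != ib.
      have [ib0|ib0] := eqVneq ib (Ordinal (ltnW k2)).
        by exists (Ordinal k2); rewrite ib0.
      by exists (Ordinal (ltnW k2)); rewrite eq_sym.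
    (* Any [ia] other than [ib] can carry [alpha]; [beta] goes to [ib], whose order is at least 3.
       The subtractions invert [m'.+2] and [n'.+3]. *)
    apply: (@rest_exists G subG simpleG vigG _ ia (fun i => (i != ia) && (i != ib)) m (m ia - 2) (m ib - 3)) => //.
    - by have := m2 ia; lia.
    - by rewrite eqxx.
    left; exists ib => [|i]; first by lia.
    by rewrite /rest; case: eqVneq => [->|_] /=; rewrite ?(negPf iab) // andbT negbK.
  have m_eq2 i : m i = 2%N.
    by apply/eqP; rewrite eqn_leq m2 andbT leqNgt; apply/negP => m3; apply: no3; exists i.
  have k3 : (3 <= k)%N.
    rewrite ltn_neqAle k2 andbT; apply/eqP => k_eq; apply: (m22 (esym k_eq)).
    apply/seteqP; split=> [_ [i _ <-]|_ ->]; first exact: m_eq2.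
    by exists (Ordinal k2).
  pose j0 := Ordinal (ltnW k2); pose j1 := Ordinal k2; pose j2 := Ordinal k3.
  (* Only involutions: [j0] carries [alpha], while [j1] and [j2] share the [beta] of order 3 given
     by [n' = 0]. *)
  apply: (@rest_exists G subG simpleG vigG _ j0 (fun i => [&& i != j0, i != j1 & i != j2]) m 0 0) => //.
  right; split=> //; exists j1, j2; split=> // i.
  by rewrite /rest; case: (i =P j0) => [->|_] //=; rewrite negb_and !negbK andbT.
split=> // ; apply: max_minimal_size_infty => k k3.
have [|//|k2|alpha [inj_a min_a _]] := first_part k (fun=> 2%N); first exact: ltnW.
  by rewrite k2 in k3.
by exists alpha.
Qed.
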